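(* Let $m\ge0$ be a fixed integer. The generating function $T^{[m]}(z,u)$ of Pólya trees, where each vertex is marked by $z$ and each weighted $D$-forest of size $m$ is marked by $u$, is given by $$T^{[m]}(z,u)=C\big(u\,z\,d_mz^m+z\,(D(z)-d_mz^m)\big),$$ where $d_m=[z^m]D(z)$. The probability that the $D$-forest $F_n(v)$ attached to a random $C$-tree node $v$ (in Pólya trees of size $n$) is of size $m$ is given, as $n\to\infty$, by $$\mathbb{P}\left(|F_n(v)|=m\right)=\frac{d_m\rho^m}{D(\rho)}\left(1+O(n^{-1})\right).$$
   Context: A Pólya tree is a rooted unlabelled non-plane tree; its size is its number of nodes. Let $\mathcal{T}$ be the class of all Pólya trees, $T(z)=\sum_{n\ge1}t_nz^n$ their ordinary generating function (so $T(z)=z\exp(\sum_{i\ge1}T(z^i)/i)$), and $\rho\approx0.3383219$ its radius of convergence. Let $D(z)=\sum_{n\ge0}d_nz^n=\exp\left(\sum_{i\ge2}T(z^i)/i\right)$, which is analytic for $|z|<\sqrt\rho$, and let $C(z)$ be the unique formal power series with $C(z)=z\exp(C(z))$; then $T(z)=C(zD(z))$. Decomposition: for a Pólya tree $T$ and an automorphism $\sigma\in\operatorname{Aut}(T)$ (a permutation of the nodes), the nodes fixed by $\sigma$ form a subtree containing the root, whose nodes are the $C$-tree nodes. For a $C$-tree node $v$, the attached $D$-forest $F_\sigma(v)$ is the (possibly empty) forest consisting of the full subtrees of $T$ rooted at the children of $v$ not fixed by $\sigma$; its size is its number of nodes. Each pair $(T,\sigma)$ carries weight $1/|\operatorname{Aut}(T)|$,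 so that $$T^{[m]}(z,u)=\sum_{T\in\mathcal{T}}z^{|T|}\frac1{|\operatorname{Aut}(T)|}\sum_{\sigma\in\operatorname{Aut}(T)}u^{|\{v\,:\,\sigma(v)=v,\ |F_\sigma(v)|=m\}|}.$$ Random $C$-tree node: the triple $(T,\sigma,v)$, with $T$ a Pólya tree of size $n$, $\sigma\in\operatorname{Aut}(T)$ and $v$ a node fixed by $\sigma$, is chosen with probability proportional to $1/|\operatorname{Aut}(T)|$, and $F_n(v)=F_\sigma(v)$. Equivalently, $\mathbb{P}(|F_n(v)|=m)=\dfrac{[z^n]\,\partial_uT^{[m]}(z,u)|_{u=1}}{[z^n]\,T(z)/(1-T(z))}$, where $T(z)/(1-T(z))$ is the generating function of the total weight of $C$-tree nodes. *)

(* Defs.v *)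
From HB Require Import structures.
From mathcomp Require Export all_boot all_order all_algebra all_fingroup.
From mathcomp Require Export generic_quotient.
From mathcomp Require Export all_classical all_reals all_analysis.

Set Implicit Arguments.
Unset Strict Implicit.
Unset Printing Implicit Defensive.

Export Order.TTheory GRing.Theory Num.Theory.
Export numFieldNormedType.Exports.

Local Open Scope ring_scope.
Local Open Scope quotient_scope.

(* A wrapper type, so that the Cauchy product is not confused with the
   pointwise product that functions [nat -> A] already carry. *)
Record fps (A : Type) : Type := Fps { fps_coef :> nat -> A }.

HB.instance Definition _ (A : Type) := [isNew for @fps_coef A].
HB.instance Definition _ (A : choiceType) := [Choice of fps A by <:].

Lemma fpsP (A : Type) (F G : fps A) : (forall n, F n = G n) <-> F = G.
Proof.
by split=> [|->//]; case: F G => [f] [g] /= fg; congr Fps; apply/funext.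
Qed.

Definition fps_zero (A : comNzRingType) : fps A := Fps (fun=> 0).
Definition fps_opp (A : comNzRingType) (F : fps A) : fps A :=
  Fps (fun n => - F n).
Definition fps_add (A : comNzRingType) (F G : fps A) : fps A :=
  Fps (fun n => F n + G n).
Definition fps_one (A : comNzRingType) : fps A := Fps (fun n => (n == 0)%:R).
HB.lock Definition fps_mul (A : comNzRingType) (F G : fps A) : fps A :=
  Fps (fun n => \sum_(i < n.+1) F i * G (n - i)%N).

Lemma fps_mulE (A : comNzRingType) (F G : fps A) (n : nat) :
  fps_mul F G n = \sum_(i < n.+1) F i * G (n - i)%N.
Proof. by rewrite fps_mul.unlock. Qed.

Lemma fps_addA (A : comNzRingType) : associative (@fps_add A).
Proof. by move=> F G H; apply/fpsP => n /=; rewrite addrA. Qed.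

Lemma fps_addC (A : comNzRingType) : commutative (@fps_add A).
Proof. by move=> F G; apply/fpsP => n /=; rewrite addrC. Qed.

Lemma fps_add0 (A : comNzRingType) : left_id (fps_zero A) (@fps_add A).
Proof. by move=> F; apply/fpsP => n /=; rewrite add0r. Qed.

Lemma fps_addN (A : comNzRingType) :
  left_inverse (fps_zero A) (@fps_opp A) (@fps_add A).
Proof. by move=> F; apply/fpsP => n /=; rewrite addNr. Qed.

HB.instance Definition _ (A : comNzRingType) :=
  GRing.isZmodule.Build (fps A)
    (@fps_addA A) (@fps_addC A) (@fps_add0 A) (@fps_addN A).

Lemma fps_mulC (A : comNzRingType) : commutative (@fps_mul A).
Proof.
move=> F G; apply/fpsP => n; rewrite !fps_mulE (reindex_inj rev_ord_inj) /=.
by apply: eq_bigr => i _; rewrite subSS subKn ?leq_ord // mulrC.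
Qed.

Lemma fps_mulA (A : comNzRingType) : associative (@fps_mul A).
Proof.
have rev (F G : fps A) n :
    fps_mul F G n = \sum_(i < n.+1) F (n - i)%N * G i.
  by rewrite fps_mulC fps_mulE; apply: eq_bigr => i _; rewrite mulrC.
move=> F G H; apply/fpsP => n; rewrite fps_mulE [RHS]rev.
pose coef3 j k := F j * (G (n - j - k)%N * H k).
transitivity (\sum_(j < n.+1) \sum_(k < n.+1 | (k <= n - j)%N) coef3 j k).
  apply: eq_bigr => /= j _; rewrite rev.
  by rewrite big_distrr (big_ord_narrow_leq (leq_subr _ _)).
rewrite (exchange_big_dep predT) //=; apply: eq_bigr => k _.
transitivity (\sum_(j < n.+1 | (j <= n - k)%N) coef3 j k).
  apply: eq_bigl => j; rewrite -ltnS -(ltnS j) -!subSn ?leq_ord //.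
  by rewrite -subn_gt0 -(subn_gt0 j) -!subnDA addnC.
rewrite (big_ord_narrow_leq (leq_subr _ _)) fps_mulE big_distrl /=.
by apply: eq_bigr => j _; rewrite /coef3 -!subnDA addnC mulrA.
Qed.

Lemma fps_mul1 (A : comNzRingType) : left_id (fps_one A) (@fps_mul A).
Proof.
move=> F; apply/fpsP => n; rewrite fps_mulE big_ord_recl subn0 mul1r.
by rewrite big1 ?addr0 // => i _; rewrite mul0r.
Qed.

Lemma fps_mulDl (A : comNzRingType) :
  left_distributive (@fps_mul A) (@fps_add A).
Proof.
move=> F G H; apply/fpsP => n /=; rewrite !fps_mulE -big_split.
by apply: eq_bigr => i _; rewrite mulrDl.
Qed.

Lemma fps_one_neq0 (A : comNzRingType) : fps_one A != fps_zero A.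
Proof. by apply/eqP => /fpsP/(_ 0%N)/eqP; rewrite oner_eq0. Qed.

HB.instance Definition _ (A : comNzRingType) :=
  GRing.Zmodule_isComNzRing.Build (fps A) (@fps_mulA A) (@fps_mulC A)
    (@fps_mul1 A) (@fps_mulDl A) (@fps_one_neq0 A).

Lemma coef_fpsM (A : comNzRingType) (F G : fps A) (n : nat) :
  (F * G) n = \sum_(i < n.+1) F i * G (n - i)%N.
Proof. exact: fps_mulE. Qed.

Definition fpsC (A : comNzRingType) (a : A) : fps A :=
  Fps (fun n => if n == 0 then a else 0).

Definition fpsX (A : comNzRingType) : fps A := Fps (fun n => (n == 1%N)%:R).

Definition map_fps (A B : Type) (f : A -> B) (F : fps A) : fps B :=
  Fps (fun n => f (F n)).

(* [a(F(z))], for [F] without constant term: [F ^+ k] then starts in degree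
   at least [k], so the terms [k > n] do not contribute to [z^n]. *)
HB.lock Definition fps_comp (A : comNzRingType) (a F : fps A) : fps A :=
  Fps (fun n => \sum_(k < n.+1) a k * (F ^+ k) n).

Lemma coef_fps_comp (A : comNzRingType) (a F : fps A) (n : nat) :
  fps_comp a F n = \sum_(k < n.+1) a k * (F ^+ k) n.
Proof. by rewrite fps_comp.unlock. Qed.

Definition fps_exp (K : numFieldType) (F : fps K) : fps K :=
  fps_comp (Fps (fun k => k`!%:R^-1)) F.

(* [F(z^i)], for [0 < i]. *)
Definition fps_dilate (A : comNzRingType) (i : nat) (F : fps A) : fps A :=
  Fps (fun n => if (i %| n)%N then F (n %/ i)%N else 0).

Lemma fps_exp_eq (K : numFieldType) (F G : fps K) (n : nat) :
  (forall i, (i <= n)%N -> F i = G i) -> fps_exp F n = fps_exp G n.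
Proof.
move=> FG.
suff H k : forall i, (i <= n)%N -> (F ^+ k) i = (G ^+ k) i.
  by rewrite /fps_exp !coef_fps_comp; apply: eq_bigr => k _; rewrite (H k n).
elim: k => [|k IHk] i lein; first by rewrite !expr0.
rewrite !exprS !coef_fpsM; apply: eq_bigr => j _; congr (_ * _).
  by apply: FG; rewrite (leq_trans _ lein) // leq_ord.
by apply: IHk; rewrite (leq_trans _ lein) // leq_subr.
Qed.

Lemma coef_fpsXM (A : comNzRingType) (F : fps A) (n : nat) :
  (fpsX A * F) n = if n is n'.+1 then F n' else 0.
Proof.
rewrite coef_fpsM; case: n => [|n]; first by rewrite big_ord1 mul0r.
rewrite big_ord_recl mul0r add0r big_ord_recl mul1r subSS subn0.
by rewrite big1 ?addr0 // => i _; rewrite mul0r.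
Qed.

(* The equation [C(z) = z exp(C(z))] has a unique solution; it forces
   [C(0) = 0], so [fps_exp] is only used where it is the exponential. *)
Lemma cayley_existsU (K : numFieldType) :
  exists! C : fps K, C = fpsX K * fps_exp C.
Proof.
pose Phi (F : fps K) := fpsX K * fps_exp F.
have PhiE (F G : fps K) n : (forall i, (i < n)%N -> F i = G i) ->
    Phi F n = Phi G n.
  rewrite /Phi !coef_fpsXM; case: n => // n FG.
  by apply: fps_exp_eq => i lei; apply: FG.
pose It k : fps K := iter k Phi 0.
have ItS k : It k.+1 = Phi (It k) by [].
have It_stable k : forall i, (i < k)%N -> It k i = It k.+1 i.
  elim: k => // k IHk i lei; rewrite (ItS k) (ItS k.+1).
  apply: (PhiE (It k) (It k.+1) i) => j ltj; apply: IHk.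
  by rewrite (leq_trans ltj).
have It_le k l i : (i < k)%N -> (k <= l)%N -> It k i = It l i.
  move=> ltik; elim: l => [|l IHl]; first by rewrite leqn0 => /eqP->.
  rewrite leq_eqVlt => /predU1P[->//|lekl]; rewrite IHl //.
  by apply: It_stable; rewrite (leq_trans ltik).
exists (Fps (fun n => It n.+1 n)); split.
  apply/fpsP => n; apply: (PhiE (It n)) => i ltin.
  by apply/esym; apply: (It_le i.+1 n).
move=> G GE; apply/fpsP => n; elim/ltn_ind: n => n IHn.
rewrite [in RHS]GE; apply: (PhiE (It n)) => i ltin; rewrite -IHn //.
by apply/esym; apply: (It_le i.+1 n).
Qed.

(* A rooted tree on the node set ['I_n] is given by its parent map, where the
   root, and only it, is its own parent. *)
Definition is_rtree (n : nat) (f : {ffun 'I_n -> 'I_n}) : bool :=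
  [exists r, (f r == r) && [forall v, fconnect f v r]].

Record rtree (n : nat) : Type :=
  RTree { parent :> {ffun 'I_n -> 'I_n}; _ : is_rtree parent }.

HB.instance Definition _ (n : nat) := [isSub for @parent n].
HB.instance Definition _ (n : nat) := [Finite of rtree n by <:].

Definition child (n : nat) (t : rtree n) (v w : 'I_n) : bool :=
  (t w == v) && (w != v).

Definition is_iso (n : nat) (t t' : rtree n) (s : 'S_n) : bool :=
  [forall v, s (t v) == t' (s v)].

Definition iso (n : nat) : rel (rtree n) :=
  fun t t' => [exists s, is_iso t t' s].

Lemma iso_refl (n : nat) : reflexive (@iso n).
Proof.
by move=> t; apply/existsP; exists 1%g; apply/forallP => v; rewrite !perm1.
Qed.

Lemma iso_sym (n : nat) : symmetric (@iso n).
Proof.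
have H t t' : @iso n t t' -> iso t' t.
  case/existsP=> s /forallP ss; apply/existsP; exists (s^-1)%g.
  by apply/forallP => v; rewrite -{1}(permKV s v) -(eqP (ss _)) permK.
by move=> t t'; apply/idP/idP; apply: H.
Qed.

Lemma iso_trans (n : nat) : transitive (@iso n).
Proof.
move=> t2 t1 t3 /existsP[s /forallP ss] /existsP[s' /forallP ss'].
apply/existsP; exists (s * s')%g; apply/forallP => v.
by rewrite !permM (eqP (ss _)) (eqP (ss' _)).
Qed.

Canonical iso_equiv (n : nat) :=
  EquivRel (@iso n) (@iso_refl n) (@iso_sym n) (@iso_trans n).

(* Pólya trees of size [n]: isomorphism classes of rooted trees.  For
   [T : polya n], [repr T] is a rooted tree in the class [T]; everything below
   that is computed from [repr T] is invariant under isomorphism. *)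
Definition polya (n : nat) : Type := {eq_quot (@iso n)}.
HB.instance Definition _ (n : nat) := Choice.on (polya n).
HB.instance Definition _ (n : nat) := EqQuotient.on (polya n).
HB.instance Definition _ (n : nat) :=
  @CanIsCountable _ (polya n) _ _ (@reprK _ (polya n)).
HB.instance Definition _ (n : nat) :=
  fintype.isFinite.Build (polya n)
    (pcan_enumP (can_pcan (@reprK _ (polya n)))).

Definition Aut_rtree (n : nat) (t : rtree n) : {set 'S_n} :=
  [set s | is_iso t t s].

Definition fringe (n : nat) (t : rtree n) (v : 'I_n) : {set 'I_n} :=
  [set w | fconnect t w v].

Definition Cnodes (n : nat) (s : 'S_n) : {set 'I_n} := [set v | s v == v].

(* The node set of [F_s(v)]: the full subtrees of [t] at the children of [v]
   that [s] moves. *)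
Definition Dforest (n : nat) (t : rtree n) (s : 'S_n) (v : 'I_n) :
    {set 'I_n} :=
  \bigcup_(c | child t v c && (c \notin Cnodes s)) fringe t c.

Definition polya_gf (R : realType) : fps R :=
  Fps (fun n => #|{: polya n}|%:R).

(* [D(z) = exp(\sum_(i >= 2) T(z^i) / i)]; as [T] has no constant term,
   [T(z^i)] contributes to [z^n] only for [i <= n]. *)
Definition D_gf (R : realType) : fps R :=
  fps_exp (Fps (fun n =>
    \sum_(2 <= i < n.+1) fps_dilate i (polya_gf R) n / i%:R)).

(* [T^[m](z, u)] as a power series in [z] whose coefficients are polynomials
   in [u = 'X]. *)
Definition marked_gf (R : realType) (m : nat) : fps {poly R} :=
  Fps (fun n => \sum_(T : polya n)
    #|Aut_rtree (repr T)|%:R^-1 *: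
      \sum_(s in Aut_rtree (repr T))
        'X^#|[set v in Cnodes s | #|Dforest (repr T) s v| == m]|).

(* The supremum is finite because [T] has a coefficient at least 1 in every
   positive degree. *)
Definition polya_radius (R : realType) : R :=
  sup [set r : R | 0 <= r /\ cvgn (pseries (polya_gf R) r)]%classic.

Definition fps_eval (R : realType) (F : fps R) (x : R) : R :=
  limn (pseries F x).

(* Total weight of the triples [(T, s, v)] with [T] of size [n], [s] in
   [Aut T] and [v] fixed by [s] that satisfy [Q]. *)
Definition weight (R : realType) (n : nat)
    (Q : rtree n -> 'S_n -> 'I_n -> bool) : R :=
  \sum_(T : polya n) \sum_(s in Aut_rtree (repr T))
    \sum_(v in Cnodes s | Q (repr T) s v) #|Aut_rtree (repr T)|%:R^-1.

Definition prob_Cnode (R : realType) (n : nat)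
    (Q : rtree n -> 'S_n -> 'I_n -> bool) : R :=
  weight R Q / weight R (fun (_ : rtree n) _ _ => true).

Definition prob_Dforest_size (R : realType) (n m : nat) : R :=
  prob_Cnode R (fun (t : rtree n) s v => #|Dforest t s v| == m).

(* Main.v *)
(* Relabelling turns a Polya tree with an automorphism into a labelled tree f
   with a commuting permutation g, so T^[m] is the exponential generating
   function of such pairs.  Removing the root leaves the forest of subtrees
   with root moved by g (a D-forest) and a set of trees whose roots are fixed,
   so T^[m] = w E with w = z D (marked) and E = exp(T^[m]); the same exponential
   formula, applied to the orbits of trees permuted cyclically by g, gives
   D = exp(\sum_(i >= 2) T(z^i) / i).

   For the asymptotics no complex analysis is needed.  With
   phi(x) = e rho x D(rho x) and b_k = k^k e^-k / k!, the Lagrange formula for C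
   turns the probability into
     p_(m+1) [x^n] x^(m+1) B(phi) / [x^n] phi B(phi),  B(s) = \sum_k b_(k+1) s^k,
   where p_(m+1) = d_m rho^m / D(rho) is a coefficient of phi, the generating
   function of a probability law, because e rho D(rho) = 1.  The mean of this
   law is less than 2, hence (1 - x) / (1 - phi) has summable coefficients
   (with polynomial weights); and the coefficients of (1 - phi) B(phi) are
   O(b_n / n), since b_k - b_(k+1) <= b_k / (k + 1).  The difference
     (x^(m+1) - phi) B(phi)
   is the product of (x^(m+1) - phi) / (1 - phi) and (1 - phi) B(phi), so its
   n-th coefficient is O(b_n / n), while [x^n] phi B(phi) is at least c b_n. *)

Require Import Defs.
From mathcomp Require Import ring lra zify.

Set Implicit Arguments.
Unset Strict Implicit.
Unset Printing Implicit Defensive.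

Local Open Scope ring_scope.

(** * Formal power series *)

(** Sets of components are handled by pointing: with [fps_theta] standing for z d/dz, marking a node
    amounts to choosing its component and a node in it, so every exponential formula becomes theta F
    = F theta G. Such an equation is a recursion on coefficients that makes sense over [{poly R}]
    and has a unique solution.

    The asymptotic part rests on a Neumann series: (1 - x) / (1 - phi) is the inverse of the series
    of tails of phi, whose nonconstant part has mass mean - 1 < 1. Two requirements compete in the
    choice of the norm. Replacing b_(n-i) / (n-i) by b_n / n costs a factor of order (1 + i)^2,
    which calls for a quadratic weight, yet a quadratic weight may push the norm of the nonconstant
    part above 1. The weight (1 + e j)^2 with e small reconciles them.

    The numerical input is 0 < rho <= 1/e < 1/2. It leaves room between rho and sqrt rho, so that D
    converges beyond rho, which gives finite moments and e rho D(rho) = 1; it also bounds the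
    mean. *)

Section PowerSeries.
Variable A : comNzRingType.
Implicit Types (a b w E F G H : fps A) (n k : nat).

Lemma coef_fps1 n : (1 : fps A) n = (n == 0)%:R. Proof. by []. Qed.

Lemma coef_fpsD F G n : (F + G) n = F n + G n. Proof. by []. Qed.

Lemma coef_fpsN F n : (- F) n = - F n. Proof. by []. Qed.

Lemma coef_fpsB F G n : (F - G) n = F n - G n. Proof. by []. Qed.

Lemma coef_fps_sum (I : Type) (r : seq I) (P : pred I) (F : I -> fps A) n :
  (\sum_(i <- r | P i) F i) n = \sum_(i <- r | P i) F i n.
Proof. by elim/big_rec2: _ => //= i y1 y2 _ <-. Qed.

Lemma coef_fpsMn F k n : (F *+ k) n = F n *+ k.
Proof. by elim: k => [|k IHk]; rewrite ?mulr0n // !mulrS coef_fpsD IHk. Qed.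

Lemma coef_fpsCM c F n : (fpsC c * F) n = c * F n.
Proof.
rewrite coef_fpsM big_ord_recl /= subn0 big1 ?addr0 // => i _.
by rewrite mul0r.
Qed.

Lemma coef0_fpsM F G : (F * G) 0%N = F 0%N * G 0%N.
Proof. by rewrite coef_fpsM big_ord1. Qed.

Lemma coef_fpsXnM k F n :
  (fpsX A ^+ k * F) n = if (k <= n)%N then F (n - k)%N else 0.
Proof.
elim: k n => [|k IHk] n; first by rewrite expr0 mul1r subn0.
by rewrite exprS -mulrA coef_fpsXM; case: n.
Qed.

Lemma coef_fps_exp_eq0 F k n : F 0%N = 0 -> (n < k)%N -> (F ^+ k) n = 0.
Proof.
move=> F0; elim: k n => // k IHk n ltnk; rewrite exprS coef_fpsM big1 // => i _.
have [i0|i_gt0] := posnP i; first by rewrite i0 F0 mul0r.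
by rewrite IHk ?mulr0 //; have := ltn_ord i; lia.
Qed.

Lemma coef_fps_comp_bound a F n N : F 0%N = 0 -> (n <= N)%N ->
  fps_comp a F n = \sum_(k < N.+1) a k * (F ^+ k) n.
Proof.
move=> F0 lenN; rewrite coef_fps_comp.
rewrite (big_ord_widen N.+1 (fun k => a k * (F ^+ k) n)) ?ltnS // big_mkcond.
apply: eq_bigr => k _; case: ifPn => //; rewrite -leqNgt => ltnk.
by rewrite coef_fps_exp_eq0 ?mulr0.
Qed.

Lemma fps_comp_coef0 a F : fps_comp a F 0%N = a 0%N.
Proof. by rewrite coef_fps_comp big_ord1 expr0 mulr1. Qed.

(** Both sides are the sum over pairs (i, j) of a_i b_j [z^n] F^(i + j); the pairs with i + j > n
    vanish because [F] has no constant term. *)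
Lemma fps_compM a b F : F 0%N = 0 ->
  fps_comp (a * b) F = fps_comp a F * fps_comp b F.
Proof.
move=> F0; apply/fpsP => n; rewrite coef_fpsM.
pose h i j := a i * b j * (F ^+ (i + j)) n.
transitivity (\sum_(i < n.+1) \sum_(j < n.+1) h i j); last first.
  transitivity (\sum_(l < n.+1) \sum_(i < n.+1) \sum_(j < n.+1)
    a i * b j * ((F ^+ i) l * (F ^+ j) (n - l)%N)); last first.
    apply: eq_bigr => l _.
    rewrite (@coef_fps_comp_bound a _ l n) ?leq_ord //.
    rewrite (@coef_fps_comp_bound b _ (n - l) n) ?leq_subr //.
    rewrite big_distrl /=; apply: eq_bigr => i _; rewrite big_distrr /=.
    by apply: eq_bigr => j _; rewrite mulrACA.
  rewrite [RHS]exchange_big /=; apply: eq_bigr => i _.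
  rewrite [RHS]exchange_big /=; apply: eq_bigr => j _.
  by rewrite /h exprD coef_fpsM big_distrr.
rewrite coef_fps_comp.
transitivity (\sum_(k < n.+1) \sum_(i < n.+1 | (i <= k)%N) h i (k - i)%N).
  apply: eq_bigr => k _; rewrite coef_fpsM big_distrl /=.
  rewrite (big_ord_widen n.+1 (fun i => a i * b (k - i)%N * (F ^+ k) n)) //.
  by apply: eq_big => [i|i]; rewrite ltnS // => leik; rewrite /h subnKC.
rewrite (exchange_big_dep predT) //=; apply: eq_bigr => i _.
rewrite [RHS](bigID (fun j : 'I_n.+1 => (i + j <= n)%N)) /=.
rewrite [X in _ = _ + X]big1 ?addr0 => [|j]; last first.
  by rewrite -ltnNge => ltn; rewrite /h coef_fps_exp_eq0 ?mulr0.
rewrite -[LHS](big_mkord (fun k => (i <= k)%N) (fun k => h i (k - i)%N)).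
rewrite -[RHS](big_mkord (fun j => (i + j <= n)%N) (h i)).
rewrite (big_cat_nat (n := i)) //=; last by rewrite ltnW.
rewrite big_nat_cond big1 ?add0r => [|k /andP[/andP[_ ltki]]]; last by lia.
rewrite -{1}[nat_of_ord i]add0n big_addn.
rewrite [RHS](big_cat_nat (n := (n.+1 - i)%N)) //=; last exact: leq_subr.
rewrite [X in _ = _ + X]big_nat_cond [X in _ = _ + X]big1 ?addr0; last first.
  by move=> k /andP[/andP[]]; lia.
rewrite big_nat_cond [RHS]big_nat_cond; apply: eq_big => [k|k _].
  by apply/idP/idP; have := ltn_ord i; lia.
by rewrite addnK.
Qed.

(** The operator z d/dz; unlike the derivative it keeps degrees, so the equations below involve no
    index shift. *)
Definition fps_theta F : fps A := Fps (fun n => n%:R * F n).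

Lemma fps_thetaM F G : fps_theta (F * G) = fps_theta F * G + F * fps_theta G.
Proof.
apply/fpsP => n; rewrite coef_fpsD /= !coef_fpsM big_distrr -big_split /=.
apply: eq_bigr => i _; have {1}-> : n = (i + (n - i))%N.
  by rewrite subnKC // leq_ord.
rewrite natrD; ring.
Qed.

Lemma fps_theta1 : fps_theta 1 = 0.
Proof. by apply/fpsP => -[|n] /=; rewrite ?mul0r ?mulr0. Qed.

Lemma fps_thetaX_exp F k :
  fps_theta (F ^+ k) = fps_theta F * F ^+ k.-1 *+ k.
Proof.
elim: k => [|k IHk]; first by rewrite expr0 fps_theta1 mulr0n.
rewrite exprS fps_thetaM IHk /=; case: k IHk => [|k] _.
  by rewrite expr0 mulr0n mulr0 addr0 mulr1n.
rewrite /= [in RHS]mulrS; congr (_ + _).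
by rewrite mulrnAr mulrCA -exprS.
Qed.

Definition fps_deriv F : fps A := Fps (fun n => n.+1%:R * F n.+1).

Lemma fps_theta_deriv F : fps_theta F = fpsX A * fps_deriv F.
Proof.
by apply/fpsP => -[|n]; rewrite coef_fpsXM //= mul0r.
Qed.

Lemma fps_theta_comp a F : F 0%N = 0 ->
  fps_theta (fps_comp a F) = fps_comp (fps_deriv a) F * fps_theta F.
Proof.
move=> F0; apply/fpsP => n /=.
rewrite coef_fps_comp big_distrr /= big_ord_recl expr0 coef_fps1.
have -> : n%:R * (a (@ord0 n) * (n == 0%N)%:R) = 0 :> A.
  by case: n => [|n]; rewrite ?mul0r // !mulr0.
rewrite add0r coef_fpsM.
transitivity (\sum_(l < n.+1) \sum_(k < n)
    a k.+1 *+ k.+1 * ((F ^+ k) l * fps_theta F (n - l)%N)); last first.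
  apply: eq_bigr => l _; have [l0|l_lt] := ltnP l n; last first.
    have -> : (n - l = 0)%N by apply/eqP; rewrite subn_eq0.
    by rewrite /= mul0r mulr0 big1 // => k _; rewrite !mulr0.
  rewrite (@coef_fps_comp_bound _ _ l n.-1) //; last by lia.
    rewrite prednK; last by lia.
  rewrite big_distrl /=; apply: eq_bigr => k _.
  by rewrite -[a k.+1 *+ _]mulr_natl !mulrA.
rewrite exchange_big /=; apply: eq_bigr => k _; rewrite /bump /= add1n.
have /fpsP/(_ n)/= E := fps_thetaX_exp F k.+1.
rewrite mulrCA E coef_fpsMn mulrnAr -mulr_natr mulrAC mulr_natr.
rewrite mulrC [fps_theta F * _]mulrC coef_fpsM big_distrl /=.
by apply: eq_bigr => l _; rewrite mulrC.
Qed.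

Lemma fps_compX F : F 0%N = 0 -> fps_comp (fpsX A) F = F.
Proof.
move=> F0; apply/fpsP => -[|n]; first by rewrite fps_comp_coef0 F0.
rewrite coef_fps_comp 2!big_ord_recl mul0r add0r big1 ?addr0 => [|i _].
  by rewrite mul1r expr1.
by rewrite mul0r.
Qed.

Lemma fpsX_mulI : injective ( *%R (fpsX A)).
Proof.
by move=> F G FG; apply/fpsP => n; have /fpsP/(_ n.+1) := FG; rewrite !coef_fpsXM.
Qed.

(** Cancellation of positive integers holds in a field of characteristic 0 and also in [{poly R}];
    both rings occur below. *)
Hypothesis natr_reg : forall n (x : A), n.+1%:R * x = 0 -> x = 0.

(** As H(0) = 0, coefficient n + 1 of F H involves only F_0, ..., F_n, so the equation is a
    recursion that determines F from F_0. *)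
Lemma fps_theta_mul_uniq F G H : H 0%N = 0 -> F 0%N = G 0%N ->
  fps_theta F = F * H -> fps_theta G = G * H -> F = G.
Proof.
move=> H0 FG0 /fpsP FE /fpsP GE; apply/fpsP => n.
elim/ltn_ind: n => -[//|n] IHn; apply/subr0_eq/(@natr_reg n); rewrite mulrBr.
apply/eqP; rewrite subr_eq0; apply/eqP; rewrite [LHS]FE [RHS]GE !coef_fpsM.
rewrite [LHS]big_ord_recr [RHS]big_ord_recr /= subnn H0 !mulr0 !addr0.
by apply: eq_bigr => i _; rewrite IHn // ltnS ltnW.
Qed.

(* The system [P = w E], [z E' = E z P'] encodes [P = w exp(P)] without
   division by factorials. *)
Lemma fps_treelike_uniq w (E1 E2 : fps A) : w 0%N = 0 -> E1 0%N = E2 0%N ->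
  fps_theta E1 = E1 * fps_theta (w * E1) ->
  fps_theta E2 = E2 * fps_theta (w * E2) -> E1 = E2.
Proof.
move=> w0 E0 /fpsP H1 /fpsP H2; apply/fpsP => n.
elim/ltn_ind: n => -[//|n] IHn; apply/subr0_eq/(@natr_reg n); rewrite mulrBr.
apply/eqP; rewrite subr_eq0; apply/eqP; rewrite [LHS]H1 [RHS]H2 !coef_fpsM.
rewrite [LHS]big_ord_recr [RHS]big_ord_recr /= subnn !mul0r !mulr0 !addr0.
apply: eq_bigr => i _; rewrite IHn //; congr (_ * (_ * _)).
rewrite !coef_fpsM [LHS]big_ord_recl [RHS]big_ord_recl w0 !mul0r !add0r; apply: eq_bigr => j _.
by rewrite IHn //= /bump /=; lia.
Qed.

End PowerSeries.

Lemma map_fpsM (A B : comNzRingType) (h : {rmorphism A -> B}) (F G : fps A) :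
  map_fps h (F * G) = map_fps h F * map_fps h G.
Proof.
apply/fpsP => n; rewrite coef_fpsM /= coef_fpsM rmorph_sum.
by apply: eq_bigr => i _; rewrite rmorphM.
Qed.

Lemma map_fpsX (A B : comNzRingType) (h : {rmorphism A -> B}) :
  map_fps h (fpsX A) = fpsX B.
Proof. by apply/fpsP => n /=; rewrite rmorph_nat. Qed.

Lemma map_fps_theta (A B : comNzRingType) (h : {rmorphism A -> B}) (F : fps A) :
  map_fps h (fps_theta F) = fps_theta (map_fps h F).
Proof. by apply/fpsP => n /=; rewrite rmorphM rmorph_nat. Qed.

Lemma map_fps_exp (A B : comNzRingType) (h : {rmorphism A -> B}) (F : fps A) k :
  map_fps h (F ^+ k) = map_fps h F ^+ k.
Proof.
elim: k => [|k IHk]; last by rewrite !exprS map_fpsM IHk.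
by rewrite !expr0; apply/fpsP => n /=; rewrite rmorph_nat.
Qed.

Lemma map_fps_comp (A B : comNzRingType) (h : {rmorphism A -> B}) (a F : fps A) :
  map_fps h (fps_comp a F) = fps_comp (map_fps h a) (map_fps h F).
Proof.
apply/fpsP => n; rewrite coef_fps_comp /= coef_fps_comp rmorph_sum.
by apply: eq_bigr => i _; rewrite rmorphM -map_fps_exp.
Qed.

Section Exponential.
Variable K : numFieldType.
Implicit Types F : fps K.

Lemma fps_exp_coef0 F : fps_exp F 0%N = 1.
Proof. by rewrite fps_comp_coef0 /= fact0 invr1. Qed.

Lemma fps_theta_exp F : F 0%N = 0 ->
  fps_theta (fps_exp F) = fps_exp F * fps_theta F.
Proof.
move=> F0; rewrite fps_theta_comp //; congr (fps_comp _ _ * _).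
by apply/fpsP => n /=; rewrite factS natrM invfM mulrA mulfV ?mul1r.
Qed.

End Exponential.

Lemma natr_reg_field (K : numFieldType) n (x : K) : n.+1%:R * x = 0 -> x = 0.
Proof. by move/eqP; rewrite mulf_eq0 pnatr_eq0 /= => /eqP. Qed.

Lemma natr_reg_poly (K : numFieldType) n (p : {poly K}) : n.+1%:R * p = 0 -> p = 0.
Proof.
by move/eqP; rewrite mulf_eq0 -polyC_natr polyC_eq0 pnatr_eq0 /= => /eqP.
Qed.

Lemma cayley_fps_coef0 (K : numFieldType) (C : fps K) :
  C = fpsX K * fps_exp C -> C 0%N = 0.
Proof. by move=> ->; rewrite coef_fpsXM. Qed.

(** With S = exp(C) one has C(w) = w S(w), and S' = S C' shows that S(w) solves the same system as
    [E]. Uniqueness gives E = S(w). *)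
Lemma fps_comp_cayley (K : numFieldType) (C : fps K) (w E : fps {poly K}) :
    C = fpsX K * fps_exp C -> w 0%N = 0 -> E 0%N = 1 ->
    fps_theta E = E * fps_theta (w * E) ->
  w * E = fps_comp (map_fps polyC C) w.
Proof.
move=> hC w0 E0 hE; have C0 := cayley_fps_coef0 hC.
pose S := fps_exp C; pose E' := fps_comp (map_fps polyC S) w.
have CE : fps_comp (map_fps polyC C) w = w * E'.
  by rewrite {1}hC map_fpsM fps_compM // map_fpsX fps_compX.
rewrite CE; congr (_ * _); apply: (fps_treelike_uniq (@natr_reg_poly K) w0) => //.
  by rewrite E0 fps_comp_coef0 /= fps_exp_coef0.
rewrite -CE !fps_theta_comp // mulrA -fps_compM //; congr (fps_comp _ _ * _).
(* Multiplication by z turns the identity S' = S C' into one about [fps_theta]. *)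
apply: fpsX_mulI; rewrite /= mulrCA -!fps_theta_deriv -!map_fps_theta -map_fpsM.
by rewrite fps_theta_exp.
Qed.

(** * Labelled forests with an automorphism *)

Definition stable (X : finType) (K : {set X}) (f : X -> X) : bool :=
  [forall v, (f v \in K) == (v \in K)].

Lemma stableP (X : finType) (K : {set X}) (f : X -> X) :
  reflect (forall v, (f v \in K) = (v \in K)) (stable K f).
Proof. by apply: (iffP forallP) => H v; apply/eqP/H. Qed.

Lemma stable_iter (X : finType) (K : {set X}) (f : X -> X) a v :
  stable K f -> (iter a f v \in K) = (v \in K).
Proof. by move=> /stableP Kf; elim: a => //= a IHa; rewrite Kf. Qed.

Lemma stableC (X : finType) (K : {set X}) (f : X -> X) :
  stable (~: K) f = stable K f.
Proof. by apply: eq_forallb => v; rewrite !inE (inj_eq negb_inj). Qed.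

Lemma stableT (X : finType) (f : X -> X) : stable [set: X] f.
Proof. by apply/stableP => v; rewrite !inE. Qed.

Section Structures.
Variable A : comNzRingType.

(* A structure on the node set [K] is a pair of self-maps of [X] that preserve
   [K]; only their values on [K] matter. *)
Definition weighting := forall X : finType, {set X} -> (X -> X) -> (X -> X) -> A.

Record transports (X Y : finType) (h : X -> Y) (K : {set X})
    (f g : X -> X) (f' g' : Y -> Y) : Prop := Transports {
  tr_inj : injective h;
  tr_stf : stable K f; tr_stg : stable K g;
  tr_stf' : stable (h @: K) f'; tr_stg' : stable (h @: K) g';
  tr_f : forall x, x \in K -> f' (h x) = h (f x);
  tr_g : forall x, x \in K -> g' (h x) = h (g x) }.

(** Invariance under relabelling. With [h] the identity it also says that values outside [K] are
    ignored; this is [natural_local]. *)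
Definition natural (a : weighting) : Prop :=
  forall (X Y : finType) (h : X -> Y) (K : {set X}) f g f' g',
    transports h K f g f' g' -> a Y (h @: K) f' g' = a X K f g.

Definition pmap1 (X : finType) (F : {ffun X -> X * X}) (v : X) : X := (F v).1.
Definition pmap2 (X : finType) (F : {ffun X -> X * X}) (v : X) : X := (F v).2.

(** Making both maps the identity off [K] selects one representative, so that [total_weight] counts
    each structure on [K] once. *)
Definition supported (X : finType) (K : {set X}) (F : {ffun X -> X * X}) : bool :=
  [forall v, if v \in K then ((F v).1 \in K) && ((F v).2 \in K)
             else F v == (v, v)].

Lemma supportedP (X : finType) (K : {set X}) (F : {ffun X -> X * X}) :
  reflect [/\ forall v, v \notin K -> F v = (v, v),
              forall v, v \in K -> (F v).1 \in K &
              forall v, v \in K -> (F v).2 \in K] (supported K F).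
Proof.
apply: (iffP forallP) => [H|[H0 H1 H2] v].
  split=> v Kv; have := H v; first by rewrite (negPf Kv) => /eqP.
    by rewrite Kv => /andP[].
  by rewrite Kv => /andP[].
by case: ifPn => [Kv|/H0/eqP//]; rewrite H1 ?H2.
Qed.

Lemma supportedT (X : finType) (F : {ffun X -> X * X}) : supported [set: X] F.
Proof. by apply/supportedP; split=> v; rewrite ?inE. Qed.

Lemma supported_stable1 (X : finType) (K : {set X}) (F : {ffun X -> X * X}) :
  supported K F -> stable K (pmap1 F).
Proof.
case/supportedP=> H0 H1 _; apply/stableP => v; rewrite /pmap1.
by have [/H1//|nKv] := boolP (v \in K); rewrite H0 //= (negPf nKv).
Qed.

Lemma supported_stable2 (X : finType) (K : {set X}) (F : {ffun X -> X * X}) :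
  supported K F -> stable K (pmap2 F).
Proof.
case/supportedP=> H0 _ H1; apply/stableP => v; rewrite /pmap2.
by have [/H1//|nKv] := boolP (v \in K); rewrite H0 //= (negPf nKv).
Qed.

Definition total_weight (a : weighting) (X : finType) (K : {set X}) : A :=
  \sum_(F : {ffun X -> X * X} | supported K F) a X K (pmap1 F) (pmap2 F).

Lemma total_weight_transport (a : weighting) (X Y : finType) (h : X -> Y)
    (K : {set X}) :
  natural a -> injective h -> total_weight a (h @: K) = total_weight a K.
Proof.
move=> na h_inj.
pose push (F : {ffun X -> X * X}) : {ffun Y -> Y * Y} := [ffun y =>
  if [pick x in K | h x == y] is Some x then (h (F x).1, h (F x).2) else (y, y)].
pose hinv x0 y := odflt x0 [pick x | h x == y].
pose pull (G : {ffun Y -> Y * Y}) : {ffun X -> X * X} := [ffun x =>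
  if x \in K then (hinv x (G (h x)).1, hinv x (G (h x)).2) else (x, x)].
have hinvK x0 x : hinv x0 (h x) = x.
  rewrite /hinv; case: pickP => [x' /eqP/h_inj//|/(_ x)].
  by rewrite eqxx.
have pushK F x : x \in K -> push F (h x) = (h (F x).1, h (F x).2).
  move=> Kx; rewrite ffunE; case: pickP => [x' /andP[_ /eqP/h_inj->]//|/(_ x)].
  by rewrite Kx eqxx.
have pushN F y : y \notin h @: K -> push F y = (y, y).
  move=> nKy; rewrite ffunE; case: pickP => // x /andP[Kx /eqP hx].
  by rewrite -hx imset_f in nKy.
rewrite /total_weight (reindex_onto push pull) => [|G /supportedP[G0 G1 G2]] /=.
  apply: eq_big => [F|F /andP[pF /eqP FE]].
    apply/idP/idP => [/andP[/supportedP[H0 H1 H2] /eqP FE]|/supportedP[H0 H1 H2]].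
      apply/supportedP; split=> v Kv.
      - by rewrite -FE ffunE (negPf Kv).
      - by have := H1 _ (imset_f h Kv); rewrite pushK //= mem_imset.
      - by have := H2 _ (imset_f h Kv); rewrite pushK //= mem_imset.
    apply/andP; split.
      apply/supportedP; split=> y Ky; first exact: pushN.
        by case/imsetP: Ky => x Kx ->; rewrite pushK //= mem_imset ?H1.
      by case/imsetP: Ky => x Kx ->; rewrite pushK //= mem_imset ?H2.
    apply/eqP/ffunP => x; rewrite ffunE; case: ifPn => [Kx|/H0->//].
    by rewrite pushK //= !hinvK -surjective_pairing.
  apply: na; split=> //; [| |exact: supported_stable1|exact: supported_stable2
    |by move=> x Kx; rewrite /pmap1 pushK|by move=> x Kx; rewrite /pmap2 pushK].
    apply/stableP => v; rewrite /pmap1 -FE.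
    have [Kv|nKv] := boolP (v \in K); last by rewrite ffunE (negPf nKv) /= (negPf nKv).
    have /supportedP[_ H1 _] := pF; have := H1 _ (imset_f h Kv).
    by rewrite pushK //= mem_imset // => H; rewrite ffunE Kv /= pushK //= hinvK H.
  apply/stableP => v; rewrite /pmap2 -FE.
  have [Kv|nKv] := boolP (v \in K); last by rewrite ffunE (negPf nKv) /= (negPf nKv).
  have /supportedP[_ _ H1] := pF; have := H1 _ (imset_f h Kv).
  by rewrite pushK //= mem_imset // => H; rewrite ffunE Kv /= pushK //= hinvK H.
apply/ffunP => y; have [/imsetP[x Kx ->]|nKy] := boolP (y \in h @: K); last first.
  by rewrite pushN ?G0.
rewrite pushK // ffunE Kx /=.
have /imsetP[x1 _ E1] := G1 _ (imset_f h Kx).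
have /imsetP[x2 _ E2] := G2 _ (imset_f h Kx).
by rewrite E1 E2 !hinvK -E1 -E2 -surjective_pairing.
Qed.

Lemma transports_id (X : finType) (K : {set X}) (f g f' g' : X -> X) :
  stable K f -> stable K g -> stable K f' -> stable K g' ->
  {in K, f' =1 f} -> {in K, g' =1 g} -> transports id K f g f' g'.
Proof. by move=> *; split=> //; rewrite imset_id. Qed.

Lemma natural_local (a : weighting) (X : finType) (K : {set X}) (f g f' g' : X -> X) :
  natural a -> stable K f -> stable K g -> stable K f' -> stable K g' ->
  {in K, f' =1 f} -> {in K, g' =1 g} -> a X K f' g' = a X K f g.
Proof.
move=> na sf sg sf' sg' ff gg.
by have := na _ _ _ _ _ _ _ _ (transports_id sf sg sf' sg' ff gg); rewrite imset_id.
Qed.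

(** A pair of maps that preserves [K] amounts to a structure on [K] and one on its complement;
    [glue] and the two restrictions [rst] are the bijections. *)
Lemma total_weightM (a b : weighting) (X : finType) (K : {set X}) :
  natural a -> natural b ->
  \sum_(F : {ffun X -> X * X} | stable K (pmap1 F) && stable K (pmap2 F))
    a X K (pmap1 F) (pmap2 F) * b X (~: K) (pmap1 F) (pmap2 F) =
  total_weight a K * total_weight b (~: K).
Proof.
move=> na nb; rewrite /total_weight big_distrl /=.
under [RHS]eq_bigr do rewrite big_distrr /=.
rewrite pair_big /=.
pose glue (PQ : {ffun X -> X * X} * {ffun X -> X * X}) : {ffun X -> X * X} :=
  [ffun v => if v \in K then PQ.1 v else PQ.2 v].
pose rst (L : {set X}) (F : {ffun X -> X * X}) : {ffun X -> X * X} :=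
  [ffun v => if v \in L then F v else (v, v)].
rewrite (reindex_onto glue (fun F => (rst K F, rst (~: K) F))) /=; last first.
  by move=> F _; apply/ffunP => v; rewrite !ffunE inE; case: (v \in K).
have glueE P Q v : glue (P, Q) v = if v \in K then P v else Q v by rewrite ffunE.
apply: eq_big => [[P Q]|[P Q]].
  rewrite /=; apply/idP/idP.
    case/andP=> /andP[/stableP s1 /stableP s2] /eqP[PE QE]; apply/andP.
    split; apply/supportedP; split=> v; rewrite ?inE => Kv.
    - by rewrite -PE ffunE (negPf Kv).
    - by have := s1 v; rewrite /pmap1 glueE Kv.
    - by have := s2 v; rewrite /pmap2 glueE Kv.
    - by rewrite -QE ffunE inE (negPf Kv).
    - by have := s1 v; rewrite /pmap1 glueE (negPf Kv) => ->.
    - by have := s2 v; rewrite /pmap2 glueE (negPf Kv) => ->.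
  case/andP=> /supportedP[P0 P1 P2] /supportedP[Q0 Q1 Q2].
  have Q1' v : v \notin K -> ((Q v).1 \in K) = false.
    by move=> Kv; apply/negbTE; have := Q1 v; rewrite !inE; exact.
  have Q2' v : v \notin K -> ((Q v).2 \in K) = false.
    by move=> Kv; apply/negbTE; have := Q2 v; rewrite !inE; exact.
  apply/andP; split; last first.
    rewrite xpair_eqE; apply/andP; split; apply/eqP/ffunP => v; rewrite ffunE glueE.
      by have [Kv|Kv] := boolP (v \in K); last rewrite P0.
    by rewrite inE; have [Kv|//] := boolP (v \in K); rewrite /= Q0 ?inE ?Kv.
  apply/andP; split; apply/stableP => v; rewrite /pmap1 /pmap2 glueE.
    by case: ifPn => [/P1//|/Q1'].
  by case: ifPn => [/P2//|/Q2'].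
case/andP=> /andP[s1 s2] /eqP[PE QE].
have sP : supported K P.
  apply/supportedP; split=> v Kv.
  - by rewrite -PE ffunE (negPf Kv).
  - by have /stableP/(_ v) := s1; rewrite /pmap1 glueE Kv.
  - by have /stableP/(_ v) := s2; rewrite /pmap2 glueE Kv.
have sQ : supported (~: K) Q.
  apply/supportedP; split=> v; rewrite ?inE => Kv.
  - by rewrite -QE ffunE inE (negPf Kv).
  - by have /stableP/(_ v) := s1; rewrite /pmap1 glueE (negPf Kv) => ->.
  - by have /stableP/(_ v) := s2; rewrite /pmap2 glueE (negPf Kv) => ->.
congr (_ * _); apply: natural_local; rewrite ?stableC //;
  try exact: supported_stable1; try exact: supported_stable2;
  try by rewrite -stableC; exact: supported_stable1.
- by move=> v Kv; rewrite /pmap1 glueE Kv.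
- by move=> v Kv; rewrite /pmap2 glueE Kv.
- by rewrite -stableC; exact: supported_stable2.
- by move=> v; rewrite inE => Kv; rewrite /pmap1 glueE (negPf Kv).
- by move=> v; rewrite inE => Kv; rewrite /pmap2 glueE (negPf Kv).
Qed.

End Structures.

Lemma sum_subsets_card (A : nmodType) (X : finType) (F : nat -> A) :
  \sum_(K : {set X}) F #|K| = \sum_(k < #|X|.+1) F k *+ 'C(#|X|, k).
Proof.
rewrite (partition_big (fun K : {set X} => inord #|K| : 'I_#|X|.+1) predT) //=.
apply: eq_bigr => k _; rewrite -card_draws -sumr_const.
apply: eq_big => [K|K /eqP <-].
  rewrite inE /= -val_eqE /= inordK //.
  by rewrite ltnS max_card.
by rewrite inordK // ltnS max_card.
Qed.

(** * Exponential generating functions of weightings *)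

Section EGF.
Variable R : realType.
Local Notation PR := {poly R}.
Implicit Types a b : weighting PR.

Lemma total_weight_card a (X : finType) (K : {set X}) :
  natural a -> total_weight a K = total_weight a [set: 'I_#|K|].
Proof.
move=> na; have [x0|K0] := pickP (mem K); last first.
  have K_eq0 : #|K| = 0%N by apply: eq_card0.
  have inj (i : 'I_#|K|) : False by case: i => i; rewrite K_eq0.
  pose h (i : 'I_#|K|) : X := False_rect X (inj i).
  have E : h @: [set: 'I_#|K|] = K.
    apply/setP => x; rewrite (K0 x : (x \in K) = false).
    by apply/imsetP => -[i]; case: (inj i).
  rewrite -[in LHS]E; apply: total_weight_transport => // i; case: (inj i).
move=> Kx; have h_inj : injective (@enum_val X (mem K)) by exact: enum_val_inj.
suff E : [set enum_val i | i in [set: 'I_#|K|]] = K.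
  by rewrite -[in LHS]E; apply: total_weight_transport.
apply/setP => x; apply/imsetP/idP => [[i _ ->]|xK]; first exact: enum_valP.
by exists (enum_rank_in xK x); rewrite ?enum_rankK_in.
Qed.

Definition egf a : fps PR :=
  Fps (fun n => n`!%:R^-1 *: total_weight a [set: 'I_n]).

Lemma egfK a n : n`!%:R *: egf a n = total_weight a [set: 'I_n].
Proof. by rewrite /= scalerA mulfV ?scale1r // pnatr_eq0 -lt0n fact_gt0. Qed.

(** The labelled product: grouping the subsets by their size k produces the binomial coefficient n!
    / (k! (n - k)!). *)
Lemma egfM a b n : natural a -> natural b ->
  n`!%:R *: (egf a * egf b) n =
  \sum_(K : {set 'I_n}) total_weight a K * total_weight b (~: K).
Proof.
move=> na nb.
transitivity (\sum_(K : {set 'I_n})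
    total_weight a [set: 'I_#|K|] * total_weight b [set: 'I_(n - #|K|)]); last first.
  apply: eq_bigr => K _; congr (_ * _); first by rewrite -total_weight_card.
  by rewrite [RHS](total_weight_card _ nb) [in RHS]cardsCs finset.setCK card_ord.
rewrite (@sum_subsets_card _ _ (fun k =>
  total_weight a [set: 'I_k] * total_weight b [set: 'I_(n - k)])).
rewrite card_ord coef_fpsM scaler_sumr; apply: eq_bigr => k _ /=.
rewrite -scalerAl -scalerAr !scalerA -[in RHS]scaler_nat.
congr (_ *: _); rewrite -(bin_fact (leq_ord k)) !natrM; field.
by rewrite !pnatr_eq0 -!lt0n !fact_gt0.
Qed.

End EGF.

(** * Predicates on forests with an automorphism *)

Definition pred_struct := forall X : finType, {set X} -> (X -> X) -> (X -> X) -> Prop.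

Definition natural_pred (P : pred_struct) : Prop :=
  forall (X Y : finType) (h : X -> Y) (K : {set X}) f g f' g',
    transports h K f g f' g' -> (P Y (h @: K) f' g' <-> P X K f g).

(* A rooted forest [f] on [K], given by its parent map with roots as fixed
   points, and an automorphism [g] of it. *)
Definition forest_aut : pred_struct := fun X K f g =>
  [/\ forall v, v \in K -> f (g v) = g (f v),
      forall v w, v \in K -> w \in K -> g v = g w -> v = w &
      forall v, v \in K -> exists a, f (iter a f v) = iter a f v].

Definition roots_fixed : pred_struct := fun X K f g =>
  forall v, v \in K -> f v = v -> g v = v.

Definition all_moved : pred_struct := fun X K f g =>
  forall v, v \in K -> g v <> v.

(** All roots lie in one [g]-orbit. These are the connected structures of the exponential formula:
    one tree, or several trees permuted cyclically by [g]. The empty set qualifies vacuously. *)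
Definition linked : pred_struct := fun X K f g =>
  forall v w, v \in K -> w \in K -> exists a b c,
    [/\ f (iter a f v) = iter a f v, f (iter b f w) = iter b f w &
        iter c g (iter a f v) = iter b f w].

Section Transports.
Variables (X Y : finType) (h : X -> Y) (K : {set X}).
Variables (f g : X -> X) (f' g' : Y -> Y).
Hypothesis tr : transports h K f g f' g'.

Lemma tr_iter_f a x : x \in K -> iter a f' (h x) = h (iter a f x).
Proof.
move=> Kx; elim: a => //= a ->.
by rewrite (tr_f tr) // stable_iter // (tr_stf tr).
Qed.

Lemma tr_iter_g a x : x \in K -> iter a g' (h x) = h (iter a g x).
Proof.
move=> Kx; elim: a => //= a ->.
by rewrite (tr_g tr) // stable_iter // (tr_stg tr).
Qed.

Lemma tr_mem_f x : x \in K -> f x \in K.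
Proof. by move=> Kx; have /stableP-> := tr_stf tr. Qed.

Lemma tr_mem_g x : x \in K -> g x \in K.
Proof. by move=> Kx; have /stableP-> := tr_stg tr. Qed.

Lemma tr_mem_iter a x : x \in K -> iter a f x \in K.
Proof. by move=> Kx; rewrite stable_iter // (tr_stf tr). Qed.

Lemma tr_forall (P : Y -> Prop) :
  (forall y, y \in h @: K -> P y) <-> (forall x, x \in K -> P (h x)).
Proof.
split=> [H x Kx|H y /imsetP[x Kx ->]]; last exact: H.
by apply: H; rewrite imset_f.
Qed.

End Transports.

Lemma natural_forest_aut : natural_pred forest_aut.
Proof.
move=> X Y h K f g f' g' tr; have h_inj := tr_inj tr.
split=> -[H1 H2 H3]; split.
- move=> v Kv; apply: h_inj; have := H1 _ (imset_f h Kv).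
  rewrite (tr_g tr) // (tr_f tr) ?(tr_mem_g tr) // (tr_f tr) //.
  by rewrite (tr_g tr) ?(tr_mem_f tr).
- move=> v w Kv Kw gvw; apply: h_inj; apply: H2; rewrite ?imset_f //.
  by rewrite !(tr_g tr) // gvw.
- move=> v Kv; have [a] := H3 _ (imset_f h Kv).
  rewrite (tr_iter_f tr) // (tr_f tr) ?(tr_mem_iter tr) // => /h_inj aP.
  by exists a.
- apply/tr_forall => v Kv.
  rewrite (tr_g tr) // (tr_f tr) ?(tr_mem_g tr) // (tr_f tr) //.
  by rewrite (tr_g tr) ?(tr_mem_f tr) // H1.
- move=> _ _ /imsetP[v Kv ->] /imsetP[w Kw ->].
  by rewrite !(tr_g tr) // => /h_inj /H2->.
- apply/tr_forall => v Kv; have [a aP] := H3 _ Kv; exists a.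
  by rewrite (tr_iter_f tr) // (tr_f tr) ?(tr_mem_iter tr) // aP.
Qed.

Lemma natural_roots_fixed : natural_pred roots_fixed.
Proof.
move=> X Y h K f g f' g' tr; have h_inj := tr_inj tr.
apply: (iff_trans (tr_forall _ _ _)); split=> H v Kv.
  by move=> fv; apply: h_inj; rewrite -(tr_g tr) // H // (tr_f tr) // fv.
by rewrite (tr_f tr) // (tr_g tr) // => /h_inj /H->.
Qed.

Lemma natural_all_moved : natural_pred all_moved.
Proof.
move=> X Y h K f g f' g' tr; have h_inj := tr_inj tr.
apply: (iff_trans (tr_forall _ _ _)); split=> H v Kv.
  by move=> gv; apply: (H v Kv); rewrite (tr_g tr) // gv.
by rewrite (tr_g tr) // => /h_inj /H; apply.
Qed.

Lemma natural_linked : natural_pred linked.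
Proof.
move=> X Y h K f g f' g' tr; have h_inj := tr_inj tr.
split=> H.
  move=> v w Kv Kw; have [a [b [c]]] := H _ _ (imset_f h Kv) (imset_f h Kw).
  rewrite !(tr_iter_f tr) // !(tr_f tr) ?(tr_mem_iter tr) //.
  rewrite (tr_iter_g tr) ?(tr_mem_iter tr) // => -[/h_inj aP /h_inj bP /h_inj cP].
  by exists a, b, c.
move=> _ _ /imsetP[v Kv ->] /imsetP[w Kw ->].
have [a [b [c [aP bP cP]]]] := H _ _ Kv Kw; exists a, b, c.
rewrite !(tr_iter_f tr) // !(tr_f tr) ?(tr_mem_iter tr) //.
by rewrite (tr_iter_g tr) ?(tr_mem_iter tr) // aP bP cP.
Qed.

Lemma natural_predI (P Q : pred_struct) : natural_pred P -> natural_pred Q ->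
  natural_pred (fun X K f g => P X K f g /\ Q X K f g).
Proof.
move=> nP nQ X Y h K f g f' g' tr.
by split=> -[p q]; split; apply/(nP _ _ _ _ _ _ _ _ tr)||apply/(nQ _ _ _ _ _ _ _ _ tr).
Qed.

Section Weightings.
Variable A : comNzRingType.
Implicit Types a b : weighting A.

Definition ind (P : pred_struct) : weighting A := fun X K f g => `[< P X K f g >]%:R.

Definition wmul a b : weighting A := fun X K f g => a X K f g * b X K f g.

Lemma natural_ind (P : pred_struct) : natural_pred P -> natural (ind P).
Proof.
move=> nP X Y h K f g f' g' tr; rewrite /ind; congr (_ %:R); congr nat_of_bool.
by apply/asboolP/asboolP => /(nP _ _ _ _ _ _ _ _ tr).
Qed.

Lemma natural_wmul a b : natural a -> natural b -> natural (wmul a b).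
Proof. by move=> na nb X Y h K f g f' g' tr; rewrite /wmul (na _ _ _ _ _ _ _ _ tr) (nb _ _ _ _ _ _ _ _ tr). Qed.

Lemma natural_card (F : nat -> A) :
  natural (fun X (K : {set X}) _ _ => F #|K|).
Proof. by move=> X Y h K f g f' g' tr; rewrite card_imset //; exact: tr_inj tr. Qed.

Definition multiplicative a : Prop := forall (X : finType) (K : {set X}) f g,
  stable K f -> stable K g ->
  a X [set: X] f g = a X K f g * a X (~: K) f g.

End Weightings.

(** * Components and the exponential formula *)

Section Components.
Variables (X : finType) (f g : X -> X).
Hypothesis fgT : forest_aut [set: X] f g.

Let fgC v : f (g v) = g (f v). Proof. by have [H _ _] := fgT; rewrite H ?inE. Qed.

Let g_inj : injective g.
Proof. by move=> v w; have [_ H _] := fgT; apply: H; rewrite ?inE. Qed.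

Lemma root_ex v : exists a, f (iter a f v) == iter a f v.
Proof. by have [_ _ H] := fgT; have [a] := H v (finset.in_setT _); exists a; apply/eqP. Qed.

Definition root_of v : X := iter (xchoose (root_ex v)) f v.

Lemma root_ofK v : f (root_of v) = root_of v.
Proof. exact/eqP/(xchooseP (root_ex v)). Qed.

Lemma root_of_iter v : exists a, root_of v = iter a f v.
Proof. by eexists. Qed.

Lemma root_of_uniq a v : f (iter a f v) = iter a f v -> iter a f v = root_of v.
Proof.
have stab b c w : f (iter b f w) = iter b f w -> iter (b + c) f w = iter b f w.
  by move=> E; elim: c => [|c IHc]; rewrite ?addn0 // addnS /= IHc.
move=> E; have E' := root_ofK v; rewrite /root_of in E' *.
set b := xchoose _ in E' *.
have [le_ab|le_ba] := leqP a b; first by rewrite -(stab _ (b - a)%N _ E) subnKC.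
by rewrite -[RHS](stab _ (a - b)%N _ E') subnKC // ltnW.
Qed.

Lemma root_of_root v : f v = v -> root_of v = v.
Proof. by move=> E; rewrite -(@root_of_uniq 0%N). Qed.

Lemma root_of_f v : root_of (f v) = root_of v.
Proof.
have [a aE] := root_of_iter v; symmetry; rewrite -(@root_of_uniq a (f v)).
  by rewrite -iterSr /= -aE root_ofK.
by rewrite -iterSr /= -aE !root_ofK.
Qed.

Lemma iter_fgC a v : iter a f (g v) = g (iter a f v).
Proof. by elim: a => //= a ->. Qed.

Lemma root_of_g v : root_of (g v) = g (root_of v).
Proof.
have [a aE] := root_of_iter v; symmetry; rewrite aE -iter_fgC.
by apply: root_of_uniq; rewrite iter_fgC fgC -aE root_ofK.
Qed.

Definition component v : {set X} := [set w | fconnect g (root_of v) (root_of w)].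

Let gsym := fconnect_sym g_inj.

Lemma component_id v : v \in component v.
Proof. by rewrite inE. Qed.

Lemma component_stable_f v : stable (component v) f.
Proof. by apply/stableP => w; rewrite !inE root_of_f. Qed.

Lemma component_stable_g v : stable (component v) g.
Proof.
apply/stableP => w; rewrite !inE root_of_g.
by rewrite [LHS]gsym [RHS]gsym -same_fconnect1.
Qed.

Lemma linkedE (K : {set X}) : linked K f g <->
  (forall v w, v \in K -> w \in K -> fconnect g (root_of v) (root_of w)).
Proof.
split=> H v w Kv Kw.
  have [a [b [c [aP bP cP]]]] := H v w Kv Kw.
  by rewrite -(root_of_uniq aP) -(root_of_uniq bP) -cP fconnect_iter.
have [a aE] := root_of_iter v; have [b bE] := root_of_iter w.
exists a, b, (findex g (root_of v) (root_of w)).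
by rewrite -aE -bE !root_ofK iter_findex // H.
Qed.

Lemma component_uniq v (K : {set X}) :
  (v \in K) && `[< linked K f g >] && stable K f && stable K g = (K == component v).
Proof.
apply/idP/eqP => [/andP[/andP[/andP[Kv /asboolP/linkedE l] sf] sg]|->].
  have Kroot w : (root_of w \in K) = (w \in K).
    by have [a ->] := root_of_iter w; rewrite stable_iter.
  apply/setP => w; rewrite inE; apply/idP/idP => [Kw|]; first exact: l.
  by move/iter_findex => E; rewrite -Kroot -E stable_iter // Kroot.
rewrite component_id component_stable_f component_stable_g !andbT /=.
apply/asboolP/linkedE => u w; rewrite !inE => vu vw.
by rewrite (connect_trans _ vw) // gsym.
Qed.

(** Counts the pairs of a node and a stable linked set containing it: the only such set is the
    component of the node. *)
Lemma sum_components (A : comNzRingType) :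
  \sum_(K : {set X} | stable K f && stable K g) #|K|%:R * `[< linked K f g >]%:R
  = #|X|%:R :> A.
Proof.
transitivity (\sum_(v : X) 1 : A); last by rewrite sumr_const.
transitivity (\sum_(v : X) \sum_(K : {set X}) (K == component v)%:R : A); last first.
  apply: eq_bigr => v _; rewrite (bigD1 (component v)) //= eqxx.
  by rewrite big1 ?addr0 // => K /negPf->.
rewrite exchange_big big_mkcond; apply: eq_bigr => K _ /=.
transitivity (\sum_(v : X) ((v \in K) && `[< linked K f g >] && stable K f && stable K g)%:R : A).
  case: ifP => [/andP[-> ->]|sK]; last first.
    by rewrite big1 // => v _; rewrite -andbA sK andbF.
  under eq_bigr do rewrite !andbT -mulnb natrM.
  rewrite -big_distrl -natr_sum /= -sum1_card [in LHS]big_mkcond /=.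
  by congr (_%:R * _); apply: eq_bigr => v _; case: (v \in K).
by apply: eq_bigr => v _; rewrite component_uniq.
Qed.

End Components.

Section ExponentialFormula.
Variable R : realType.
Local Notation PR := {poly R}.

(** The factor n coming from [fps_theta] is the sum of |K| over the components K, and
    multiplicativity splits the weight between K and its complement. The factor |K| also discards
    the empty set, which counts as linked. *)
Lemma egf_components (a : weighting PR) :
    natural a -> multiplicative a ->
    (forall n f g, a 'I_n [set: 'I_n] f g != 0 -> forest_aut [set: 'I_n] f g) ->
  fps_theta (egf a) = egf a * fps_theta (egf (wmul (ind PR linked) a)).
Proof.
move=> na ma fa; apply/fpsP => n.
pose c : weighting PR := wmul (fun X K _ _ => #|K|%:R) (wmul (ind PR linked) a).
have nc : natural c.
  apply: natural_wmul; first exact: (natural_card (fun k => k%:R)).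
  exact/natural_wmul/na/natural_ind/natural_linked.
have -> : fps_theta (egf (wmul (ind PR linked) a)) = egf c.
  apply/fpsP => k /=; rewrite -scalerAr; congr (_ *: _).
  rewrite /total_weight big_distrr /=; apply: eq_bigr => F _.
  by rewrite /c {2}/wmul cardsT card_ord.
rewrite mulrC; apply: (@scalerI _ _ n`!%:R).
  by rewrite pnatr_eq0 -lt0n fact_gt0.
rewrite egfM // [LHS]scalerAr egfK.
under [RHS]eq_bigr do rewrite -total_weightM //.
rewrite (exchange_big_dep predT) //= /total_weight big_distrr /=.
apply: eq_big => F.
  by rewrite supportedT.
move=> _; set f := pmap1 F; set g := pmap2 F.
have [a0|/fa fgT] := eqVneq (a _ [set: 'I_n] f g) 0; last first.
  rewrite -[n in n%:R]card_ord -(sum_components fgT) big_distrl /=.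
  apply: eq_bigr => K /andP[sf sg].
  by rewrite (ma _ _ _ _ sf sg) /c /wmul /ind !mulrA.
rewrite a0 mulr0 big1 // => K /andP[sf sg].
by rewrite /c /wmul -!mulrA -ma // a0 !mulr0.
Qed.

End ExponentialFormula.

(* The node set of the D-forest attached to [v]. *)
Definition moved_below (X : finType) (f g : X -> X) (v : X) : {set X} :=
  [set w | `[< exists a, [/\ f (iter a f w) = v, iter a f w <> v &
                             g (iter a f w) <> iter a f w] >]].

(** The trees whose root is moved by [g]. In the forest left when a fixed root is removed, they form
    the D-forest of that root. *)
Definition moved_part (X : finType) (K : {set X}) (f g : X -> X) : {set X} :=
  [set w in K | `[< exists a, f (iter a f w) = iter a f w /\
                              g (iter a f w) <> iter a f w >]].

Section MarkedWeight.
Variable R : realType.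
Local Notation PR := {poly R}.
Variable m : nat.

Definition mark_weight : weighting PR := fun X K f g =>
  \prod_(v in K | g v == v) 'X ^+ (#|moved_below f g v| == m).

Lemma tr_moved_below (X Y : finType) (h : X -> Y) (K : {set X})
    (f g : X -> X) (f' g' : Y -> Y) (v : X) :
  transports h K f g f' g' -> v \in K ->
  moved_below f' g' (h v) = h @: moved_below f g v.
Proof.
move=> tr Kv; have h_inj := tr_inj tr.
apply/setP => w; apply/idP/imsetP.
  rewrite inE => /asboolP[a [aE anv ag]].
  have : w \in h @: K.
    by rewrite -(stable_iter a.+1 _ (tr_stf' tr)) /= aE imset_f.
  case/imsetP=> x Kx wE; exists x => //; rewrite inE; apply/asboolP; exists a.
  move: aE anv ag; rewrite wE (tr_iter_f tr) // (tr_f tr) ?(tr_mem_iter tr) //.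
  rewrite (tr_g tr) ?(tr_mem_iter tr) // => /h_inj aE anv ag.
  by split=> // [E|E]; [apply: anv|apply: ag]; rewrite E.
case=> x; rewrite inE => /asboolP[a [aE anv ag]] ->.
have Kx : x \in K by rewrite -(stable_iter a.+1 _ (tr_stf tr)) /= aE.
rewrite inE; apply/asboolP; exists a.
rewrite (tr_iter_f tr) // (tr_f tr) ?(tr_mem_iter tr) //.
rewrite (tr_g tr) ?(tr_mem_iter tr) // aE.
by split=> // /h_inj.
Qed.

Lemma natural_mark_weight : natural mark_weight.
Proof.
move=> X Y h K f g f' g' tr; have h_inj := tr_inj tr.
rewrite /mark_weight !big_mkcondr big_imset /=; last by move=> x y _ _ /h_inj.
apply: eq_bigr => v Kv; rewrite (tr_g tr) // (inj_eq h_inj).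
by rewrite (tr_moved_below tr) // card_imset.
Qed.

Lemma multiplicative_mark_weight : multiplicative mark_weight.
Proof.
move=> X K f g sf sg; rewrite /mark_weight (bigID (mem K)) /=.
by congr (_ * _); apply: eq_bigl => v; rewrite !inE /= andbC.
Qed.

Lemma natural_moved_part : natural (fun X K f g => 'X ^+ (#|moved_part K f g| == m) : PR).
Proof.
move=> X Y h K f g f' g' tr; have h_inj := tr_inj tr.
suff -> : moved_part (h @: K) f' g' = h @: moved_part K f g by rewrite card_imset.
apply/setP => w; apply/idP/imsetP.
  rewrite inE => /andP[/imsetP[x Kx ->] /asboolP[a [aE ag]]].
  exists x => //; rewrite inE Kx; apply/asboolP; exists a; move: aE ag.
  rewrite (tr_iter_f tr) // (tr_f tr) ?(tr_mem_iter tr) //.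
  rewrite (tr_g tr) ?(tr_mem_iter tr) // => /h_inj aE ag.
  by split=> // E; apply: ag; rewrite E.
case=> x; rewrite inE => /andP[Kx /asboolP[a [aE ag]]] ->.
rewrite inE imset_f //; apply/asboolP; exists a.
rewrite (tr_iter_f tr) // (tr_f tr) ?(tr_mem_iter tr) //.
by rewrite (tr_g tr) ?(tr_mem_iter tr) // aE; split=> // /h_inj.
Qed.

End MarkedWeight.

(** * Splitting a forest into its moved and its fixed trees *)

Section Multiplicative.
Variables (X : finType) (K : {set X}) (f g : X -> X).
Hypothesis sg : stable K g.

Lemma forest_aut_split :
  forest_aut [set: X] f g <-> forest_aut K f g /\ forest_aut (~: K) f g.
Proof.
split=> [[H1 H2 H3]|[[H1 H2 H3] [H1' H2' H3']]].
  by split; split=> *; [apply: H1|apply: H2|apply: H3|apply: H1|apply: H2|apply: H3];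
     rewrite ?inE.
split.
- move=> v _; have [Kv|Kv] := boolP (v \in K); first exact: H1.
  by apply: H1'; rewrite inE.
- move=> v w _ _ gvw.
  have Kvw : (v \in K) = (w \in K).
    by have /stableP sg' := sg; rewrite -sg' gvw sg'.
  have [Kv|Kv] := boolP (v \in K); first by apply: H2 => //; rewrite -Kvw.
  by apply: H2' => //; rewrite inE -?Kvw.
- move=> v _; have [Kv|Kv] := boolP (v \in K); first exact: H3.
  by apply: H3'; rewrite inE.
Qed.

Lemma roots_fixed_split :
  roots_fixed [set: X] f g <-> roots_fixed K f g /\ roots_fixed (~: K) f g.
Proof.
split=> [H|[H1 H2] v _]; first by split=> v _; apply: H; rewrite inE.
by have [Kv|Kv] := boolP (v \in K); [apply: H1|apply: H2; rewrite inE].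
Qed.

Lemma all_moved_split :
  all_moved [set: X] f g <-> all_moved K f g /\ all_moved (~: K) f g.
Proof.
split=> [H|[H1 H2] v _]; first by split=> v _; apply: H; rewrite inE.
by have [Kv|Kv] := boolP (v \in K); [apply: H1|apply: H2; rewrite inE].
Qed.

End Multiplicative.

Lemma multiplicative_ind (A : comNzRingType) (P : pred_struct) :
  (forall (X : finType) (K : {set X}) f g, stable K f -> stable K g ->
     (P X [set: X] f g <-> P X K f g /\ P X (~: K) f g)) ->
  multiplicative (ind A P).
Proof.
move=> H X K f g sf sg; rewrite /ind -natrM mulnb; congr (_ %:R); congr nat_of_bool.
apply/asboolP/andP; first by move/(H _ _ _ _ sf sg) => [? ?]; split; apply/asboolP.
by case=> /asboolP ? /asboolP ?; apply/(H _ _ _ _ sf sg).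
Qed.

Lemma multiplicative_wmul (A : comNzRingType) (a b : weighting A) :
  multiplicative a -> multiplicative b -> multiplicative (wmul a b).
Proof.
by move=> ma mb X K f g sf sg; rewrite /wmul (ma _ _ _ _ sf sg) (mb _ _ _ _ sf sg) mulrACA.
Qed.

Section ForestWeights.
Variable R : realType.
Local Notation PR := {poly R}.
Variable m : nat.

Definition fixed_forest : weighting PR :=
  wmul (ind PR (fun X K f g => forest_aut K f g /\ roots_fixed K f g))
       (mark_weight R m).

Definition moved_forest : weighting PR :=
  ind PR (fun X K f g => forest_aut K f g /\ all_moved K f g).

(** The weight of a tree, read on the forest left by its root; the last factor is the mark of the
    root itself. *)
Definition marked_forest : weighting PR :=
  wmul (wmul (ind PR forest_aut) (mark_weight R m))
       (fun X K f g => 'X ^+ (#|moved_part K f g| == m)).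

Lemma natural_fixed_forest : natural fixed_forest.
Proof.
apply: natural_wmul; last exact: natural_mark_weight.
apply/natural_ind/natural_predI; first exact: natural_forest_aut.
exact: natural_roots_fixed.
Qed.

Lemma natural_moved_forest : natural moved_forest.
Proof.
apply/natural_ind/natural_predI; first exact: natural_forest_aut.
exact: natural_all_moved.
Qed.

Lemma natural_marked_forest : natural marked_forest.
Proof.
apply: natural_wmul; last exact: natural_moved_part.
apply: natural_wmul; last exact: natural_mark_weight.
exact/natural_ind/natural_forest_aut.
Qed.

Lemma multiplicative_fixed_forest : multiplicative fixed_forest.
Proof.
apply: multiplicative_wmul; last exact: multiplicative_mark_weight.
apply: multiplicative_ind => X K f g sf sg.
have := forest_aut_split f sg; have := roots_fixed_split K f g.
by tauto.
Qed.

Lemma multiplicative_moved_forest : multiplicative moved_forest.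
Proof.
apply: multiplicative_ind => X K f g sf sg.
have := forest_aut_split f sg; have := all_moved_split K f g.
by tauto.
Qed.

Lemma ind_neq0 (P : pred_struct) (X : finType) (K : {set X}) f g :
  ind PR P K f g != 0 -> P X K f g.
Proof. by rewrite /ind; case: asboolP => //; rewrite eqxx. Qed.

Lemma indT (P : pred_struct) (X : finType) (K : {set X}) f g :
  P X K f g -> ind PR P K f g = 1.
Proof. by move=> p; rewrite /ind asboolT. Qed.

Lemma indF (P : pred_struct) (X : finType) (K : {set X}) f g :
  ~ P X K f g -> ind PR P K f g = 0.
Proof. by move=> p; rewrite /ind asboolF. Qed.

(** Its generating function is D with the term d_m z^m multiplied by u. *)
Definition sized_moved_forest : weighting PR :=
  wmul (fun X K _ _ => 'X ^+ (#|K| == m)) moved_forest.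

(** For a forest automorphism only one [K] contributes, the set [N] of nodes whose root is moved. A
    node fixed by [g] has a fixed root, so [g] moves all of [N]; conversely a nonzero term forces
    [K] to consist of the trees with moved root. *)
Lemma marked_forest_split (X : finType) (f g : X -> X) :
  marked_forest [set: X] f g =
  \sum_(K : {set X} | stable K f && stable K g)
    sized_moved_forest K f g * fixed_forest (~: K) f g.
Proof.
have [fgT|nfgT] := pselect (forest_aut [set: X] f g); last first.
  rewrite /marked_forest /wmul indF // !mul0r big1 // => K /andP[sf sg].
  rewrite /sized_moved_forest /fixed_forest /moved_forest /wmul /ind.
  case: asboolP => [[H1 _]|_]; last by rewrite mulr0 mul0r.
  case: asboolP => [[H2 _]|_]; last by rewrite mul0r mulr0.
  by case: nfgT; apply/(forest_aut_split f sg).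
pose N := moved_part [set: X] f g.
have inN w : (w \in N) = (g (root_of fgT w) != root_of fgT w).
  rewrite !inE; apply/asboolP/idP => [[a [/(root_of_uniq fgT)-> /eqP //]]|/eqP H].
  by have [a E] := root_of_iter fgT w; exists a; rewrite -E root_ofK.
have sf : stable N f by apply/stableP => v; rewrite !inN root_of_f.
have sg : stable N g.
  have g_inj : injective g by have [_ H _] := fgT; move=> v w; apply: H; rewrite inE.
  by apply/stableP => v; rewrite !inN root_of_g (inj_eq g_inj).
have [faN faCN] := iffLR (forest_aut_split f sg) fgT.
have amN : all_moved N f g.
  by move=> v; rewrite inN => + E; rewrite -root_of_g E eqxx.
have rfN : roots_fixed (~: N) f g.
  by move=> v; rewrite inE inN negbK => /eqP + /(root_of_root fgT)-E; rewrite E.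
rewrite (bigD1 N) /=; last by rewrite sf.
rewrite [X in _ = _ + X]big1 ?addr0 => [|K /andP[/andP[sKf sKg] nKN]].
  rewrite /marked_forest /sized_moved_forest /fixed_forest /moved_forest /wmul.
  rewrite !indT // mul1r mulr1 mul1r mulrC; congr (_ * _).
  rewrite (multiplicative_mark_weight _ _ sf sg) [X in X * _ = _]big_pred0 ?mul1r //.
  by move=> v; apply/negP => /andP[/amN H /eqP].
apply/eqP; apply: contra_neqT nKN => H; apply/esym.
have : sized_moved_forest K f g != 0 by apply: contraNneq H => ->; rewrite mul0r.
rewrite mulf_eq0 negb_or => /andP[_ /ind_neq0[_ am]].
have : fixed_forest (~: K) f g != 0 by apply: contraNneq H => ->; rewrite mulr0.
rewrite mulf_eq0 negb_or => /andP[/ind_neq0[_ rf] _].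
apply/setP => v; rewrite inN.
have [a E] := root_of_iter fgT v; have <- := stable_iter a v sKf; rewrite -E.
have [Kr|nKr] := boolP (_ \in K); first by apply/eqP/am.
by apply/negbTE; rewrite negbK; apply/eqP/rf; rewrite ?inE ?root_ofK.
Qed.

Lemma egf_marked_forest :
  egf marked_forest = egf sized_moved_forest * egf fixed_forest.
Proof.
apply/fpsP => n; apply: (@scalerI _ _ n`!%:R).
  by rewrite pnatr_eq0 -lt0n fact_gt0.
have ns : natural sized_moved_forest.
  by apply: natural_wmul natural_moved_forest; apply: (natural_card (fun k => 'X ^+ (k == m))).
have nf := natural_fixed_forest; rewrite egfK egfM //.
under [RHS]eq_bigr do rewrite -(total_weightM _ ns nf).
rewrite (exchange_big_dep predT) //= /total_weight; apply: eq_big => F.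
  by rewrite supportedT.
by move=> _; rewrite marked_forest_split.
Qed.

Lemma egf_sized_moved_forest n :
  egf sized_moved_forest n = 'X ^+ (n == m) * egf moved_forest n.
Proof.
rewrite /= -scalerAr; congr (_ *: _); rewrite /total_weight big_distrr /=.
by apply: eq_bigr => F _; rewrite /sized_moved_forest /wmul cardsT card_ord.
Qed.

End ForestWeights.

(* [f] is a tree with root [r]; [f'] is the forest of its subtrees at the
   children of [r], on the nodes other than [r]. *)
Section CutRoot.
Variables (X : finType) (r : X) (f f' g : X -> X).
Hypotheses (fr : f r = r) (gr : g r = r).
Hypothesis fE : forall v, v <> r -> f v = if f' v == v then r else f' v.
Hypothesis f'r : forall v, v <> r -> f' v <> r.
Hypothesis gNr : forall v, v <> r -> g v <> r.

Let f_neq v : v <> r -> f v <> v.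
Proof. by move=> vr; rewrite fE //; case: eqP => // _ /esym. Qed.

Let f'E v : v <> r -> f' v = if f v == r then v else f v.
Proof.
move=> vr; rewrite fE //; have [E|E] := eqVneq (f' v) v; first by rewrite eqxx.
by case: eqP => // /f'r; case.
Qed.

Lemma cut_reaches v a : v <> r -> f' (iter a f' v) = iter a f' v ->
  exists b, iter b f v = r.
Proof.
elim: a v => [|a IHa] v vr; first by move=> /= E; exists 1%N; rewrite /= fE // E eqxx.
rewrite -iterS !iterSr => E; have [E'|E'] := eqVneq (f' v) v.
  by exists 1%N; rewrite /= fE // E' eqxx.
have [|b bE] := IHa (f' v) (f'r vr); first by rewrite -iterS iterSr.
by exists b.+1; rewrite iterSr fE // (negPf E').
Qed.

Lemma uncut_reaches v a : v <> r -> iter a f v = r ->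
  exists b, f' (iter b f' v) = iter b f' v.
Proof.
elim: a v => [|a IHa] v vr //; rewrite iterSr => E.
have [E'|/eqP E'] := eqVneq (f v) r; first by exists 0%N; rewrite /= f'E // E' eqxx.
have [b bE] := IHa _ E' E; exists b.+1; rewrite iterSr (f'E vr).
by case: eqP.
Qed.

Lemma cut_forest_aut :
  forest_aut (~: [set r]) f' g <->
  forest_aut [set: X] f g /\ (forall v, f v = v -> v = r).
Proof.
have in_r v : (v \in ~: [set r]) <-> v <> r by rewrite !inE; split=> /eqP.
split=> [[H1 H2 H3]|[[H1 H2 H3] Hr]].
  have gI v w : v <> r -> w <> r -> g v = g w -> v = w by move=> *; apply: H2; rewrite ?in_r.
  split; last by move=> v; have [->//|/eqP vr] := eqVneq v r; move/f_neq; case.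
  split.
  - move=> v _; have [->|/eqP vr] := eqVneq v r; first by rewrite gr fr gr.
    rewrite [LHS]fE; last exact: gNr.
    rewrite [in RHS]fE // H1 ?in_r //.
    have -> : (g (f' v) == g v) = (f' v == v).
      by apply/eqP/eqP => [|->//]; apply: gI => //; apply: f'r.
    by case: eqP; rewrite ?gr.
  - move=> v w _ _.
    have [->|/eqP vr] := eqVneq v r; have [->|/eqP wr] := eqVneq w r => //.
    + by rewrite gr => /esym /gNr.
    + by rewrite gr => /gNr.
    + exact: gI.
  - move=> v _; have [->|/eqP vr] := eqVneq v r; first by exists 0%N.
    have [a aE] := H3 v (iffRL (in_r v) vr).
    by have [b bE] := cut_reaches vr aE; exists b; rewrite bE.
have gI v w : g v = g w -> v = w by apply: H2; rewrite inE.
split.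
- move=> v /in_r vr; rewrite [LHS]f'E; last exact: gNr.
  rewrite H1 ?inE // f'E //.
  have -> : (g (f v) == r) = (f v == r).
    by apply/eqP/eqP => [|->//]; rewrite -[in X in X -> _]gr => /gI.
  by case: eqP.
- by move=> v w _ _ /gI.
- move=> v /in_r vr; have [a aE] := H3 v (finset.in_setT _).
  exact: uncut_reaches vr (Hr _ aE).
Qed.

Let iter_f'E w a : iter a f w <> r -> iter a f' w = iter a f w.
Proof.
elim: a => //= a IHa H.
have cr : iter a f w <> r by move=> E; apply: H; rewrite E.
by rewrite IHa // f'E //; case: eqP.
Qed.

Let iter_fE w a : w <> r -> f' (iter a f' w) <> iter a f' w ->
  iter a f w = iter a f' w /\ iter a f' w <> r.
Proof.
move=> wr; elim: a => //= a IHa H.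
have H' : f' (iter a f' w) <> iter a f' w by move=> E; apply: H; rewrite !E.
have [-> nr] := IHa H'; rewrite fE //; split; last exact: f'r.
by case: eqP.
Qed.

Let iter_f_root w a : w <> r -> f' (iter a f' w) = iter a f' w ->
  exists2 b, iter b f w = iter a f' w & iter a f' w <> r.
Proof.
elim: a w => [|a IHa] w wr; first by exists 0%N.
rewrite -iterS !iterSr; have [E|E] := eqVneq (f' w) w.
  have -> : iter a f' (f' w) = w by elim: a {IHa} => //= a ->.
  by move=> _; exists 0%N.
move=> E'; have [|b bE nr] := IHa _ (f'r wr); first by rewrite -iterS iterSr.
by exists b.+1; rewrite // iterSr fE // (negPf E).
Qed.

Lemma cut_moved_below v : f' r = r -> v <> r ->
  moved_below f g v = moved_below f' g v.
Proof.
move=> f'rr vr; apply/setP => w; rewrite !inE; apply/asboolP/asboolP => -[a [aE anv ag]].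
  have cr : iter a f w <> r by move=> E; apply: vr; rewrite -aE E.
  exists a; rewrite iter_f'E //; split=> //; rewrite f'E // aE.
  by case: eqP.
have wr : w <> r.
  by move=> E; apply: vr; rewrite -aE E -iterS; elim: a.+1 => //= b ->.
have nfix : f' (iter a f' w) <> iter a f' w by rewrite aE => E; apply: anv.
have [E cr] := iter_fE wr nfix; exists a; rewrite E; split=> //; rewrite fE // aE.
by case: eqP => // /esym.
Qed.

(** The children of [r] become the roots of the cut forest, so the nodes below a moved child are
    those with a moved root. *)
Lemma cut_moved_part : moved_below f g r = moved_part (~: [set r]) f' g.
Proof.
apply/setP => w; rewrite !inE; apply/asboolP/andP.
  case=> a [aE cr ag].
  have wr : w <> r by move=> E; apply: cr; rewrite E; elim: (a) => //= b ->.
  split; first exact/eqP.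
  apply/asboolP; exists a; rewrite iter_f'E // f'E // aE eqxx.
  by split.
case=> /eqP wr /asboolP[a [aE ag]].
have [b bE cr] := iter_f_root wr aE; exists b; rewrite bE fE // aE eqxx.
by split.
Qed.

Lemma cut_mark_weight (R : realType) m : f' r = r ->
  mark_weight R m [set: X] f g =
  mark_weight R m (~: [set r]) f' g *
    'X ^+ (#|moved_part (~: [set r]) f' g| == m).
Proof.
move=> f'rr; rewrite /mark_weight (bigD1 r) /=; last by rewrite inE gr eqxx.
rewrite cut_moved_part mulrC; congr (_ * _).
apply: eq_big => [v|v /andP[_ /eqP vr]]; first by rewrite !inE /= andbC.
by rewrite cut_moved_below.
Qed.

End CutRoot.

(** * Trees obtained by adding a root to a forest *)

Section TreeWeight.
Variable R : realType.
Local Notation PR := {poly R}.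
Variable m : nat.

Definition rooted_aut (X : finType) (r : X) (f g : X -> X) : Prop :=
  [/\ forest_aut [set: X] f g, f r = r & forall v, f v = v -> v = r].

Lemma rooted_aut_fixed (X : finType) (r : X) (f g : X -> X) :
  rooted_aut r f g -> g r = r.
Proof. by case=> -[H _ _] fr; apply; rewrite H ?inE // fr. Qed.

Lemma sum_rooted_aut (X : finType) (f g : X -> X) :
  \sum_r `[< rooted_aut r f g >]%:R = `[< exists r, rooted_aut r f g >]%:R :> PR.
Proof.
have [[r Hr]|nr] := pselect (exists r, rooted_aut r f g); last first.
  rewrite asboolF // big1 // => r _; rewrite asboolF // => H.
  by apply: nr; exists r.
rewrite [in RHS]asboolT; last by exists r.
rewrite (bigD1 r) //= asboolT // big1 ?addr0 // => s sr.
rewrite asboolF // => -[_ fs _]; have [_ _ /(_ s fs) E] := Hr.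
by rewrite E eqxx in sr.
Qed.

(** If all roots are fixed, an orbit of roots is a single root, so linked means being a tree. The
    point [x0] excludes the empty set, which is linked but not a tree. *)
Lemma linked_fixedE (X : finType) (x0 : X) (f g : X -> X) :
  (`[< linked [set: X] f g >]%:R *
   `[< forest_aut [set: X] f g /\ roots_fixed [set: X] f g >]%:R : PR)
  = `[< exists r, rooted_aut r f g >]%:R.
Proof.
rewrite -natrM mulnb; congr (_%:R); congr nat_of_bool.
apply/andP/asboolP => [[/asboolP l /asboolP[fgT rf]]|[r Hr]].
  exists (root_of fgT x0); split=> //; first exact: root_ofK.
  move=> v fv; have /(linkedE fgT)/(_ x0 v) := l; rewrite !inE => /(_ isT isT).
  rewrite (root_of_root fgT fv) => /iter_findex <-.
  elim: (findex _ _ _) => //= a ->; apply: rf; rewrite ?inE //.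
  exact: root_ofK.
have gr := rooted_aut_fixed Hr; have [fgT fr ur] := Hr.
split; apply/asboolP; last by split=> // v _ /ur->.
apply/(linkedE fgT) => v w _ _.
by rewrite (ur _ (root_ofK fgT v)) (ur _ (root_ofK fgT w)).
Qed.

Definition uncut (X : finType) (r : X) (G : {ffun X -> X * X}) : {ffun X -> X * X} :=
  [ffun v => if v == r then (r, r)
             else (if (G v).1 == v then r else (G v).1, (G v).2)].

(** The removed root stays as a point fixed by both maps, as [supported] demands for nodes off the
    complement of [r]. *)
Definition cut (X : finType) (r : X) (F : {ffun X -> X * X}) : {ffun X -> X * X} :=
  [ffun v => if v == r then (r, r)
             else (if (F v).1 == r then v else (F v).1, (F v).2)].

Lemma sum_rooted (X : finType) (r : X) :
  \sum_(F : {ffun X -> X * X})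
     `[< rooted_aut r (pmap1 F) (pmap2 F) >]%:R *
     mark_weight R m [set: X] (pmap1 F) (pmap2 F) =
  total_weight (marked_forest R m) (~: [set r]).
Proof.
have in_r v : (v \in ~: [set r]) <-> v <> r by rewrite !inE; split=> /eqP.
have cutP (F : {ffun X -> X * X}) : rooted_aut r (pmap1 F) (pmap2 F) ->
    uncut r (cut r F) = F.
  move=> H; have gr := rooted_aut_fixed H; case: H => _ fr ur.
  apply/ffunP => v; rewrite !ffunE; case: ifPn => [/eqP->|vr].
    by rewrite [RHS]surjective_pairing; congr pair; [exact/esym/fr|exact/esym/gr].
  rewrite (negPf vr) /= [RHS]surjective_pairing; congr pair.
  have [->|Fr] := eqVneq (F v).1 r; first by rewrite ?eqxx.
  by case: eqP => // /ur E; rewrite E eqxx in vr.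
rewrite /total_weight.
transitivity (\sum_(F : {ffun X -> X * X} | `[< rooted_aut r (pmap1 F) (pmap2 F) >])
    mark_weight R m [set: X] (pmap1 F) (pmap2 F)).
  rewrite [RHS]big_mkcond; apply: eq_bigr => F _.
  by case: asboolP => _; rewrite ?mul1r ?mul0r.
rewrite (reindex_onto (uncut r) (cut r)) /=; last by move=> F /asboolP/cutP.
transitivity (\sum_(G : {ffun X -> X * X} |
    supported (~: [set r]) G && `[< forest_aut (~: [set r]) (pmap1 G) (pmap2 G) >])
    mark_weight R m (~: [set r]) (pmap1 G) (pmap2 G) *
    'X ^+ (#|moved_part (~: [set r]) (pmap1 G) (pmap2 G)| == m)); last first.
  rewrite big_mkcondr; apply: eq_bigr => G _.
  by rewrite /marked_forest /wmul /ind; case: asboolP => _; rewrite ?mul1r ?mul0r.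
have sup (G : {ffun X -> X * X}) : supported (~: [set r]) G ->
  [/\ pmap1 (uncut r G) r = r,
      pmap2 G r = r,
      forall v, v <> r -> pmap1 (uncut r G) v = if pmap1 G v == v then r else pmap1 G v,
      forall v, v <> r -> pmap1 G v <> r &
      [/\ forall v, v <> r -> pmap2 G v <> r, pmap1 G r = r &
          pmap2 (uncut r G) = pmap2 G]].
  case/supportedP=> G0 G1 G2.
  have Gr : G r = (r, r) by rewrite G0 // !inE eqxx.
  split; rewrite /pmap1 /pmap2 ?ffunE ?eqxx ?Gr //.
  - by move=> v /eqP/negPf vr; rewrite ffunE vr.
  - by move=> v /in_r /G1; rewrite in_r.
  - split=> //; first by move=> v /in_r /G2; rewrite in_r.
    by apply/funext => v; rewrite ffunE; case: eqP => // ->; rewrite Gr.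
have supG G : rooted_aut r (pmap1 (uncut r G)) (pmap2 (uncut r G)) ->
    cut r (uncut r G) = G -> supported (~: [set r]) G.
  move=> H E; have gr := rooted_aut_fixed H; case: H => -[H1 H2 H3] fr ur.
  rewrite -E; apply/supportedP; split=> v.
  - by rewrite !inE negbK => /eqP->; rewrite ffunE eqxx.
  - rewrite !inE ffunE => vr; rewrite (negPf vr) /=.
    by have [|] := eqVneq (uncut r G v).1 r.
  - rewrite !inE ffunE => vr; rewrite (negPf vr) /=.
    apply: contraNN vr => /eqP gv; apply/eqP; apply: H2; rewrite ?inE //.
    by rewrite gr.
apply: eq_big => [G|G /andP[/asboolP H /eqP E]].
  apply/andP/andP => -[].
    move=> /asboolP H /eqP E.
    have sG := supG _ H E.
    split=> //; apply/asboolP; have [h1 h2 h3 h4 [h5 h6 h7]] := sup _ sG.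
    apply/(cut_forest_aut h1 h2 h3 h4 h5); rewrite -h7.
    by case: H.
  move=> sG /asboolP H; have [h1 h2 h3 h4 [h5 h6 h7]] := sup _ sG.
  split.
    apply/asboolP; have [a b] := iffLR (cut_forest_aut h1 h2 h3 h4 h5) H.
    by split=> //; rewrite h7.
  apply/eqP/ffunP => v; rewrite ffunE; case: eqP => [->|vr].
    by rewrite [RHS]surjective_pairing; congr pair; [exact/esym/h6|exact/esym/h2].
  rewrite /= [RHS]surjective_pairing; congr pair; last by rewrite -[LHS]/(pmap2 _ v) h7.
  have := h3 _ vr; rewrite /pmap1 => ->.
  have [->|Gv] := eqVneq (G v).1 v; first by rewrite ?eqxx.
  by case: eqP => // /(h4 _ vr).
have sG := supG _ H E.
have [h1 h2 h3 h4 [h5 h6 h7]] := sup _ sG.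
by rewrite h7 (cut_mark_weight h1 h2 h3 h4).
Qed.

Definition tree_aut : weighting PR := wmul (ind PR linked) (fixed_forest R m).

Lemma tree_autE (X : finType) (x0 : X) (f g : X -> X) :
  tree_aut [set: X] f g =
  `[< exists r, rooted_aut r f g >]%:R * mark_weight R m [set: X] f g.
Proof. by rewrite /tree_aut /fixed_forest /wmul /ind mulrA linked_fixedE. Qed.

(** Each of the n + 1 labels can be the root and leaves a forest on n labels; this factor turns 1/(n
    + 1)! into 1/n!. *)
Lemma egf_tree_autS n : egf tree_aut n.+1 = egf (marked_forest R m) n.
Proof.
apply: (@scalerI _ _ n.+1`!%:R); first by rewrite pnatr_eq0 -lt0n fact_gt0.
rewrite egfK factS natrM -scalerA egfK /total_weight.
transitivity (\sum_(r : 'I_n.+1) total_weight (marked_forest R m) (~: [set r])).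
  under [RHS]eq_bigr do rewrite -sum_rooted.
  rewrite exchange_big /=; apply: eq_big => F; first by rewrite supportedT.
  by move=> _; rewrite (tree_autE ord0) -sum_rooted_aut -big_distrl.
rewrite (eq_bigr (fun=> total_weight (marked_forest R m) [set: 'I_n])) => [|r _].
  by rewrite sumr_const card_ord scaler_nat.
rewrite total_weight_card; last exact: natural_marked_forest.
by rewrite cardsC1 card_ord.
Qed.

End TreeWeight.

(** * Forests whose trees are permuted cyclically *)

Lemma card_eq_can2 (S T : finType) (A : {pred S}) (B : {pred T})
    (h : S -> T) (h' : T -> S) :
  (forall x, x \in A -> h x \in B /\ h' (h x) = x) ->
  (forall y, y \in B -> h' y \in A /\ h (h' y) = y) -> #|A| = #|B|.
Proof.
move=> hAB hBA; rewrite -(@card_in_imset _ _ h A); last first.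
  by move=> x y /hAB[_ xE] /hAB[_ yE] hxy; rewrite -xE hxy yE.
apply: eq_card => y; apply/imsetP/idP => [[x /hAB[hx _] -> //]|/hBA[h'y yE]].
by exists (h' y).
Qed.

Definition pinv (S : finType) (T : eqType) (s0 : S) (h : S -> T) (y : T) : S :=
  odflt s0 [pick x | h x == y].

Lemma pinvK (S : finType) (T : eqType) (s0 : S) (h : S -> T) :
  injective h -> cancel h (pinv s0 h).
Proof.
move=> h_inj x; rewrite /pinv; case: pickP => [y /eqP/h_inj//|/(_ x)].
by rewrite eqxx.
Qed.

Lemma pinv_onto (S : finType) (T : eqType) (s0 : S) (h : S -> T) y :
  (exists x, h x = y) -> h (pinv s0 h y) = y.
Proof.
case=> x <-; rewrite /pinv; case: pickP => [z /eqP//|/(_ x)].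
by rewrite eqxx.
Qed.

Section CyclicForests.
Variables (X : finType) (i' k' : nat).
Local Notation i := i'.+1.
Local Notation k := k'.+1.
Hypothesis cardX : #|X| = (i * k)%N.

Definition cyclic_forest (F : {ffun X -> X * X}) : Prop :=
  [/\ forest_aut [set: X] (pmap1 F) (pmap2 F),
      linked [set: X] (pmap1 F) (pmap2 F) &
      #|[set r | pmap1 F r == r]| = i].

(** A bijective labelling of one tree of the forest: [b] is injective into a single tree, and in a
    cyclic forest each tree has k nodes. *)
Definition labels_tree (F : {ffun X -> X * X}) (b : {ffun 'I_k -> X}) : Prop :=
  injective b /\ exists r, forall a, pmap1 F r = r /\ exists c, iter c (pmap1 F) (b a) = r.

Definition is_tree_aut (G : {ffun 'I_k -> 'I_k * 'I_k}) : Prop :=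
  exists r, rooted_aut r (pmap1 G) (pmap2 G).

Definition spread (F : {ffun X -> X * X}) (b : {ffun 'I_k -> X}) :
    {ffun 'I_i * 'I_k -> X} :=
  [ffun p : 'I_i * 'I_k => iter p.1 (pmap2 F) (b p.2)].

(** The second component is g^i, the first positive power of [g] that brings the labelled tree back
    to itself. *)
Definition first_tree (F : {ffun X -> X * X}) (b : {ffun 'I_k -> X}) :
    {ffun 'I_k -> 'I_k * 'I_k} :=
  [ffun a => (pinv ord0 b (pmap1 F (b a)), pinv ord0 b (iter i (pmap2 F) (b a)))].

(** Each of the i layers is a copy of the tree. The automorphism carries a layer to the next one
    without changing labels, and the last layer back to the first with the twist [(G _).2]. *)
Definition wind (c : {ffun 'I_i * 'I_k -> X}) (G : {ffun 'I_k -> 'I_k * 'I_k}) :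
    {ffun X -> X * X} :=
  [ffun v => let p := pinv (ord0, ord0) c v in
     (c (p.1, (G p.2).1),
      if (p.1.+1 < i)%N then c (inord p.1.+1, p.2) else c (ord0, (G p.2).2))].

Section FromTree.
Variables (c : {ffun 'I_i * 'I_k -> X}) (G : {ffun 'I_k -> 'I_k * 'I_k}).
Hypothesis c_inj : injective c.
Hypothesis hG : is_tree_aut G.
Let F := wind c G.
Let f := pmap1 F.
Let g := pmap2 F.

Let c_onto v : exists p, c p = v.
Proof.
have /codomP[p ->] : v \in codom c; last by exists p.
by apply: inj_card_onto => //; rewrite card_prod !card_ord cardX.
Qed.

Let fE j a : f (c (j, a)) = c (j, pmap1 G a).
Proof. by rewrite /f /pmap1 ffunE /= pinvK. Qed.

Let gE j a : g (c (j, a)) =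
  if (j.+1 < i)%N then c (inord j.+1, a) else c (ord0, pmap2 G a).
Proof. by rewrite /g /pmap2 ffunE /= pinvK. Qed.

Let iter_fE n j a : iter n f (c (j, a)) = c (j, iter n (pmap1 G) a).
Proof. by elim: n => //= n ->; rewrite fE. Qed.

Let iter_gE (j : 'I_i) a : iter j g (c (ord0, a)) = c (j, a).
Proof.
case: j => j /= ltj; elim: j ltj => [|j IHj] ltj /=.
  by congr (c (_, _)); apply: val_inj.
rewrite (IHj (ltnW ltj)) gE /= ltj; congr (c (_, _)).
by apply: val_inj; rewrite /= inordK.
Qed.

Let iter_giE a : iter i g (c (ord0, a)) = c (ord0, pmap2 G a).
Proof.
have := iter_gE ord_max a; rewrite /= => ->; rewrite gE /=.
by rewrite ltnn.
Qed.

Lemma wind_cyclic : cyclic_forest F /\ labels_tree F [ffun a => c (ord0, a)].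
Proof.
have [r Hr] := hG; have tr := rooted_aut_fixed Hr; have [[H1 H2 H3] fr ur] := Hr.
have faF : forest_aut [set: X] f g.
  split.
  - move=> v _; have [[j a] <-] := c_onto v.
    rewrite gE !fE gE; case: ifP => _; rewrite fE //.
    by rewrite H1 ?inE.
  - move=> v w _ _; have [[j a] <-] := c_onto v; have [[j1 a1] <-] := c_onto w.
    rewrite !gE; case: ifP => ltj; case: ifP => ltj1 /c_inj[].
    + move=> /(congr1 val); rewrite /= !inordK // => -[jj] ->.
      by congr (c (_, _)); apply: val_inj.
    + by move=> /(congr1 val); rewrite /= inordK.
    + by move=> /(congr1 val); rewrite /= inordK.
    + move=> /H2-> //; rewrite ?inE //; congr (c (_, _)); apply: val_inj.
      by have := ltn_ord j; have := ltn_ord j1; move: ltj ltj1 => /=; lia.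
  - move=> v _; have [[j a] <-] := c_onto v; have [b bE] := H3 a (finset.in_setT _).
    by exists b; rewrite iter_fE fE bE.
have rootE j a : root_of faF (c (j, a)) = c (j, r).
  have [b bE] := H3 a (finset.in_setT _); rewrite -(ur _ bE) -iter_fE; apply/esym.
  by apply: root_of_uniq; rewrite iter_fE fE bE.
split; last first.
  split; first by move=> a a1; rewrite !ffunE => /c_inj[].
  exists (c (ord0, r)) => a; split; first by rewrite -/f fE fr.
  by rewrite ffunE; have [b] := root_of_iter faF (c (ord0, a)); rewrite rootE => ->; exists b.
split=> //.
  apply/(linkedE faF).
  have Hj j : fconnect g (c (ord0, r)) (c (j, r)) by rewrite -(iter_gE j) fconnect_iter.
  have g_inj : injective g by have [_ H _] := faF; move=> v w; apply: H; rewrite inE.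
  move=> v w _ _; have [[j a] <-] := c_onto v; have [[j1 a1] <-] := c_onto w.
  by rewrite !rootE (connect_trans _ (Hj j1)) // fconnect_sym.
rewrite -[RHS]card_ord -(@card_imset _ _ (fun j : 'I_i => c (j, r))); last first.
  by move=> j j1 /c_inj[].
apply: eq_card => v; rewrite inE; apply/eqP/imsetP => [|[j _ ->]]; last first.
  by rewrite -/f fE fr.
have [[j a] <-] := c_onto v; rewrite -/f fE => /c_inj[] /ur ->.
by exists j.
Qed.

Lemma spread_wind : spread F [ffun a => c (ord0, a)] = c.
Proof. by apply/ffunP => -[j a]; rewrite !ffunE /= -/g iter_gE. Qed.

Lemma first_tree_wind : first_tree F [ffun a => c (ord0, a)] = G.
Proof.
have inj0 : injective [ffun a => c (ord0, a)].
  by move=> a a1; rewrite !ffunE => /c_inj[].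
apply/ffunP => a; rewrite ffunE [RHS]surjective_pairing; congr pair.
  rewrite ffunE -/f fE; have := pinvK ord0 inj0 (pmap1 G a); rewrite ffunE.
  by [].
rewrite [[ffun a => c (ord0, a)] a]ffunE -/g iter_giE.
by have := pinvK ord0 inj0 (pmap2 G a); rewrite ffunE.
Qed.

End FromTree.

Section FromCyclic.
Variables (F : {ffun X -> X * X}) (b : {ffun 'I_k -> X}).
Hypothesis hF : cyclic_forest F.
Let f := pmap1 F.
Let g := pmap2 F.

Let fa : forest_aut [set: X] f g. Proof. by case: hF. Qed.

Let fgC v : f (g v) = g (f v). Proof. by have [H _ _] := fa; rewrite H ?inE. Qed.

Let g_inj : injective g.
Proof. by move=> v w; have [_ H _] := fa; apply: H; rewrite ?inE. Qed.

Let iter_g_inj n : injective (iter n g).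
Proof. by elim: n => //= n IHn v w /g_inj /IHn. Qed.

Local Notation root := (root_of fa).

Let root_iter_g n v : root (iter n g v) = iter n g (root v).
Proof. by elim: n => //= n IHn; rewrite root_of_g IHn. Qed.

Let f_iter_g n v : f (iter n g v) = iter n g (f v).
Proof. by elim: n => //= n IHn; rewrite fgC IHn. Qed.

Let root_connect r r1 : f r = r -> f r1 = r1 -> fconnect g r r1.
Proof.
have [_ l _] := hF; move=> fr fr1; have /(linkedE fa)/(_ r r1) := l.
by rewrite !inE !root_of_root //; apply.
Qed.

Let order_root r : f r = r -> fingraph.order g r = i.
Proof.
move=> fr; have [_ _ <-] := hF; rewrite /fingraph.order; apply: eq_card => v; rewrite inE -/f.
apply/idP/eqP => [/iter_findex <-|fv]; last exact: root_connect.
by rewrite f_iter_g fr.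
Qed.

Let iter_root_inj r j j1 : f r = r -> (j < i)%N -> (j1 < i)%N ->
  iter j g r = iter j1 g r -> j = j1.
Proof.
move=> fr ltj ltj1 E.
by rewrite -(@findex_iter _ g r j) ?E ?findex_iter ?order_root.
Qed.

Let iter_i_root r : f r = r -> iter i g r = r.
Proof. by move=> fr; rewrite -(order_root fr) iter_order. Qed.

Definition tree_at r := [set v | root v == r].

(** Powers of [g] carry the i trees bijectively onto one another. The resulting divisibility of
    [#|X|] by i is what makes T(z^i) appear. *)
Lemma mul_card_tree_at r : f r = r -> (i * #|tree_at r|)%N = #|X|.
Proof.
move=> fr; have card_eq r1 : f r1 = r1 -> #|tree_at r1| = #|tree_at r|.
  move=> fr1; have /iter_findex <- := root_connect fr fr1.
  rewrite -[RHS](card_imset _ (@iter_g_inj (findex g r r1))); apply/esym/eq_card => v.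
  apply/imsetP/idP => [[w + ->]|].
    by rewrite !inE root_iter_g => /eqP->.
  rewrite inE => /eqP vE.
  have /codomP[w wE] : v \in codom (iter (findex g r r1) g).
    by apply: inj_card_onto.
  exists w => //; rewrite inE -(inj_eq (@iter_g_inj (findex g r r1))).
  by rewrite -root_iter_g -wE vE.
have [_ _ <-] := hF; rewrite -sum_nat_const -[RHS]sum1_card.
rewrite [RHS](partition_big root (mem [set r1 | f r1 == r1])) /=; last first.
  by move=> v _; rewrite inE root_ofK.
apply: eq_bigr => r1; rewrite inE => /eqP/card_eq <-.
by rewrite -sum1_card; apply: eq_bigl => v; rewrite inE.
Qed.

Lemma card_tree_at r : f r = r -> #|tree_at r| = k.
Proof. by move/mul_card_tree_at/eqP; rewrite cardX eqn_pmul2l // => /eqP. Qed.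

Lemma labels_treeE : labels_tree F b <->
  injective b /\ exists2 r, f r = r & forall a, root (b a) = r.
Proof.
split=> -[b_inj]; last first.
  case=> r fr rE; split=> //; exists r => a; split=> //.
  by have [c cE] := root_of_iter fa (b a); exists c; rewrite -cE rE.
case=> r rE; split=> //; exists r; first by have [] := rE ord0.
move=> a; have [fr [c cE]] := rE a.
by rewrite -[RHS]cE; apply/esym/root_of_uniq; rewrite cE.
Qed.

Hypothesis hb : labels_tree F b.

Let b_inj : injective b. Proof. by case: hb. Qed.

Let b_root : exists2 r, f r = r & forall a, root (b a) = r.
Proof. by have [_] := iffLR labels_treeE hb. Qed.

Let b_onto a v : root v = root (b a) -> exists a1, b a1 = v.
Proof.
have [r fr rE] := b_root; rewrite rE => vr.
have : v \in [set b a | a : 'I_k].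
  suff -> : [set b a | a : 'I_k] = tree_at r by rewrite inE vr.
  apply/eqP; rewrite eqEcard card_tree_at // card_imset // card_ord leqnn andbT.
  by apply/fintype.subsetP => _ /imsetP[a1 _ ->]; rewrite inE rE.
by case/imsetP => a1 _ ->; exists a1.
Qed.

Let G := first_tree F b.

Let b1E a : b (pmap1 G a) = f (b a).
Proof.
rewrite /G /pmap1 ffunE /=; apply: pinv_onto; apply: (@b_onto a).
exact: root_of_f.
Qed.

Let b2E a : b (pmap2 G a) = iter i g (b a).
Proof.
rewrite /G /pmap2 ffunE; apply: pinv_onto; apply: (@b_onto a).
have [r fr rE] := b_root.
by rewrite root_iter_g rE iter_i_root.
Qed.

Let b_iter1 n a : b (iter n (pmap1 G) a) = iter n f (b a).
Proof. by elim: n => //= n <-; rewrite b1E. Qed.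

Lemma spread_inj : injective (spread F b).
Proof.
have [r fr rE] := b_root.
move=> [j a] [j1 a1]; rewrite !ffunE -/g /= => E.
have jj : j = j1.
  apply/val_inj/(iter_root_inj fr (ltn_ord j) (ltn_ord j1)).
  by have := congr1 root E; rewrite !root_iter_g !rE.
by rewrite jj in E *; rewrite (b_inj (iter_g_inj E)).
Qed.

Lemma first_tree_aut : is_tree_aut G.
Proof.
have [r fr rE] := b_root.
have [a0 a0E] : exists a, b a = r by apply: (@b_onto ord0); rewrite rE root_of_root.
exists a0; split.
- split.
  + by move=> a _; apply: b_inj; rewrite b1E !b2E b1E f_iter_g.
  + by move=> a a1 _ _ E; apply/b_inj/(iter_g_inj (n := i)); rewrite -!b2E E.
  + move=> a _; have [n nE] := root_of_iter fa (b a); exists n.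
    by apply: b_inj; rewrite b1E b_iter1 -nE root_ofK.
- by apply: b_inj; rewrite b1E a0E fr.
- move=> a aE; apply: b_inj; rewrite a0E -(rE a) root_of_root //.
  by rewrite -b1E aE.
Qed.

Lemma wind_spread : wind (spread F b) G = F.
Proof.
have onto v : exists p, spread F b p = v.
  have /codomP[p ->] : v \in codom (spread F b); last by exists p.
  by apply: inj_card_onto spread_inj _ _; rewrite card_prod !card_ord cardX.
have spE j a : spread F b (j, a) = iter j g (b a) by rewrite ffunE.
apply/ffunP => v; have [[j a] <-] := onto v.
rewrite ffunE pinvK /=; last exact: spread_inj.
rewrite -/(pmap1 G a) -/(pmap2 G a) !spE [RHS]surjective_pairing; congr pair.
  by rewrite b1E -[RHS]/(f _) f_iter_g.
rewrite -[RHS]/(g _); case: ifP => ltj; first by rewrite /= inordK.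
have -> : j = i' :> nat by have := ltn_ord j; move: ltj; lia.
by rewrite b2E.
Qed.

Lemma spread0 : [ffun a => spread F b (ord0, a)] = b.
Proof. by apply/ffunP => a; rewrite !ffunE. Qed.

End FromCyclic.

Lemma card_labels_tree (F : {ffun X -> X * X}) : cyclic_forest F ->
  #|[set b : {ffun 'I_k -> X} | `[< labels_tree F b >]]| = (i * k`!)%N.
Proof.
move=> hF; have [fa _ cardr] := hF.
rewrite -sum1_card (partition_big (fun b : {ffun 'I_k -> X} => root_of fa (b ord0))
  (mem [set r | pmap1 F r == r])) /=; last by move=> b _; rewrite inE root_ofK.
rewrite -cardr -sum_nat_const; apply: eq_bigr => r; rewrite inE => /eqP fr.
(* [root_of] takes a proof of [forest_aut] as argument; any two proofs give the same root. *)
have fa_irr (fa' : forest_aut [set: X] (pmap1 F) (pmap2 F)) v :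
    root_of fa' v = root_of fa v.
  by have [c E] := root_of_iter fa' v; rewrite E; apply: root_of_uniq; rewrite -E root_ofK.
pose D := [set v | root_of fa v == r].
have cardD : #|D| = k.
  rewrite -(card_tree_at hF fr); apply: eq_card => v.
  by rewrite !inE fa_irr.
rewrite sum1_card; transitivity
  #|[set b : {ffun 'I_k -> X} in ffun_on (mem D) | injectiveb b]|; last first.
  by rewrite card_inj_ffuns_on cardD card_ord ffactnn.
apply: eq_card => b; rewrite [LHS]unfold_in [in LHS]inE [RHS]inE.
apply/idP/idP.
  case/andP => /asboolP/(labels_treeE _ hF)[b_inj [r1 fr1 rE]] /eqP r0.
  rewrite (introT (injectiveP b)) // andbT; apply/ffun_onP => a.
  have rE' a1 : root_of fa (b a1) = r1 by rewrite -(rE a1) [RHS]fa_irr.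
  by rewrite inE -r0 !rE'.
case/andP=> /ffun_onP bD /injectiveP b_inj.
have bE a : root_of fa (b a) = r by have := bD a; rewrite inE => /eqP.
apply/andP; rewrite bE; split=> //.
apply/asboolP/(labels_treeE _ hF); split=> //; exists r => // a.
by rewrite fa_irr.
Qed.

(** A cyclic forest with one labelled tree (i choices of the tree, k! labellings) corresponds to a
    labelling of all nodes by pairs (layer, label) together with a tree automorphism on k labels.
    This is the source of T(z^i) / i. *)
Lemma card_cyclic_forest :
  (#|[set F : {ffun X -> X * X} | `[< cyclic_forest F >]]| * (i * k`!) =
   (i * k)`! * #|[set G : {ffun 'I_k -> 'I_k * 'I_k} | `[< is_tree_aut G >]]|)%N.
Proof.
transitivity #|[pred p : {ffun X -> X * X} * {ffun 'I_k -> X} |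
    `[< cyclic_forest p.1 >] && `[< labels_tree p.1 p.2 >]]|.
  rewrite -sum_nat_const -[RHS]sum1_card.
  rewrite -(pair_big_dep (fun F : {ffun X -> X * X} => `[< cyclic_forest F >])
     (fun F (b : {ffun 'I_k -> X}) => `[< labels_tree F b >]) (fun _ _ => 1%N)) /=.
  apply: eq_big => [F|F]; rewrite inE // => /asboolP hF.
  by rewrite -(card_labels_tree hF) -sum1_card; apply: eq_bigl => b; rewrite inE.
transitivity #|[predX [set c : {ffun 'I_i * 'I_k -> X} | injectiveb c] &
    [set G : {ffun 'I_k -> 'I_k * 'I_k} | `[< is_tree_aut G >]]]|; last first.
  by rewrite fintype.cardX card_inj_ffuns cardX card_prod !card_ord ffactnn.
apply: (card_eq_can2 (h := fun p => (spread p.1 p.2, first_tree p.1 p.2))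
  (h' := fun p => (wind p.1 p.2, [ffun a => p.1 (ord0, a)]))) => -[x y] /=.
  rewrite inE => /andP[/asboolP hF /asboolP hb] /=; split.
    apply/andP; split; rewrite inE.
      exact/injectiveP/(spread_inj hF hb).
    exact/asboolP/(first_tree_aut hF hb).
  by rewrite wind_spread // spread0.
move=> /andP[]; rewrite !inE /= => /injectiveP c_inj hG.
have [H1 H2] := wind_cyclic c_inj hG.
rewrite spread_wind // first_tree_wind //; split=> //.
by apply/andP; split; apply/asboolP.
Qed.

End CyclicForests.

(** * From labelled to unlabelled trees *)

Section Relabelling.
Local Open Scope quotient_scope.
Variable n : nat.
Implicit Types (t : rtree n) (s : 'S_n).

Lemma conj_rtree_subproof t s : is_rtree [ffun v => s (t (s^-1 v)%g)].
Proof.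
have /existsP[r /andP[/eqP tr /forallP tc]] := valP t.
apply/existsP; exists (s r); rewrite ffunE permK tr eqxx /=; apply/forallP => v.
have /iter_findex := tc (s^-1 v)%g; set a := findex _ _ _ => E.
have <- : iter a [ffun v => s (t (s^-1 v)%g)] v = s r; last exact: fconnect_iter.
rewrite -E; elim: (a) => [|b IHb] /=; first by rewrite permKV.
by rewrite IHb ffunE permK.
Qed.

Definition conj_rtree t s : rtree n := RTree (conj_rtree_subproof t s).

Lemma is_isoP t t' s : reflect (forall v, s (t v) = t' (s v)) (is_iso t t' s).
Proof. by apply: (iffP forallP) => H v; apply/eqP/H. Qed.

Lemma is_iso_conj t t' s : is_iso t t' s = (t' == conj_rtree t s).
Proof.
apply/is_isoP/eqP => [H|-> v]; last by rewrite /= ffunE permK.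
by apply/val_inj/ffunP => v; rewrite /= ffunE H permKV.
Qed.

(** The isomorphisms from [t] to [t'] form a coset of the automorphism group. *)
Lemma card_iso t t' : iso t t' -> #|[set s | is_iso t t' s]| = #|Aut_rtree t|.
Proof.
case/existsP=> s0 /is_isoP s0P; rewrite -[RHS](card_rcoset _ s0); apply: eq_card => s.
rewrite mem_rcoset !inE; apply/is_isoP/is_isoP => H v.
  by rewrite !permM H; apply: (@perm_inj _ s0); rewrite s0P !permKV.
have := congr1 s0 (H v); rewrite s0P !permM !permKV.
by [].
Qed.

(** Orbit-stabilizer: each permutation [s] is an isomorphism from [t] to exactly one tree,
    [conj_rtree t s]. *)
Lemma card_iso_class t : (#|[set t' | iso t t']| * #|Aut_rtree t|)%N = n`!.
Proof.
rewrite -sum_nat_const -card_Sn -[RHS]sum1_card.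
transitivity (\sum_(t' in [set t' | iso t t']) \sum_(s : 'S_n) is_iso t t' s)%N.
  apply: eq_bigr => t'; rewrite inE => /card_iso <-.
  by rewrite -sum1_card big_mkcond; apply: eq_bigr => s _; rewrite inE; case: is_iso.
rewrite exchange_big /=; apply: eq_bigr => s _.
rewrite (bigD1 (conj_rtree t s)) /=; last first.
  by rewrite inE; apply/existsP; exists s; rewrite is_iso_conj.
rewrite is_iso_conj eqxx big1 // => t' /andP[_ nt].
by rewrite is_iso_conj (negPf nt).
Qed.

Lemma sum_polya (R : realType) (S : rtree n -> {poly R}) :
  (forall t t', iso t t' -> S t = S t') ->
  \sum_(T : polya n) #|Aut_rtree (repr T)|%:R^-1 *: S (repr T) =
  n`!%:R^-1 *: \sum_t S t.
Proof.
move=> Siso; rewrite (partition_big (fun t => \pi_(polya n) t) predT) //= scaler_sumr.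
apply: eq_bigr => T _; rewrite (eq_bigr (fun=> S (repr T))) => [|t /eqP tT]; last first.
  by apply: Siso; rewrite -tT; apply/(eqmodP (iso_equiv n)); rewrite reprK.
rewrite sumr_const -[S _ *+ _]scaler_nat scalerA; congr (_ *: _).
have -> : #|[pred t | \pi_(polya n) t == T]| = #|[set t' | iso (repr T) t']|.
  apply: eq_card => t; rewrite !inE -[in LHS](reprK T) eq_sym.
  exact: (eqmodE (iso_equiv n)).
rewrite -(card_iso_class (repr T)) natrM invfM mulrC mulrA mulfV ?mul1r //.
rewrite pnatr_eq0 -lt0n card_gt0; apply/set0Pn; exists (repr T).
by rewrite inE iso_refl.
Qed.

Lemma Dforest_moved_below t s v : Dforest t s v = moved_below t s v.
Proof.
apply/setP => w; rewrite [RHS]inE; apply/bigcupP/asboolP.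
  case=> c /andP[/andP[/eqP tc cv] nc]; rewrite inE => /iter_findex E.
  exists (findex t w c); rewrite E; split=> //; apply/eqP => //.
  by move: nc; rewrite inE.
case=> a [aE av ag]; exists (iter a t w); last by rewrite inE fconnect_iter.
by rewrite /child aE eqxx !inE; apply/andP; split; apply/eqP.
Qed.

Lemma mark_weightE (R : realType) m t s :
  'X^#|[set v in Cnodes s | #|Dforest t s v| == m]| =
  mark_weight R m [set: 'I_n] t s.
Proof.
rewrite /mark_weight -sum1_card -prodrXr big_mkcond [RHS]big_mkcond.
apply: eq_bigr => v _; rewrite !inE Dforest_moved_below /=.
by case: (s v == v); case: eqP.
Qed.

Lemma mark_weight_iso (R : realType) m t t' : iso t t' ->
  \sum_(s in Aut_rtree t) mark_weight R m [set: 'I_n] t s =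
  \sum_(s in Aut_rtree t') mark_weight R m [set: 'I_n] t' s.
Proof.
case/existsP=> s0 /is_isoP s0P.
rewrite [RHS](reindex_inj (conjg_inj s0)); apply: eq_big => [s|s _] /=.
  rewrite !inE; apply/is_isoP/is_isoP => H v.
    have [w ->] : exists w, v = s0 w by exists (s0^-1 v)%g; rewrite permKV.
    by rewrite -s0P !permM !permK H s0P.
  apply: (@perm_inj _ s0); have := H (s0 v).
  by rewrite -s0P !permM !permK s0P.
have E : s0 @: [set: 'I_n] = [set: 'I_n].
  by apply/setP => v; rewrite inE; apply/imsetP; exists (s0^-1 v)%g; rewrite ?permKV.
rewrite -[in RHS]E; symmetry; apply: natural_mark_weight.
split; rewrite ?E ?stableT //; first exact: perm_inj.
by move=> v _; rewrite permJ.
Qed.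

End Relabelling.

Section LabelledTrees.
Variable R : realType.
Local Notation PR := {poly R}.

Lemma rooted_aut_is_rtree n (f : {ffun 'I_n -> 'I_n}) (g : 'I_n -> 'I_n) r :
  rooted_aut r f g -> is_rtree f.
Proof.
case=> -[_ _ H3] fr ur; apply/existsP; exists r; rewrite fr eqxx; apply/forallP => v.
by have [a aE] := H3 v (finset.in_setT _); rewrite -(ur _ aE) fconnect_iter.
Qed.

Lemma is_tree_aut_rtree n (t : rtree n) (s : 'S_n) :
  (exists r, rooted_aut r t s) <-> s \in Aut_rtree t.
Proof.
rewrite inE; split=> [[r [[H1 _ _] _ _]]|/is_isoP H].
  by apply/is_isoP => v; rewrite H1 ?inE.
have /existsP[r /andP[/eqP tr /forallP tc]] := valP t.
exists r; split=> //.
  split=> [v _|v w _ _|v _]; [by rewrite H|exact: perm_inj|].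
  by exists (findex t v r); rewrite iter_findex // tr.
move=> v tv; have /iter_findex <- := tc v.
by elim: (findex _ _ _) => //= a <-.
Qed.

Lemma egf_tree_autE m n : (0 < n)%N ->
  egf (tree_aut R m) n = n`!%:R^-1 *: \sum_(t : rtree n)
    \sum_(s in Aut_rtree t) mark_weight R m [set: 'I_n] t s.
Proof.
case: n => // n _; rewrite /=; congr (_ *: _).
pose h (p : rtree n.+1 * 'S_n.+1) : {ffun 'I_n.+1 -> 'I_n.+1 * 'I_n.+1} :=
  [ffun v => (p.1 v, p.2 v)].
have h1 p : pmap1 (h p) = p.1 by apply/funext => v; rewrite /pmap1 ffunE.
have h2 p : pmap2 (h p) = p.2 by apply/funext => v; rewrite /pmap2 ffunE.
have h_inj : injective h.
  move=> [t s] [t' s'] E; congr pair.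
    by apply/val_inj/ffunP => v; rewrite -[LHS]/((t, s).1 v) -h1 E h1.
  by apply/permP => v; rewrite -[LHS]/((t, s).2 v) -h2 E h2.
rewrite pair_big_dep /=.
pose P := [set p : rtree n.+1 * 'S_n.+1 | p.2 \in Aut_rtree p.1].
transitivity (\sum_(F in h @: P) mark_weight R m [set: 'I_n.+1] (pmap1 F) (pmap2 F)).
  rewrite /total_weight [RHS]big_mkcond; apply: eq_big => F; first by rewrite supportedT.
  move=> _; rewrite (tree_autE _ _ ord0).
  have [[r Hr]|nr] := pselect (exists r, rooted_aut r (pmap1 F) (pmap2 F)).
    rewrite asboolT; last by exists r.
    rewrite mul1r ifT //; apply/imsetP.
    have g_inj : injective (pmap2 F).
      by have [[_ H _] _ _] := Hr; move=> v w; apply: H; rewrite inE.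
    pose f0 : {ffun 'I_n.+1 -> 'I_n.+1} := [ffun v => pmap1 F v].
    have f_tree : is_rtree f0.
      have fE : (f0 : 'I_n.+1 -> 'I_n.+1) = pmap1 F.
        by apply/funext => v; rewrite /f0 ffunE.
      by apply: (@rooted_aut_is_rtree _ _ (pmap2 F) r); rewrite fE.
    have hF : F = h (RTree f_tree, perm g_inj).
      by apply/ffunP => v; rewrite !ffunE permE /= -surjective_pairing.
    exists (RTree f_tree, perm g_inj) => //.
    rewrite inE /=; apply/is_tree_aut_rtree; exists r.
    by have := Hr; rewrite {1 2}hF h1 h2.
  rewrite asboolF // mul0r ifF //; apply/negbTE/imsetP => -[[t s]]; rewrite inE /= => ts FE.
  by apply: nr; rewrite FE h1 h2; apply/is_tree_aut_rtree.
rewrite big_imset /=; last by move=> p q _ _ /h_inj.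
by apply: eq_big => p; [rewrite inE|rewrite h1 h2].
Qed.

Lemma marked_gfE m n : (0 < n)%N -> marked_gf R m n = egf (tree_aut R m) n.
Proof.
move=> n_gt0; rewrite egf_tree_autE // -sum_polya /=; last first.
  by move=> t t'; exact: mark_weight_iso.
apply: eq_bigr => T _; congr (_ *: _); apply: eq_bigr => s _.
exact: mark_weightE.
Qed.

Lemma marked_gf0 m : marked_gf R m 0%N = 0.
Proof.
rewrite /= big1 // => T _.
by have /existsP[[]] := valP (repr T).
Qed.

Lemma marked_gf_horner1 m n : (marked_gf R m n).[1] = polya_gf R n.
Proof.
rewrite /= horner_sum -sum1_card natr_sum; apply: eq_bigr => T _.
rewrite hornerZ horner_sum (eq_bigr (fun=> 1)) => [|s _]; last by rewrite hornerXn expr1n.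
rewrite sumr_const mulVf // pnatr_eq0 -lt0n card_gt0; apply/set0Pn.
by exists 1%g; rewrite inE; apply/is_isoP => v; rewrite !perm1.
Qed.

End LabelledTrees.

(** * Unlabelled counting and the series D *)

Section Count.
Variable R : realType.
Local Notation PR := {poly R}.

(** Burnside's count: at u = 1 every isomorphism class has weight 1, so t_n is the number of
    labelled pairs of a tree and an automorphism, over n!. *)
Lemma polya_gf_tree_aut k :
  polya_gf R k.+1 =
  #|[set G : {ffun 'I_k.+1 -> 'I_k.+1 * 'I_k.+1} | `[< is_tree_aut G >]]|%:R / k.+1`!%:R.
Proof.
rewrite -(marked_gf_horner1 R 0) marked_gfE // [egf _ _]/= hornerZ mulrC; congr (_ / _).
rewrite /total_weight horner_sum -sum1_card natr_sum [RHS]big_mkcond.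
apply: eq_big => F; first by rewrite supportedT.
move=> _; rewrite (tree_autE _ _ ord0) hornerM inE -/(is_tree_aut F).
rewrite [X in _ * X]horner_prod [X in _ * X]big1 ?mulr1; last first.
  by move=> v _; rewrite hornerXn expr1n.
by case: asboolP => _; rewrite ?hornerC // -polyC1 hornerC.
Qed.

Lemma polya_gf0 : polya_gf R 0%N = 0.
Proof. by rewrite -(marked_gf_horner1 R 0) marked_gf0 horner0. Qed.

Lemma fps_dilateE (A : comNzRingType) i (F : fps A) n :
  fps_dilate i F n = if (i %| n)%N then F (n %/ i)%N else 0.
Proof. by []. Qed.

Definition log_D_gf : fps R :=
  Fps (fun n => \sum_(2 <= i < n.+1) fps_dilate i (polya_gf R) n / i%:R).

Lemma card_cyclic_dilate n i' : (0 < n)%N ->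
  #|[set F : {ffun 'I_n -> 'I_n * 'I_n} | `[< cyclic_forest i' F >]]|%:R =
  n`!%:R * (fps_dilate i'.+1 (polya_gf R) n / i'.+1%:R) :> R.
Proof.
move=> n_gt0; rewrite fps_dilateE; case: ifPn => [/dvdnP[[|k]]|ndvd].
- by move=> n0; rewrite n0 in n_gt0.
- rewrite mulnC => nE; have -> : (n %/ i'.+1)%N = k.+1 by rewrite nE mulKn.
  rewrite polya_gf_tree_aut.
  have := @card_cyclic_forest 'I_n i' k (etrans (card_ord n) nE); rewrite -nE.
  have : k.+1`!%:R != 0 :> R by rewrite pnatr_eq0 -lt0n fact_gt0.
  move: (k.+1`!) => K K0 /(congr1 (fun x => x%:R : R)).
  rewrite [LHS]natrM [RHS]natrM [in LHS]natrM => E.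
  have i0 : i'.+1%:R != 0 :> R by rewrite pnatr_eq0.
  apply: (mulIf (mulf_neq0 i0 K0)); rewrite E.
  by field; rewrite nat1r i0 K0.
- rewrite mul0r mulr0; apply/eqP; rewrite pnatr_eq0 cards_eq0; apply/eqP/setP => F.
  rewrite !inE; apply/negbTE/negP => /asboolP hF; case/negP: ndvd.
  have [fa _ _] := hF.
  have := mul_card_tree_at hF (root_ofK fa (Ordinal n_gt0)).
  by rewrite card_ord => <-; rewrite dvdn_mulr.
Qed.

(** In a linked forest every node is moved if and only if there are at least two roots: a fixed node
    has a fixed root, whose orbit is then the only one. The argument [i.-1] reflects that the
    parameter of [cyclic_forest] is the number of trees minus one. *)
Lemma linked_movedE n (F : {ffun 'I_n -> 'I_n * 'I_n}) : (0 < n)%N ->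
  (`[< linked [set: 'I_n] (pmap1 F) (pmap2 F) >]%:R *
   `[< forest_aut [set: 'I_n] (pmap1 F) (pmap2 F) /\
       all_moved [set: 'I_n] (pmap1 F) (pmap2 F) >]%:R : R) =
  \sum_(2 <= i < n.+1) `[< cyclic_forest i.-1 F >]%:R.
Proof.
move=> n_gt0; set f := pmap1 F; set g := pmap2 F.
have [fa|nfa] := pselect (forest_aut [set: 'I_n] f g); last first.
  rewrite [`[< _ /\ _ >]]asboolF ?mulr0 => [|[]//]; rewrite big1 // => i _.
  by rewrite asboolF // => -[].
have [l|nl] := pselect (linked [set: 'I_n] f g); last first.
  rewrite asboolF // mul0r big1 // => i _.
  by rewrite asboolF // => -[].
rewrite asboolT // mul1r.
pose Rt := [set r | f r == r]; pose r0 := root_of fa (Ordinal n_gt0).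
have r0Rt : r0 \in Rt by rewrite inE root_ofK.
have g_inj : injective g by have [_ H _] := fa; move=> v w; apply: H; rewrite inE.
have gRt r : f r = r -> f (g r) = g r.
  by have [H _ _] := fa; rewrite H ?inE // => ->.
have movedE : (1 < #|Rt|)%N <-> all_moved [set: 'I_n] f g.
  split=> [/card_gt1P[r [r1 [rR r1R rr1]]] v _ gv|am].
    have groot : g (root_of fa v) = root_of fa v by rewrite -root_of_g gv.
    have H w : w \in Rt -> w = root_of fa v.
      rewrite inE => /eqP fw; have /(linkedE fa)/(_ v w) := l.
      rewrite !inE (root_of_root fa fw) => /(_ isT isT)/iter_findex <-.
      by elim: (findex _ _ _) => //= a ->.
    by move: rr1; rewrite (H r rR) (H r1 r1R) eqxx.
  apply/card_gt1P; exists r0, (g r0); split=> //.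
    by rewrite inE gRt ?eqxx // root_ofK.
  by apply/eqP => /esym; apply: am; rewrite inE.
have cycE i : (0 < i)%N -> `[< cyclic_forest i.-1 F >] = (i == #|Rt|).
  move=> i_gt0; apply/asboolP/eqP => [[_ _]|E]; first by rewrite prednK.
  by split=> //; rewrite prednK.
have Rt_le : (#|Rt| <= n)%N by rewrite -[X in (_ <= X)%N]card_ord max_card.
rewrite big_nat_cond (eq_bigr (fun i => (i == #|Rt|)%:R)) => [|i /andP[/andP[i1 _] _]]; last first.
  by rewrite cycE // ltnW.
rewrite -big_nat_cond; have [Rt2|Rt2] := ltnP 1 #|Rt|.
  rewrite asboolT; last by split=> //; apply/movedE.
  rewrite (bigD1_seq #|Rt|) ?iota_uniq ?mem_index_iota ?Rt2 ?ltnS //= eqxx.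
  by rewrite big1 ?addr0 // => i /negPf->.
rewrite asboolF; last by move=> -[_ /movedE]; rewrite ltnNge Rt2.
rewrite big_nat_cond big1 // => i /andP[/andP[i2 _] _].
by case: eqP => // E; move: Rt2; rewrite -E leqNgt i2.
Qed.

Lemma egf_linked_moved n : (0 < n)%N ->
  egf (wmul (ind PR linked) (moved_forest R)) n = (log_D_gf n)%:P.
Proof.
move=> n_gt0; rewrite [egf _ _]/= /total_weight.
transitivity (n`!%:R^-1 *: (\sum_(F : {ffun 'I_n -> 'I_n * 'I_n})
   \sum_(2 <= i < n.+1) `[< cyclic_forest i.-1 F >]%:R : R)%:P).
  congr (_ *: _); rewrite raddf_sum; apply: eq_big => F; first by rewrite supportedT.
  by move=> _; rewrite -linked_movedE //= polyCM !polyC_natr.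
rewrite exchange_big /= -mul_polyC -polyCM big_distrr /=; congr (_ %:P).
rewrite big_nat_cond [RHS]big_nat_cond; apply: eq_bigr => i /andP[/andP[i2 _] _].
rewrite (_ : \sum_F _ = #|[set F : {ffun 'I_n -> 'I_n * 'I_n} | `[< cyclic_forest i.-1 F >]]|%:R).
  by rewrite card_cyclic_dilate // prednK ?(ltnW i2) // mulKf //.
rewrite -sum1_card natr_sum [RHS]big_mkcond; apply: eq_bigr => F _.
by rewrite inE; case: asboolP.
Qed.

End Count.

(** * The functional equation of the marked series *)

Section Decomposition.
Variable R : realType.
Local Notation PR := {poly R}.

Lemma egf_coef0 (a : weighting PR) :
  (forall f g, a 'I_0 [set: 'I_0] f g = 1) -> egf a 0%N = 1.
Proof.
move=> a1; rewrite /= fact0 invr1 scale1r /total_weight.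
rewrite (eq_bigr (fun=> 1)) => [|F _]; last exact: a1.
rewrite (eq_bigl predT) => [|F]; last by rewrite supportedT.
by rewrite sumr_const card_ffun card_prod !card_ord.
Qed.

Lemma egf_fixed_forest0 m : egf (fixed_forest R m) 0%N = 1.
Proof.
apply: egf_coef0 => f g; rewrite /fixed_forest /wmul indT.
  by rewrite mul1r /mark_weight big1 // => -[].
by split; [split|] => -[].
Qed.

Lemma egf_moved_forest0 : egf (moved_forest R) 0%N = 1.
Proof. by apply: egf_coef0 => f g; apply: indT; split; [split|] => -[]. Qed.

Lemma fps_theta_fixed_forest m :
  fps_theta (egf (fixed_forest R m)) =
  egf (fixed_forest R m) * fps_theta (egf (tree_aut R m)).
Proof.
apply: egf_components; first exact: natural_fixed_forest.
  exact: multiplicative_fixed_forest.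
by move=> n f g; rewrite mulf_eq0 negb_or => /andP[/ind_neq0[]].
Qed.

Lemma log_D_gf0 : log_D_gf R 0%N = 0.
Proof. by rewrite /= big_geq. Qed.

Lemma egf_moved_forest : egf (moved_forest R) = map_fps polyC (D_gf R).
Proof.
apply: (fps_theta_mul_uniq (@natr_reg_poly R)
  (H := fps_theta (map_fps polyC (log_D_gf R)))).
- by rewrite /= mul0r.
- by rewrite egf_moved_forest0 /= fps_exp_coef0.
- rewrite egf_components; first last.
  + by move=> n f g /ind_neq0[].
  + exact: multiplicative_moved_forest.
  + exact: natural_moved_forest.
  (* The two constant terms differ, since the empty set counts as linked; [fps_theta] erases
     both. *)
  congr (_ * _); apply/fpsP => -[|n]; first by rewrite /= !mul0r.
  by rewrite -[LHS]/(_ * egf _ _) egf_linked_moved.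
- by rewrite -!map_fps_theta -map_fpsM fps_theta_exp ?log_D_gf0.
Qed.

Lemma marked_gf_treelike m :
  marked_gf R m = (fpsX _ * egf (sized_moved_forest R m)) * egf (fixed_forest R m).
Proof.
rewrite -mulrA -egf_marked_forest; apply/fpsP => -[|n].
  by rewrite marked_gf0 coef_fpsXM.
by rewrite marked_gfE // egf_tree_autS coef_fpsXM.
Qed.

Lemma marked_gf_comp m (C : fps R) : C = fpsX R * fps_exp C ->
  marked_gf R m =
  fps_comp (map_fps polyC C) (fpsX _ * egf (sized_moved_forest R m)).
Proof.
move=> hC; rewrite marked_gf_treelike; apply: fps_comp_cayley => //.
- by rewrite coef_fpsXM.
- exact: egf_fixed_forest0.
- rewrite -marked_gf_treelike fps_theta_fixed_forest; congr (_ * _).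
  apply/fpsP => -[|n]; first by rewrite /= !mul0r.
  by rewrite -[LHS]/(_ * egf _ _) -marked_gfE.
Qed.

Lemma marked_argE m :
  let D := map_fps polyC (D_gf R) in
  let z := fpsX PR in
  let u := fpsC ('X : PR) in
  let dm := fpsC (D m) in
  u * z * (dm * z ^+ m) + z * (D - dm * z ^+ m) =
  z * egf (sized_moved_forest R m).
Proof.
move=> D z u dm; rewrite [u * z]mulrC -mulrA -mulrDr; congr (_ * _).
apply/fpsP => n; rewrite egf_sized_moved_forest egf_moved_forest -/D.
have zE : (z ^+ m) n = (n == m)%:R.
  rewrite -[z ^+ m]mulr1 coef_fpsXnM coef_fps1 subn_eq0.
  by rewrite [in RHS]eqn_leq andbC; case: leqP.
rewrite coef_fpsD coef_fpsB !coef_fpsCM zE.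
by case: eqP => [->|_]; rewrite ![nat_of_bool _]/= ?expr0 ?expr1; ring.
Qed.

End Decomposition.

(** * A renewal estimate *)

Section MoreComp.
Variable A : comNzRingType.
Implicit Types (a b F : fps A).

Lemma fps_compD a b F : fps_comp (a + b) F = fps_comp a F + fps_comp b F.
Proof.
apply/fpsP => n; rewrite coef_fpsD !coef_fps_comp -big_split.
by apply: eq_bigr => k _; rewrite coef_fpsD mulrDl.
Qed.

Lemma fps_compN a F : fps_comp (- a) F = - fps_comp a F.
Proof.
apply/fpsP => n; rewrite coef_fpsN !coef_fps_comp -sumrN.
by apply: eq_bigr => k _; rewrite coef_fpsN mulNr.
Qed.

Lemma fps_comp1 F : fps_comp 1 F = 1.
Proof.
apply/fpsP => n; rewrite coef_fps_comp big_ord_recl big1 => [|i _].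
  by rewrite addr0 mul1r expr0.
by rewrite mul0r.
Qed.

End MoreComp.

Section WeightedSums.
Variable R : realFieldType.
Implicit Types (w : nat -> R) (F G H : fps R) (N n : nat).

Definition fps_ge0 F := forall n, 0 <= F n.

(** A partial sum of a weighted l^1 norm. Bounds uniform in [N] stand for summability, and a
    submultiplicative [w] makes the norm submultiplicative. *)
Definition wsum w F N : R := \sum_(n < N) w n * F n.

Definition fps_abs F : fps R := Fps (fun n => `|F n|).

Lemma fps_ge0M F G : fps_ge0 F -> fps_ge0 G -> fps_ge0 (F * G).
Proof. by move=> F0 G0 n; rewrite coef_fpsM sumr_ge0 // => i _; rewrite mulr_ge0. Qed.

Lemma fps_ge0_1 : fps_ge0 1.
Proof. by move=> n; rewrite coef_fps1 ler0n. Qed.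

Lemma fps_ge0X F k : fps_ge0 F -> fps_ge0 (F ^+ k).
Proof.
by move=> F0; elim: k => [|k IHk]; rewrite ?expr0 ?exprS; [exact: fps_ge0_1|exact: fps_ge0M].
Qed.

Lemma fps_ge0_comp a F : fps_ge0 a -> fps_ge0 F -> fps_ge0 (fps_comp a F).
Proof.
move=> a0 F0 n; rewrite coef_fps_comp sumr_ge0 // => k _.
by rewrite mulr_ge0 //; exact: fps_ge0X.
Qed.

Lemma fps_ge0_theta F : fps_ge0 F -> fps_ge0 (fps_theta F).
Proof. by move=> F0 n; rewrite mulr_ge0. Qed.

Lemma fps_ge0_abs F : fps_ge0 (fps_abs F).
Proof. by move=> n; exact: normr_ge0. Qed.

Lemma fps_abs_id F : fps_ge0 F -> fps_abs F = F.
Proof. by move=> F0; apply/fpsP => n /=; rewrite ger0_norm. Qed.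

Lemma fps_absM_le F G n : fps_abs (F * G) n <= (fps_abs F * fps_abs G) n.
Proof.
rewrite /= !coef_fpsM (le_trans (ler_norm_sum _ _ _)) //.
by apply: ler_sum => i _; rewrite normrM.
Qed.

Lemma wsum_le w F G N : (forall n, 0 <= w n) -> (forall n, F n <= G n) ->
  wsum w F N <= wsum w G N.
Proof. by move=> w0 FG; apply: ler_sum => n _; rewrite ler_wpM2l. Qed.

Lemma wsum_ge0 w F N : (forall n, 0 <= w n) -> fps_ge0 F -> 0 <= wsum w F N.
Proof. by move=> w0 F0; apply: sumr_ge0 => n _; rewrite mulr_ge0. Qed.

Lemma wsumD w F G N : wsum w (F + G) N = wsum w F N + wsum w G N.
Proof. by rewrite /wsum -big_split; apply: eq_bigr => n _; rewrite coef_fpsD mulrDr. Qed.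

Lemma wsum_mono w F N N' : (forall n, 0 <= w n) -> fps_ge0 F -> (N <= N')%N ->
  wsum w F N <= wsum w F N'.
Proof.
move=> w0 F0 leN; rewrite /wsum -!(big_mkord predT (fun n => w n * F n)).
rewrite [leRHS](big_cat_nat (n := N)) //= lerDl sumr_ge0 // => n _.
by rewrite mulr_ge0.
Qed.

Lemma wsumM w F G N : wsum w (F * G) N =
  \sum_(i < N) \sum_(j < N | (i + j < N)%N) w (i + j)%N * (F i * G j).
Proof.
transitivity (\sum_(n < N) \sum_(i < N | (i <= n)%N) w n * (F i * G (n - i)%N)).
  apply: eq_bigr => n _; rewrite coef_fpsM big_distrr /=.
  by rewrite (big_ord_widen N (fun i => w n * (F i * G (n - i)%N))) //.
rewrite (exchange_big_dep predT) //=; apply: eq_bigr => i _.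
rewrite -(big_mkord (fun n => i <= n)%N (fun n => w n * (F i * G (n - i)%N))).
rewrite -(big_mkord (fun j => i + j < N)%N (fun j => w (i + j)%N * (F i * G j))).
rewrite (big_cat_nat (n := i)) //=; last by rewrite ltnW.
rewrite big_nat_cond big1 ?add0r => [|n /andP[/andP[_ ltni]]]; last by lia.
rewrite -{1}[nat_of_ord i]add0n big_addn.
rewrite [RHS](big_cat_nat (n := (N - i)%N)) //=; last exact: leq_subr.
rewrite [X in _ = _ + X]big_nat_cond [X in _ = _ + X]big1 ?addr0; last first.
  by move=> j /andP[/andP[]]; lia.
rewrite big_nat_cond [RHS]big_nat_cond; apply: eq_big => [n|n _].
  by apply/idP/idP; have := ltn_ord i; lia.
by rewrite addnK addnC.
Qed.

Lemma wsumM_le w F G N : (forall n, 0 <= w n) ->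
  (forall i j, w (i + j)%N <= w i * w j) -> fps_ge0 F -> fps_ge0 G ->
  wsum w (F * G) N <= wsum w F N * wsum w G N.
Proof.
move=> w0 wM F0 G0; rewrite wsumM /wsum big_distrl /=; apply: ler_sum => i _.
rewrite big_distrr /= big_mkcond; apply: ler_sum => j _.
rewrite mulrACA; case: ifP => _; first by rewrite ler_wpM2r // mulr_ge0.
by rewrite !mulr_ge0.
Qed.

Lemma wsumM_ge w F G N N' : (forall n, 0 <= w n) ->
  (forall i j, w (i + j)%N = w i * w j) -> fps_ge0 F -> fps_ge0 G ->
  wsum w F N * wsum w G N' <= wsum w (F * G) (N + N').
Proof.
move=> w0 wM F0 G0; rewrite wsumM /wsum big_distrl /=.
pose h i j := w (i + j)%N * (F i * G j).
rewrite (big_ord_widen (N + N') (fun i => w i * F i * \sum_(j < N') w j * G j)) ?leq_addr //.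
rewrite big_mkcond; apply: ler_sum => i _; case: ifP => [ltiN|_]; last first.
  by apply: sumr_ge0 => j _; rewrite !mulr_ge0.
rewrite big_distrr /= (big_ord_widen (N + N') (fun j => w i * F i * (w j * G j))) ?leq_addl //.
rewrite big_mkcond [leRHS]big_mkcond; apply: ler_sum => j _.
case: ifP => [ltjN|_]; last by case: ifP => _; rewrite // !mulr_ge0.
by rewrite ifT ?wM 1?mulrACA //; lia.
Qed.

(* The norm of [V = 1 - V (H - 1)] is at most [1 + |V| |H - 1|]. *)
Lemma wsum_inverse_le w V H k N : (forall n, 0 <= w n) -> w 0%N = 1 ->
  (forall i j, w (i + j)%N <= w i * w j) ->
  V * H = 1 -> wsum w (fps_abs (H - 1)) N <= k -> k < 1 ->
  wsum w (fps_abs V) N <= (1 - k)^-1.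
Proof.
move=> w0 w_0 wM VH Hk k1; rewrite -div1r ler_pdivlMr ?subr_gt0 //.
rewrite mulrBr mulr1 lerBlDr.
have VE : V = 1 - V * (H - 1) by rewrite mulrBr VH mulr1 opprB addrC subrK.
apply: (@le_trans _ _ (wsum w (1 + fps_abs V * fps_abs (H - 1)) N)).
  apply: wsum_le => // n; rewrite coef_fpsD.
  have -> : fps_abs V n = `|(1 : fps R) n - (V * (H - 1)) n| by rewrite -coef_fpsB -VE.
  rewrite (le_trans (ler_normB _ _)) // lerD //; last exact: fps_absM_le.
  by rewrite ger0_norm // fps_ge0_1.
rewrite wsumD lerD //.
  rewrite /wsum; case: N {Hk} => [|N]; first by rewrite big_ord0.
  rewrite big_ord_recl w_0 mul1r big1 ?addr0 // => i _.
  by rewrite coef_fps1 mulr0.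
apply: le_trans (wsumM_le _ _ _ _ _) _ => //; try exact: fps_ge0_abs.
by rewrite ler_wpM2l // wsum_ge0 //; exact: fps_ge0_abs.
Qed.

End WeightedSums.

(** * Comparing coefficients of a renewal series *)

Section RenewalRatio.
Variable R : realFieldType.
Variables (phi : fps R) (b : nat -> R) (k M : R).
Hypothesis phi0 : phi 0%N = 0.
Hypothesis phi_ge0 : fps_ge0 phi.

Definition ones : fps R := Fps (fun=> 1).

(* The tails [\sum_(l > j) phi l], when [phi] sums to 1. *)
Definition tails : fps R := ones * (1 - phi).

Hypothesis tails_ge0 : fps_ge0 tails.
Hypothesis k_lt1 : k < 1.
(** The tails of a law sum to its mean, so [k] bounds the mean minus one. *)
Hypothesis tails_mean : forall N, wsum (fun=> 1) (tails - 1) N <= k.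
Hypothesis tails_moment2 : forall N, wsum (fun j => (1 + j%:R) ^+ 2) tails N <= M.
Hypothesis phi_moment2 : forall N, wsum (fun j => j%:R ^+ 2) phi N <= M.
Hypothesis b_gt0 : forall j, (0 < j)%N -> 0 < b j.
Hypothesis b_noninc : forall j, (0 < j)%N -> b j.+1 <= b j.
Hypothesis b_nondec : forall j, (0 < j)%N -> j%:R * b j <= j.+1%:R * b j.+1.

Let B1 : fps R := fps_comp (Fps (fun j => b j.+1)) phi.
(** The renewal series 1 / (1 - phi): [U n] is the probability that a walk with step law [phi]
    visits n. *)
Let U : fps R := fps_comp ones phi.

Lemma onesE : ones = 1 + fpsX R * ones.
Proof.
apply/fpsP => -[|n]; rewrite coef_fpsD coef_fpsXM coef_fps1 /=; first by rewrite addr0.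
by rewrite add0r.
Qed.

Lemma ones_mul : (1 - fpsX R) * ones = 1.
Proof. by rewrite mulrBl mul1r {1}onesE addrK. Qed.

Lemma comp_1X : fps_comp (1 - fpsX R) phi = 1 - phi.
Proof. by rewrite fps_compD fps_compN fps_comp1 fps_compX. Qed.

Let UE : (1 - phi) * U = 1.
Proof. by rewrite -comp_1X -fps_compM // ones_mul fps_comp1. Qed.

Let V := (1 - fpsX R) * U.

Let V_tails : V * tails = 1.
Proof. by rewrite /V /tails mulrACA ones_mul mul1r mulrC UE. Qed.

Let tails_U : tails * U = ones.
Proof. by rewrite /tails -mulrA UE mulr1. Qed.

Let U_ge0 : fps_ge0 U.
Proof. by apply: fps_ge0_comp => // n; rewrite ler01. Qed.

Let tails0 : tails 0%N = 1.
Proof. by rewrite /tails coef0_fpsM coef_fpsB phi0 subr0 mulr1. Qed.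

Let tails1_ge0 : fps_ge0 (tails - 1).
Proof.
move=> [|n]; rewrite coef_fpsB coef_fps1; first by rewrite tails0 subrr.
by rewrite subr0 tails_ge0.
Qed.

Let U_le1 n : U n <= 1.
Proof.
have /fpsP/(_ n) := tails_U; rewrite coef_fpsM big_ord_recl tails0 mul1r subn0 => E.
have -> : 1 = ones n by []; rewrite -E lerDl sumr_ge0 // => i _.
by rewrite mulr_ge0 //; exact: tails_ge0.
Qed.

(** Coefficient n of tails U = 1 / (1 - x) reads 1 = U_n + [x^n] (tails - 1) U, and U <= 1 bounds
    the last term by the mass [k] of tails - 1. *)
Let U_ge n : 1 - k <= U n.
Proof.
have /fpsP/(_ n) := tails_U; rewrite -[tails](subrK 1) mulrDl mul1r coef_fpsD => E.
have {1}<- : ones n = 1 by [].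
rewrite -E lerBlDr [leLHS]addrC lerD2l (le_trans _ (tails_mean n.+1)) //.
rewrite coef_fpsM; apply: ler_sum => i _; rewrite mul1r.
by rewrite ler_piMr // tails1_ge0.
Qed.

Let b_le j n : (0 < j)%N -> (j <= n)%N -> b n <= b j.
Proof.
move=> j0; elim: n => [|n IHn]; first by move: j0; case: j.
rewrite leq_eqVlt => /predU1P[<-//|ltjn].
by rewrite (le_trans (b_noninc _)) ?IHn //; lia.
Qed.

Let b_ratio j n : (0 < j)%N -> (j <= n)%N -> j%:R * b j <= n%:R * b n.
Proof.
move=> j0; elim: n => [|n IHn]; first by move: j0; case: j.
rewrite leq_eqVlt => /predU1P[<-//|ltjn].
by rewrite (le_trans _ (b_nondec _)) ?IHn //; lia.
Qed.

Let phiX_ge0 j n : 0 <= (phi ^+ j) n. Proof. exact: fps_ge0X. Qed.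

Let M_ge0 : 0 <= M.
Proof. by apply: le_trans (phi_moment2 0); rewrite /wsum big_ord0. Qed.

Let Usum_le n N : (\sum_(j < N) phi ^+ j) n <= 1.
Proof.
rewrite coef_fps_sum; apply: le_trans (U_le1 n).
rewrite /U (@coef_fps_comp_bound _ _ _ _ (n + N)) ?leq_addr //.
rewrite (big_ord_widen (n + N).+1 (fun j => (phi ^+ j) n)); last by lia.
rewrite big_mkcond; apply: ler_sum => j _; rewrite /= mul1r.
by case: ifP.
Qed.

Let wsum1_theta2 N : wsum (fun=> 1) (fps_theta (fps_theta phi)) N <= M.
Proof.
apply: le_trans (phi_moment2 N); apply: ler_sum => j _ /=.
by rewrite mul1r mulrA expr2.
Qed.

Let wsum1_theta N : wsum (fun=> 1) (fps_theta phi) N <= M.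
Proof.
apply: le_trans (phi_moment2 N); apply: ler_sum => j _ /=.
rewrite mul1r ler_wpM2r // -natrX ler_nat.
by case: (nat_of_ord j) => // i; rewrite -mulnn leq_pmulr.
Qed.

Let coefM_le (F G : fps R) n c : fps_ge0 F -> 0 <= c -> (forall i, G i <= c) ->
  (F * G) n <= c * wsum (fun=> 1) F n.+1.
Proof.
move=> F0 c0 Gc; rewrite coef_fpsM /wsum big_distrr /=; apply: ler_sum => i _.
by rewrite mul1r mulrC ler_wpM2r.
Qed.

(* Differentiating [phi ^+ j] twice shows that
   [n ^ 2 [z ^ n] phi ^ j <= j (j + 1) moment2 j n]. *)
Let moment2 j n := (fps_theta (fps_theta phi) * phi ^+ j.-1) n +
                   (fps_theta phi * fps_theta phi * phi ^+ j.-2) n.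

Let th_ge0 : fps_ge0 (fps_theta phi). Proof. exact: fps_ge0_theta. Qed.

Let th2_ge0 : fps_ge0 (fps_theta (fps_theta phi)). Proof. exact: fps_ge0_theta. Qed.

Let thth_ge0 : fps_ge0 (fps_theta phi * fps_theta phi). Proof. exact: fps_ge0M. Qed.

Let fps_ge0_phiX j : fps_ge0 (phi ^+ j). Proof. exact: fps_ge0X. Qed.

Let moment2_ge0 j n : 0 <= moment2 j n.
Proof. by rewrite addr_ge0 //; apply: fps_ge0M. Qed.

Let phiX_le j n : n%:R ^+ 2 * (phi ^+ j) n <= (j * j.+1)%:R * moment2 j n.
Proof.
have E2 : fps_theta (fps_theta phi * phi ^+ j.-1 *+ j) =
    (fps_theta (fps_theta phi) * phi ^+ j.-1 +
     fps_theta phi * fps_theta phi * phi ^+ j.-2 *+ j.-1) *+ j.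
  have -> : fps_theta phi * fps_theta phi * phi ^+ j.-2 *+ j.-1 =
      fps_theta phi * fps_theta (phi ^+ j.-1).
    by rewrite fps_thetaX_exp mulrnAr mulrA.
  rewrite -fps_thetaM.
  by apply/fpsP => l; rewrite /= !coef_fpsMn mulrnAr.
have /fpsP/(_ n) := congr1 (@fps_theta R) (fps_thetaX_exp phi j).
rewrite [LHS]/= mulrA -expr2 => ->.
rewrite E2 coef_fpsMn coef_fpsD coef_fpsMn /moment2.
move: (fps_ge0M th2_ge0 (fps_ge0_phiX j.-1) n) (fps_ge0M thth_ge0 (fps_ge0_phiX j.-2) n).
move: (_ n) (_ n) => a c a0 c0.
rewrite -[leLHS]mulr_natl natrM -mulrA ler_wpM2l // mulrDr lerD //.
  by rewrite ler_peMl ?ler1n.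
by rewrite -[leLHS]mulr_natl ler_wpM2r // ler_nat; lia.
Qed.

Let sum_moment2 n : \sum_(j < n) moment2 j.+1 n <= M + 2 * M ^+ 2.
Proof.
rewrite big_split /= -!coef_fps_sum -!big_distrr /=; apply: lerD.
  apply: le_trans (coefM_le n th2_ge0 ler01 (fun i => Usum_le i n)) _.
  by rewrite mul1r.
(* The exponent [j.-1] is 0 for both j = 0 and j = 1, so phi^0 may occur twice and the bound is 2
   instead of 1. *)
have le2 i : (\sum_(j < n) phi ^+ j.-1) i <= 2.
  case: (n) => [|n']; first by rewrite big_ord0 ler0n.
  rewrite big_ord_recl coef_fpsD -[2]/(1 + 1); apply: lerD; last exact: Usum_le.
  by rewrite -[_ ^+ _]/(1 : fps R) coef_fps1 lern1; case: (i == _).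
apply: le_trans (coefM_le n thth_ge0 _ le2) _ => //.
rewrite ler_wpM2l // expr2; apply: le_trans (wsumM_le _ _ _ th_ge0 th_ge0) _ => //.
  by move=> ? ?; rewrite mul1r.
by rewrite ler_pM // wsum_ge0.
Qed.

Let Fs := (1 - phi) * B1.

(** The summand 1 makes [K0] at least 1, which [Fs_shift] uses for the coefficient [Fs 0 = b 1]. *)
Let K0 := M + 2 * M ^+ 2 + 1.

Let Fs0 : Fs 0%N = b 1%N.
Proof. by rewrite /Fs coef0_fpsM coef_fpsB phi0 subr0 mul1r /B1 fps_comp_coef0. Qed.

Let FsE n : (0 < n)%N -> Fs n = \sum_(j < n) (b j.+2 - b j.+1) * (phi ^+ j.+1) n.
Proof.
case: n => // n _; rewrite /Fs -comp_1X /B1 -fps_compM // coef_fps_comp.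
rewrite big_ord_recl expr0 coef_fps1 mulr0 add0r; apply: eq_bigr => j _.
by congr (_ * _); rewrite mulrBl mul1r coef_fpsB coef_fpsXM.
Qed.

(** Two factors absorb the bound (j + 1)(j + 2) on n^2 [x^n] phi^(j + 1): (j + 2)(b_(j+1) - b_(j+2))
    <= b_(j+1), then (j + 1) b_(j+1) <= n b_n. What remains is n b_n / n^2 times a summable
    moment. *)
Let Fs_le n : (0 < n)%N -> `|Fs n| <= K0 * (b n / n%:R).
Proof.
move=> n0; rewrite FsE // (le_trans (ler_norm_sum _ _ _)) //.
have nR : 0 < n%:R :> R by rewrite ltr0n.
have bn := b_gt0 n0.
apply: (@le_trans _ _ (\sum_(j < n) moment2 j.+1 n * (b n / n%:R))); last first.
  rewrite -big_distrl ler_wpM2r ?divr_ge0 ?(ltW bn) ?(ltW nR) //.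
  by rewrite (le_trans (sum_moment2 n)) // /K0 lerDl.
apply: ler_sum => j _; rewrite normrM (ger0_norm (phiX_ge0 _ _)).
rewrite ler0_norm ?subr_le0 ?b_noninc // opprB.
rewrite -(ler_pM2l (exprn_gt0 2 nR)).
have -> : n%:R ^+ 2 * (moment2 j.+1 n * (b n / n%:R)) = n%:R * b n * moment2 j.+1 n.
  by field; rewrite gt_eqF.
rewrite mulrCA.
have j0 : 0 < j.+1%:R :> R by rewrite ltr0n.
have j1 : 0 < j.+2%:R :> R by rewrite ltr0n.
have d_ge0 : 0 <= b j.+1 - b j.+2 by rewrite subr_ge0 b_noninc.
rewrite (le_trans (ler_wpM2l d_ge0 (phiX_le j.+1 n))) // mulrA ler_wpM2r //.
have := b_ratio (ltn0Sn j) (ltn_ord j); have := b_nondec (ltn0Sn j).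
rewrite natrM => h1 h2.
have d : (b j.+1 - b j.+2) * j.+2%:R <= b j.+1.
  have E : j.+2%:R = j.+1%:R + 1 :> R by rewrite natr1.
  by rewrite E in h1 *; nra.
apply: le_trans h2; rewrite [j.+1%:R * j.+2%:R]mulrC mulrA [leLHS]mulrC.
by rewrite ler_wpM2l // ltW.
Qed.

(** For i < n, monotonicity of j b_j gives b_(n-i) / (n-i) <= n b_n / (n-i)^2, and n <= (n-i)(1 + i)
    turns this into (1 + i)^2 b_n / n. For i = n, b_1 <= n b_n suffices. *)
Let Fs_shift n i : (0 < n)%N -> (i <= n)%N ->
  `|Fs (n - i)%N| <= K0 * (b n / n%:R) * (1 + i%:R) ^+ 2.
Proof.
move=> n0 lein; have nR : 0 < n%:R :> R by rewrite ltr0n.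
have bn := b_gt0 n0.
have K0_ge1 : 1 <= K0.
  by rewrite /K0 lerDr addr_ge0 // mulr_ge0 // exprn_ge0.
move: lein; rewrite leq_eqVlt => /predU1P[->|ltin].
  rewrite subnn Fs0 ger0_norm ?(ltW (b_gt0 _)) //.
  have := b_ratio (ltn0Sn 0) n0; rewrite mul1r => h; apply: le_trans h _.
  have -> : K0 * (b n / n%:R) * (1 + n%:R) ^+ 2 =
            (n%:R * b n) * (K0 * ((1 + n%:R) ^+ 2 / n%:R ^+ 2)).
    by field; rewrite gt_eqF.
  rewrite ler_peMr ?mulr_ge0 ?(ltW bn) ?(ltW nR) //.
  rewrite mulr_ege1 // ler_pdivlMr ?exprn_gt0 // mul1r lerXn2r ?nnegrE ?(ltW nR) //.
  by rewrite lerDr.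
have ni0 : (0 < n - i)%N by rewrite subn_gt0.
have niR : 0 < (n - i)%:R :> R by rewrite ltr0n.
apply: le_trans (Fs_le ni0) _; rewrite -mulrA ler_wpM2l ?(le_trans ler01) //.
rewrite ler_pdivrMr //.
have h := b_ratio ni0 (leq_subr i n).
rewrite -(ler_pM2l niR); apply: le_trans h _.
have -> : (n - i)%:R * (b n / n%:R * (1 + i%:R) ^+ 2 * (n - i)%:R) =
  (n%:R * b n) * (((n - i)%:R * (1 + i%:R)) / n%:R) ^+ 2.
  by field; rewrite gt_eqF.
rewrite ler_peMr ?mulr_ge0 ?(ltW bn) ?(ltW nR) //.
rewrite exprn_ege1 // ler_pdivlMr // mul1r -[1 + _]/(1%:R + _) -natrD -natrM ler_nat.
nia.
Qed.

Let y := phi * B1.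

(** Since [b] is nonincreasing, each of the weights b_j, 1 <= j <= n, is at least b_n; the powers of
    [phi] then add up to [U n]. *)
Let y_ge n : (0 < n)%N -> b n * (1 - k) <= y n.
Proof.
move=> n0; have -> : y = fps_comp (fpsX R * Fps (fun j => b j.+1)) phi.
  by rewrite fps_compM // fps_compX.
rewrite coef_fps_comp.
apply: (@le_trans _ _ (b n * U n)); first by rewrite ler_pM2l ?b_gt0.
rewrite /U coef_fps_comp big_distrr /=; apply: ler_sum => j _.
rewrite coef_fpsXM mul1r; case: j => -[|j] /= ltj.
  by rewrite gtn_eqF // mulr0 mul0r.
by rewrite ler_wpM2r // b_le.
Qed.

Section Weight.
Variable e : R.
Hypotheses (e0 : 0 < e) (e1 : e <= 1).

(** Submultiplicative, comparable to (1 + j)^2, and so close to 1 for small [e] that the norm of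
    tails - 1 stays below 1. *)
Let w j : R := (1 + e * j%:R) ^+ 2.

Let w_ge0 j : 0 <= w j. Proof. exact: sqr_ge0. Qed.

Let w0 : w 0%N = 1. Proof. by rewrite /w mulr0 addr0 expr1n. Qed.

Let w_nneg j : 0 <= 1 + e * j%:R.
Proof. by rewrite addr_ge0 // mulr_ge0 // ltW. Qed.

Let wM i j : w (i + j)%N <= w i * w j.
Proof.
rewrite /w -exprMn lerXn2r ?nnegrE ?mulr_ge0 //.
rewrite natrD -subr_ge0.
have -> : (1 + e * i%:R) * (1 + e * j%:R) - (1 + e * (i%:R + j%:R))
  = e * i%:R * (e * j%:R) by ring.
by rewrite !mulr_ge0 // ltW.
Qed.

Let sq_le_w j : (1 + j%:R) ^+ 2 <= e ^- 2 * w j.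
Proof.
rewrite mulrC ler_pdivlMr ?exprn_gt0 // -exprMn lerXn2r ?nnegrE //.
- by rewrite mulr_ge0 ?addr_ge0 // ltW.
- by rewrite mulrDl mul1r lerD // mulrC.
Qed.

Hypothesis eM : k + e * M < 1.

(** [V] is the inverse of [tails]. As e <= 1, (1 + e x)^2 <= 1 + e (1 + x)^2, so the weighted norm
    of tails - 1 exceeds its mass by at most e M. *)
Let wsum_V N : wsum w (fps_abs V) N <= (1 - (k + e * M))^-1.
Proof.
apply: (wsum_inverse_le w_ge0 w0 wM V_tails) => //.
rewrite (fps_abs_id tails1_ge0).
apply: (@le_trans _ _ (wsum (fun=> 1) (tails - 1) N +
                       e * wsum (fun j => (1 + j%:R) ^+ 2) tails N)); last first.
  by rewrite lerD // ler_wpM2l // ltW.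
rewrite /wsum big_distrr -big_split; apply: ler_sum => j _.
rewrite coef_fpsB coef_fps1; case: j => -[|j] /= _.
  by rewrite tails0 subrr mulr0 mul1r add0r mulr_ge0 ?(ltW e0) // addr0 expr1n mul1r.
rewrite subr0 mulrA -mulrDl ler_wpM2r //.
rewrite /w; set x := j.+1%:R; have x0 : 0 <= x by [].
have : e * e * x ^+ 2 <= e * x ^+ 2.
  by rewrite ler_wpM2r ?exprn_ge0 // ler_piMl // ltW.
move=> H; rewrite -subr_ge0.
have -> : 1 + e * (1 + x) ^+ 2 - (1 + e * x) ^+ 2 = e + (e * x ^+ 2 - e * e * x ^+ 2) by ring.
by rewrite addr_ge0 ?(ltW e0) // subr_ge0.
Qed.

Variable m : nat.

(** This is (x^(m+1) - phi) / (1 - phi): the geometric sum cancels the factor 1 - x of [V] and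
    leaves 1 - x^(m+1). *)
Let Q := 1 - (\sum_(l < m.+1) fpsX R ^+ l) * V.

Let QE : (fpsX R ^+ m.+1 - phi) * B1 = Q * Fs.
Proof.
rewrite /Q /Fs mulrA; congr (_ * _).
have E : (\sum_(l < m.+1) fpsX R ^+ l) * V * (1 - phi) = 1 - fpsX R ^+ m.+1.
  rewrite -mulrA /V -[_ * U * _]mulrA [U * _]mulrC UE mulr1 mulrC.
  by rewrite -[1 - _ ^+ _]opprB subrX1 -mulNr opprB.
by rewrite mulrBl mul1r E; ring.
Qed.

Let wsum_1 N : wsum w (1 : fps R) N <= 1.
Proof.
rewrite /wsum; case: N => [|N]; first by rewrite big_ord0.
rewrite big_ord_recl w0 mul1r big1 ?addr0 // => i _.
by rewrite coef_fps1 mulr0.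
Qed.

Let wsum_Q : exists K, forall N, wsum w (fps_abs Q) N <= K.
Proof.
pose S : fps R := \sum_(l < m.+1) fpsX R ^+ l.
have S0 : fps_ge0 S.
  move=> n; rewrite coef_fps_sum sumr_ge0 // => l _; apply: fps_ge0X => i /=.
  exact: ler0n.
exists (1 + wsum w S m.+1 * (1 - (k + e * M))^-1) => N.
apply: (@le_trans _ _ (wsum w (1 + S * fps_abs V) N)).
  apply: wsum_le => // n; rewrite coef_fpsD.
  have -> : fps_abs Q n = `|(1 : fps R) n - (S * V) n| by rewrite -coef_fpsB.
  rewrite (le_trans (ler_normB _ _)) // lerD //.
    by rewrite ger0_norm // fps_ge0_1.
  by have := fps_absM_le S V n; rewrite (fps_abs_id S0).
rewrite wsumD lerD //.
apply: le_trans (wsumM_le _ w_ge0 wM S0 (@fps_ge0_abs _ _)) _.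
have S_fin : wsum w S N <= wsum w S m.+1.
  have [le|lt] := leqP N m.+1; first exact: wsum_mono.
  rewrite /wsum -!(big_mkord predT (fun n => w n * S n)).
  rewrite (big_cat_nat (n := m.+1)) 1?ltnW //= gerDl.
  rewrite big_nat_cond big1 // => n /andP[/andP[lem _] _].
  rewrite coef_fps_sum big1 ?mulr0 // => l _.
  rewrite -[fpsX R ^+ l]mulr1 coef_fpsXnM coef_fps1.
  by case: ifP => // _; case: eqP => //; have := ltn_ord l; lia.
by rewrite ler_pM // wsum_ge0 //; exact: fps_ge0_abs.
Qed.

Lemma renewal_ratio_weight : exists K, forall n, (0 < n)%N ->
  0 < y n /\ `|(fpsX R ^+ m.+1 * B1) n - y n| <= K / n%:R * y n.
Proof.
have [KQ KQP] := wsum_Q.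
have KQ0 : 0 <= KQ by apply: le_trans (KQP 0); rewrite /wsum big_ord0.
have K0_ge0 : 0 <= K0 by rewrite /K0 !addr_ge0 // mulr_ge0 // exprn_ge0.
exists (K0 * e ^- 2 * KQ / (1 - k)) => n n0.
have k0 : 0 < 1 - k by rewrite subr_gt0.
have nR : 0 < n%:R :> R by rewrite ltr0n.
have bn := b_gt0 n0.
split; first by rewrite (lt_le_trans _ (y_ge n0)) // mulr_gt0.
rewrite -coef_fpsB -mulrBl QE coef_fpsM (le_trans (ler_norm_sum _ _ _)) //.
apply: (@le_trans _ _ (\sum_(i < n.+1) K0 * (b n / n%:R) * e ^- 2 * (w i * fps_abs Q i))).
  apply: ler_sum => i _; rewrite normrM mulrC.
  apply: (@le_trans _ _ (K0 * (b n / n%:R) * (1 + i%:R) ^+ 2 * `|Q i|)).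
    by rewrite ler_wpM2r // Fs_shift // -ltnS.
  rewrite [leRHS]mulrA ler_wpM2r // -[leRHS]mulrA ler_wpM2l //.
  by rewrite mulr_ge0 // divr_ge0 // ltW.
rewrite -big_distrr /= -/(wsum w (fps_abs Q) n.+1).
apply: (@le_trans _ _ (K0 * (b n / n%:R) * e ^- 2 * KQ)).
  by rewrite ler_wpM2l // !mulr_ge0 ?invr_ge0 ?exprn_ge0 // ltW.
have -> : K0 * (b n / n%:R) * e ^- 2 * KQ =
    (K0 * e ^- 2 * KQ / (1 - k) / n%:R) * (b n * (1 - k)).
  by field; rewrite !gt_eqF.
by rewrite ler_wpM2l ?y_ge // !mulr_ge0 ?invr_ge0 ?exprn_ge0 // ltW.
Qed.

End Weight.

Lemma renewal_ratio m : exists K, forall n, (0 < n)%N ->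
  0 < y n /\ `|(fpsX R ^+ m.+1 * B1) n - y n| <= K / n%:R * y n.
Proof.
have d0 : 0 < 2 * (M + 1) by rewrite mulr_gt0 // ltr_wpDl.
(* This makes e M at most (1 - k) / 2, hence k + e M < 1. *)
pose e := Num.min 1 ((1 - k) / (2 * (M + 1))).
apply: (@renewal_ratio_weight e).
- by rewrite lt_min ltr01 divr_gt0 // subr_gt0.
- by rewrite ge_min lexx.
- have : e * M <= (1 - k) / 2; last by move: k_lt1; lra.
  apply: (@le_trans _ _ ((1 - k) / (2 * (M + 1)) * M)).
    by rewrite ler_wpM2r // ge_min lexx orbT.
  rewrite invfM mulrA -mulrA ler_piMr // ?divr_ge0 ?subr_ge0 ?(ltW k_lt1) //.
  by rewrite mulrC ler_pdivrMr ?mul1r ?lerDl // ltr_wpDl.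
Qed.

End RenewalRatio.

(** * Coefficients of the Cayley tree series *)

Section Abel.
Variable K : numFieldType.

(** Pascal's rule writes the difference of order n + 1 as one of order n of (x + i)^m - (x + i +
    1)^m, whose degree is below m. *)
Lemma finite_difference_eq0 n m (x : K) : (m < n)%N ->
  \sum_(i < n.+1) (-1) ^+ i * 'C(n, i)%:R * (x + i%:R) ^+ m = 0.
Proof.
elim: n m x => // n IHn m x; rewrite ltnS => lemn.
pose T i := (-1) ^+ i * 'C(n, i)%:R * ((x + i%:R) ^+ m - (x + i.+1%:R) ^+ m).
transitivity (\sum_(i < n.+1) T i); last first.
  transitivity (\sum_(i < n.+1) \sum_(l < m)
      - 'C(m, l)%:R * ((-1) ^+ i * 'C(n, i)%:R * (x + i%:R) ^+ l)).
    apply: eq_bigr => i _; rewrite /T -natr1 addrA [_ + 1]addrC [(1 + _) ^+ m]exprDn big_ord_recr /= subnn.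
    rewrite expr0 mul1r binn mulr1n opprD addrCA subrr addr0 -sumrN big_distrr /=.
    apply: eq_bigr => l _; rewrite expr1n mul1r -mulr_natl; ring.
  rewrite exchange_big big1 //= => l _.
  by rewrite -big_distrr /= IHn ?mulr0 // (leq_trans (ltn_ord l)).
pose A i := (-1) ^+ i * 'C(n, i)%:R * (x + i%:R) ^+ m.
pose B i := - ((-1) ^+ i * 'C(n, i)%:R * (x + i.+1%:R) ^+ m).
transitivity (\sum_(i < n.+1) A i + \sum_(i < n.+1) B i); last first.
  by rewrite -big_split; apply: eq_bigr => i _; rewrite /T /A /B mulrBr.
rewrite big_ord_recl [in RHS]big_ord_recl -addrA; congr (_ + _); first by rewrite /A !bin0.
transitivity (\sum_(i < n.+1) (A i.+1 + B i)).
  by apply: eq_bigr => i _; rewrite /A /B lift0 binS natrD exprS; ring.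
rewrite big_split; congr (_ + _); rewrite big_ord_recr /=.
by rewrite /A bin_small // mulr0 mul0r addr0; apply: eq_bigr => i _.
Qed.

(** Abel's expansion of x^n; [i.+1%:R ^+ i / i.+1%:R] is (i + 1)^(i - 1), including i = 0. *)
Definition abel_poly n : {poly K} :=
  \sum_(i < n.+1) ('C(n, i)%:R * i.+1%:R ^+ i / i.+1%:R) *: ('X - i.+1%:R%:P) ^+ (n - i).

(** The derivative of the expansion of order n + 1 is n + 1 times that of order n, and its value at
    0 is, up to sign, a difference of order n + 1 of an n-th power. *)
Lemma abel_polyE n : abel_poly n = 'X^n.
Proof.
elim: n => [|n IHn].
  by rewrite /abel_poly big_ord1 bin0 expr0 mulr1 mulfV ?oner_eq0 // scale1r.
have dE : deriv (abel_poly n.+1) = deriv 'X^(n.+1).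
  rewrite derivXn /= -IHn /abel_poly raddf_sum big_ord_recr /= subnn expr0.
  rewrite -(polyC1) alg_polyC derivC addr0 -sumrMnl; apply: eq_bigr => i _ /=.
  have lein : (i <= n)%N by rewrite -ltnS.
  rewrite derivZ deriv_exp derivXsubC mul1r subSn //= -scalerMnr.
  rewrite -[LHS]scaler_nat -[RHS]scaler_nat !scalerA; congr (_ *: _).
  have /(congr1 (fun x => x%:R : K)) := mul_bin_down n.+1 i; rewrite !natrM /= => E.
  by rewrite subSn // in E; rewrite !mulrA -E.
apply/polyP => -[|i].
  rewrite -!horner_coef0 hornerXn expr0n /= /abel_poly horner_sum.
  transitivity ((-1) ^+ n.+1 * \sum_(i < n.+2)
      (-1) ^+ i * 'C(n.+1, i)%:R * (1 + i%:R) ^+ n : K); last first.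
    by rewrite finite_difference_eq0 ?mulr0.
  rewrite big_distrr /=; apply: eq_bigr => i _.
  have lein : (i <= n.+1)%N by rewrite -ltnS.
  rewrite hornerZ horner_exp hornerXsubC sub0r [(- i.+1%:R) ^+ _]exprNn nat1r.
  have -> : (-1) ^+ (n.+1 - i) = (-1) ^+ n.+1 * (-1) ^+ i :> K.
    rewrite -signr_odd oddB // signr_addb !signr_odd.
    by [].
  have i0 : i.+1%:R != 0 :> K by rewrite pnatr_eq0.
  have -> : (i.+1%:R : K) ^+ n = i.+1%:R ^+ i * i.+1%:R ^+ (n.+1 - i) / i.+1%:R.
    by rewrite -exprD subnKC // exprSr mulfK.
  ring.
have /polyP/(_ i) := dE; rewrite !coef_deriv => /eqP.
by rewrite eqr_pMn2r // => /eqP.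
Qed.

Lemma abel_identity n :
  \sum_(i < n) 'C(n, i)%:R * i.+1%:R ^+ i / i.+1%:R * (n - i)%:R ^+ (n - i) =
  n%:R * n.+1%:R ^+ n / n.+1%:R :> K.
Proof.
have := congr1 (horner^~ n.+1%:R) (abel_polyE n).
rewrite hornerXn /abel_poly horner_sum big_ord_recr /= subnn expr0.
rewrite hornerZ hornerC mulr1 binn mul1r => E.
have -> : n%:R * n.+1%:R ^+ n / n.+1%:R = n.+1%:R ^+ n - n.+1%:R ^+ n / n.+1%:R :> K.
  have -> : n%:R = n.+1%:R - 1 :> K by rewrite -natr1 addrK.
  have : n.+1%:R != 0 :> K by rewrite pnatr_eq0.
  by move: (n.+1%:R) => N N0; field.
rewrite -[X in _ = X - _]E addrK; apply: eq_bigr => i _.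
rewrite hornerZ horner_exp hornerXsubC -natrB ?subSS //.
by have := ltn_ord i; lia.
Qed.

Definition cayley_coef n : K := n%:R ^+ n / n%:R / n`!%:R.

(* [0 ^ 0 / 0 = 0] makes the constant term vanish. *)
Lemma cayley_coef_at0 : cayley_coef 0 = 0.
Proof. by rewrite /cayley_coef invr0 mulr0 mul0r. Qed.

(** By Abel's identity the numbers n^(n-1) / n! solve the system attached to C = z exp(C), whose
    solution is unique. *)
Lemma cayleyE (C : fps K) : C = fpsX K * fps_exp C -> C = Fps cayley_coef.
Proof.
move=> hC; pose S : fps K := Fps (fun n => cayley_coef n.+1).
have cS : Fps cayley_coef = fpsX K * S.
  by apply/fpsP => -[|n]; rewrite coef_fpsXM // /= cayley_coef_at0.
suff SE : S = fps_exp C by rewrite [LHS]hC -SE -cS.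
apply: (fps_treelike_uniq (@natr_reg_field K) (w := fpsX K)) => //.
- by rewrite fps_exp_coef0 /= /cayley_coef expr1 !divr1.
2: by rewrite -hC fps_theta_exp // (cayley_fps_coef0 hC).
rewrite -cS; apply/fpsP => n; rewrite coef_fpsM /=.
have f0 k : k`!%:R != 0 :> K by rewrite pnatr_eq0 -lt0n fact_gt0.
have s0 k : k.+1%:R != 0 :> K by rewrite pnatr_eq0.
apply: (mulfI (f0 n)).
rewrite big_ord_recr /= subnn mul0r mulr0 addr0 big_distrr /=.
transitivity (n%:R * n.+1%:R ^+ n / n.+1%:R : K).
  rewrite /cayley_coef exprSr mulfK // factS natrM.
  by field; rewrite ?nat1r ?s0 ?f0.
rewrite -abel_identity; apply: eq_bigr => i _.
have ltin := ltn_ord i.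
have -> : n`!%:R = 'C(n, i)%:R * i`!%:R * (n - i)`!%:R :> K.
  by rewrite -!natrM -mulnA bin_fact // ltnW.
have ni0 : (n - i)%:R != 0 :> K by rewrite pnatr_eq0 subn_eq0 -ltnNge.
rewrite /cayley_coef exprSr mulfK // factS natrM.
by field; rewrite ?nat1r ?s0 ?f0 ?ni0.
Qed.

End Abel.

(** * The radius of convergence *)

Section Evaluation.
Variable R : realType.
Implicit Types (x y : R) (F G a : fps R) (N : nat).

Definition ev F x N : R := wsum (fun n => x ^+ n) F N.

Lemma ev_ge0 F x N : 0 <= x -> fps_ge0 F -> 0 <= ev F x N.
Proof. by move=> x0 F0; apply: wsum_ge0 => // n; rewrite exprn_ge0. Qed.

Lemma ev_mono F x N N' : 0 <= x -> fps_ge0 F -> (N <= N')%N -> ev F x N <= ev F x N'.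
Proof. by move=> x0 F0 le; apply: wsum_mono => // n; rewrite exprn_ge0. Qed.

Lemma ev_le F x y N : fps_ge0 F -> 0 <= x -> x <= y -> ev F x N <= ev F y N.
Proof.
move=> F0 x0 xy; apply: ler_sum => n _; rewrite ler_wpM2r // lerXn2r ?nnegrE //.
exact: le_trans x0 xy.
Qed.

Lemma evM_le F G x N : 0 <= x -> fps_ge0 F -> fps_ge0 G ->
  ev (F * G) x N <= ev F x N * ev G x N.
Proof.
move=> x0 F0 G0; apply: wsumM_le => // [n|i j]; first by rewrite exprn_ge0.
by rewrite exprD.
Qed.

Lemma evM_ge F G x N N' : 0 <= x -> fps_ge0 F -> fps_ge0 G ->
  ev F x N * ev G x N' <= ev (F * G) x (N + N').
Proof.
move=> x0 F0 G0; apply: wsumM_ge => // [n|i j]; first by rewrite exprn_ge0.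
by rewrite exprD.
Qed.

Lemma ev1 x N : ev 1 x N = (0 < N)%:R.
Proof.
rewrite /ev /wsum; case: N => [|N]; first by rewrite big_ord0.
rewrite big_ord_recl expr0 mul1r coef_fps1 big1 ?addr0 // => i _.
by rewrite coef_fps1 mulr0.
Qed.

Lemma evX_le F x N k : 0 <= x -> fps_ge0 F -> ev (F ^+ k) x N <= ev F x N ^+ k.
Proof.
move=> x0 F0; elim: k => [|k IHk]; first by rewrite !expr0 ev1; case: N => [|N] //=; rewrite ler01.
rewrite !exprS (le_trans (evM_le _ _ _ _)) // ?ler_wpM2l ?ev_ge0 //.
exact: fps_ge0X.
Qed.

Lemma evX_ge F x N k : 0 <= x -> fps_ge0 F -> ev F x N ^+ k <= ev (F ^+ k) x (k * N).+1.
Proof.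
move=> x0 F0; elim: k => [|k IHk]; first by rewrite !expr0 ev1.
rewrite !exprS (le_trans (ler_wpM2l _ IHk)) ?ev_ge0 //.
rewrite mulSn -addnS; apply: evM_ge => //; exact: fps_ge0X.
Qed.

Lemma evXM F x N : ev (fpsX R * F) x N.+1 = x * ev F x N.
Proof.
rewrite /ev /wsum big_ord_recl coef_fpsXM mulr0 add0r big_distrr.
by apply: eq_bigr => i _; rewrite coef_fpsXM /= exprS mulrA.
Qed.

Lemma ev_comp_le a F x N : 0 <= x -> fps_ge0 a -> fps_ge0 F -> F 0%N = 0 ->
  ev (fps_comp a F) x N <= \sum_(k < N) a k * ev F x N ^+ k.
Proof.
move=> x0 a0 F0 F00; case: N => [|N]; first by rewrite /ev /wsum !big_ord0.
apply: (@le_trans _ _ (\sum_(k < N.+1) a k * ev (F ^+ k) x N.+1)); last first.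
  by apply: ler_sum => k _; rewrite ler_wpM2l // evX_le.
rewrite /ev /wsum.
under [leRHS]eq_bigr do rewrite big_distrr /=.
rewrite exchange_big; apply: ler_sum => n _ /=.
have leN : (n <= N)%N by rewrite -ltnS.
rewrite (@coef_fps_comp_bound _ _ _ _ N) // big_distrr /=.
by apply: ler_sum => k _; rewrite mulrCA.
Qed.

Lemma ev_comp_ge a F x N K : 0 <= x -> fps_ge0 a -> fps_ge0 F -> F 0%N = 0 ->
  exists N', \sum_(k < K) a k * ev F x N ^+ k <= ev (fps_comp a F) x N'.
Proof.
move=> x0 a0 F0 F00; pose N' := (K * N).+1; exists N'.
apply: (@le_trans _ _ (\sum_(k < K) a k * ev (F ^+ k) x N')).
  apply: ler_sum => k _; rewrite ler_wpM2l // (le_trans (evX_ge _ _ _ _)) //.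
  apply: ev_mono => //; first exact: fps_ge0X.
  by rewrite ltnS leq_mul2r ltnW // orbT.
rewrite /ev /wsum.
under eq_bigr do rewrite big_distrr /=.
rewrite exchange_big; apply: ler_sum => n _ /=.
rewrite (@coef_fps_comp_bound _ _ _ _ (n + K)) ?leq_addr // big_distrr /=.
rewrite (big_ord_widen (n + K).+1 (fun k => a k * (x ^+ n * (F ^+ k) n))); last by lia.
rewrite big_mkcond; apply: ler_sum => k _.
have ge0 : 0 <= x ^+ n * (a k * (F ^+ k) n).
  by rewrite !mulr_ge0 // ?exprn_ge0 //; exact: fps_ge0X.
by case: ifP => _ //; rewrite mulrCA.
Qed.

Lemma exp_partial_le y N : 0 <= y -> \sum_(k < N) k`!%:R^-1 * y ^+ k <= expR y.
Proof.
move=> y0; rewrite -(big_mkord predT (fun k => k`!%:R^-1 * y ^+ k)).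
have -> : \sum_(0 <= k < N) k`!%:R^-1 * y ^+ k = series (exp_coeff y) N.
  by apply: eq_bigr => k _; rewrite mulrC.
apply: nondecreasing_cvgn_le; last exact: is_cvg_series_exp_coeff.
apply: nondecreasing_series => n _ _.
by rewrite /exp_coeff /= divr_ge0 // exprn_ge0.
Qed.

Lemma fps_ge0_exp F : fps_ge0 F -> fps_ge0 (fps_exp F).
Proof. by apply: fps_ge0_comp => n /=; rewrite invr_ge0. Qed.

Lemma ev_exp_le F x N : 0 <= x -> fps_ge0 F -> F 0%N = 0 ->
  ev (fps_exp F) x N <= expR (ev F x N).
Proof.
move=> x0 F0 F00; apply: le_trans (ev_comp_le _ _ _ _ _) _ => //.
  by move=> n /=; rewrite invr_ge0.
by apply: exp_partial_le; exact: ev_ge0.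
Qed.

Lemma bernoulli x n : 0 <= x -> 1 + n%:R * x <= (1 + x) ^+ n.
Proof.
move=> x0; elim: n => [|n IHn]; first by rewrite mul0r addr0 expr0.
rewrite exprS; apply: le_trans (ler_wpM2l _ IHn); last by rewrite addr_ge0.
rewrite -natr1 -subr_ge0.
have -> : (1 + x) * (1 + n%:R * x) - (1 + (n%:R + 1) * x) = n%:R * x ^+ 2 by ring.
by rewrite mulr_ge0 // sqr_ge0.
Qed.

Lemma bernoulli_sub x n : 0 <= x -> x <= 1 -> 1 - n%:R * x <= (1 - x) ^+ n.
Proof.
move=> x0 x1; elim: n => [|n IHn]; first by rewrite mul0r subr0 expr0.
rewrite exprS; apply: le_trans (ler_wpM2l _ IHn); last by rewrite subr_ge0.
rewrite -natr1 -subr_ge0.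
have -> : (1 - x) * (1 - n%:R * x) - (1 - (n%:R + 1) * x) = n%:R * x ^+ 2 by ring.
by rewrite mulr_ge0 // sqr_ge0.
Qed.

Definition renewal_weight n : R := n%:R ^+ n * expR (- n%:R) / n`!%:R.

Lemma renewal_weight_gt0 n : (0 < n)%N -> 0 < renewal_weight n.
Proof.
move=> n0; rewrite /renewal_weight divr_gt0 ?ltr0n ?fact_gt0 //.
by rewrite mulr_gt0 ?expR_gt0 // exprn_gt0 // ltr0n.
Qed.

(** Amounts to (1 + 1/n)^n <= e, from 1 + t <= exp(t) at t = 1/n. *)
Lemma renewal_weight_noninc n : (0 < n)%N -> renewal_weight n.+1 <= renewal_weight n.
Proof.
move=> n0; rewrite /renewal_weight exprS factS natrM.
have s0 : n.+1%:R != 0 :> R by rewrite pnatr_eq0.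
have f0 : n`!%:R != 0 :> R by rewrite pnatr_eq0 -lt0n fact_gt0.
have -> : n.+1%:R * n.+1%:R ^+ n * expR (- n.+1%:R) / (n.+1%:R * n`!%:R) =
  n.+1%:R ^+ n * expR (- n.+1%:R) / n`!%:R :> R by field; rewrite f0 nat1r.
rewrite ler_wpM2r ?invr_ge0 // -[X in expR (- X)]natr1 opprD expRD.
rewrite [leLHS]mulrCA [leRHS]mulrC ler_wpM2l ?expR_ge0 // expRN ler_pdivrMr ?expR_gt0 //.
have nR : 0 < n%:R :> R by rewrite ltr0n.
have := expR_ge1Dx (n%:R^-1 : R) => h.
have -> : expR 1 = expR (n%:R^-1 : R) ^+ n by rewrite -expRM_natl mulfV ?gt_eqF.
rewrite -exprMn lerXn2r ?nnegrE ?mulr_ge0 ?expR_ge0 //.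
apply: le_trans (ler_wpM2l (ltW nR) h).
by rewrite mulrDr mulr1 mulfV ?gt_eqF // natr1.
Qed.

(** Amounts to e n^(n+1) <= (n + 1)^(n+1), from 1 + t <= exp(t) at t = -1/(n + 1). *)
Lemma renewal_weight_nondec n : (0 < n)%N ->
  n%:R * renewal_weight n <= n.+1%:R * renewal_weight n.+1.
Proof.
move=> n0; rewrite /renewal_weight factS natrM.
have s0 : n.+1%:R != 0 :> R by rewrite pnatr_eq0.
have f0 : n`!%:R != 0 :> R by rewrite pnatr_eq0 -lt0n fact_gt0.
have -> : n.+1%:R * (n.+1%:R ^+ n.+1 * expR (- n.+1%:R) / (n.+1%:R * n`!%:R)) =
  n.+1%:R ^+ n.+1 * expR (- n.+1%:R) / n`!%:R :> R by field; rewrite f0 nat1r.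
rewrite !mulrA -exprS ler_wpM2r ?invr_ge0 //.
rewrite -[X in _ <= _ * expR (- X)]natr1 opprD expRD [leRHS]mulrA [leRHS]mulrAC.
rewrite ler_wpM2r ?expR_ge0 //.
rewrite expRN ler_pdivlMr ?expR_gt0 //.
have nR : 0 < n.+1%:R :> R by rewrite ltr0n.
have := expR_ge1Dx (- n.+1%:R^-1 : R) => h.
have -> : expR 1 = expR (n.+1%:R^-1 : R) ^+ n.+1 by rewrite -expRM_natl mulfV ?gt_eqF.
rewrite -exprMn lerXn2r ?nnegrE ?mulr_ge0 ?expR_ge0 //.
rewrite -ler_pdivlMr ?expR_gt0 // -expRN.
apply: le_trans (ler_wpM2l (ltW nR) h).
by rewrite mulrDr mulr1 mulrN mulfV ?gt_eqF // -natr1 addrK.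
Qed.

Lemma renewal_weightE n : (0 < n)%N ->
  n%:R * cayley_coef R n = renewal_weight n * expR n%:R.
Proof.
move=> n0; have nR : n%:R != 0 :> R by rewrite pnatr_eq0 -lt0n.
have f0 : n`!%:R != 0 :> R by rewrite pnatr_eq0 -lt0n fact_gt0.
rewrite /cayley_coef /renewal_weight expRN; field.
by rewrite f0 nR gt_eqF ?expR_gt0.
Qed.

End Evaluation.

Section Radius.
Variable R : realType.
Implicit Types (x y : R) (N n : nat).
Local Notation T := (polya_gf R).
Local Notation D := (D_gf R).
Local Notation L := (log_D_gf R).
Local Notation C := (Fps (cayley_coef R)).
Local Notation Einv := (expR (-1) : R).

Lemma cayley_eq : C = fpsX R * fps_exp C.
Proof. by have [C' [hC' _]] := cayley_existsU R; rewrite -(cayleyE hC'). Qed.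

Lemma map_horner_sized m :
  map_fps (horner_eval 1) (egf (sized_moved_forest R m)) = D.
Proof.
apply/fpsP => n; rewrite -[LHS]/((egf (sized_moved_forest R m) n).[1]).
rewrite egf_sized_moved_forest egf_moved_forest hornerM hornerXn expr1n mul1r.
exact: hornerC.
Qed.

Lemma polya_gf_comp : T = fps_comp C (fpsX R * D).
Proof.
have -> : T = map_fps (horner_eval 1) (marked_gf R 0).
  by apply/fpsP => n; rewrite -(marked_gf_horner1 R 0).
rewrite (marked_gf_comp 0 cayley_eq) map_fps_comp map_fpsM map_fpsX map_horner_sized.
congr (fps_comp _ _); apply/fpsP => n /=; exact: hornerC.
Qed.

Lemma polya_gf_ge0 : fps_ge0 T. Proof. by move=> n /=. Qed.

Lemma cayley_ge0 : fps_ge0 C.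
Proof. by move=> n /=; rewrite /cayley_coef !divr_ge0 // exprn_ge0. Qed.

Lemma log_D_gf_ge0 : fps_ge0 L.
Proof.
move=> n; apply: sumr_ge0 => i _; rewrite divr_ge0 //.
by rewrite fps_dilateE; case: ifP => // _; exact: polya_gf_ge0.
Qed.

Lemma D_gf_ge0 : fps_ge0 D.
Proof. exact: fps_ge0_exp log_D_gf_ge0. Qed.

Lemma XD_ge0 : fps_ge0 (fpsX R * D).
Proof. by apply: fps_ge0M D_gf_ge0 => n /=. Qed.

Lemma XD0 : (fpsX R * D) 0%N = 0. Proof. by rewrite coef_fpsXM. Qed.

Lemma D_gf_coef0 : D 0%N = 1. Proof. exact: fps_exp_coef0. Qed.

(** By C = z exp(C), a partial sum at most 1 forces the next one to be at most x e <= 1. *)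
Lemma ev_cayley_le1 x N : 0 <= x -> x <= Einv -> ev C x N <= 1.
Proof.
move=> x0 xe; elim: N => [|N IHN]; first by rewrite /ev /wsum big_ord0 ler01.
rewrite cayley_eq evXM.
apply: (@le_trans _ _ (Einv * expR 1)); last by rewrite -expRD addNr expR0.
apply: ler_pM => //.
  by apply: ev_ge0 => //; exact: fps_ge0_exp cayley_ge0.
apply: le_trans (ev_exp_le _ _ _ _) _ => //; first exact: cayley_ge0.
  exact: cayley_coef_at0.
by rewrite ler_expR.
Qed.

Lemma ev_polya_le1 x N : 0 <= x -> x * ev D x N <= Einv -> ev T x N.+1 <= 1.
Proof.
move=> x0 xD; rewrite polya_gf_comp.
apply: le_trans (ev_comp_le _ x0 cayley_ge0 XD_ge0 XD0) _.
rewrite evXM; apply: le_trans (ev_cayley_le1 N.+1 _ xD).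
  by apply: ler_sum => k _; rewrite mulrC.
by rewrite mulr_ge0 // ev_ge0 // ; exact: D_gf_ge0.
Qed.

(* The series [C(w)] diverges for [w > 1/e]: its terms are at least
   [b_1 (e w)^k / k^2]. *)
Lemma cayley_bounded_le x t : 0 <= x ->
  (forall N, ev C x N <= t) -> x <= Einv.
Proof.
move=> x0 H; rewrite leNgt; apply/negP => ex.
pose q := x * expR 1.
have q1 : 1 < q by rewrite /q -ltr_pdivrMr ?expR_gt0 // div1r -expRN.
(* For h <= 1, (1 + h)^3 <= 1 + 7 h <= q, so q^k >= (k h)^3 by Bernoulli: cubic growth beats the k^2
   in the denominator and leaves b_1 h^3 k, which is unbounded. *)
pose h := Num.min 1 ((q - 1) / 7).
have h0 : 0 < h by rewrite lt_min ltr01 divr_gt0 // subr_gt0.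
have h1 : h <= 1 by rewrite ge_min lexx.
have hq : 7 * h <= q - 1.
  by rewrite mulrC -ler_pdivlMr // ge_min lexx orbT.
have hc : (1 + h) ^+ 3 <= q.
  have h2 : h ^+ 2 <= h by rewrite expr2 ler_piMl // ltW.
  have h3 : h ^+ 3 <= h.
    by rewrite exprS (le_trans (ler_wpM2l (ltW h0) h2)) // ler_piMl // ltW.
  have -> : (1 + h) ^+ 3 = 1 + 3 * h + 3 * h ^+ 2 + h ^+ 3 by ring.
  lra.
have b1 : 0 < renewal_weight R 1 by exact: renewal_weight_gt0.
have bk k : (0 < k)%N -> renewal_weight R 1 <= k%:R * renewal_weight R k.
  elim: k => // -[|k] IHk _; first by rewrite mul1r.
  by apply: le_trans (IHk _) _ => //; exact: renewal_weight_nondec.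
have term k : (0 < k)%N -> renewal_weight R 1 * h ^+ 3 * k%:R <= t.
  move=> k0; have kR : 0 < k%:R :> R by rewrite ltr0n.
  apply: le_trans (H k.+1).
  rewrite /ev /wsum big_ord_recr /=; apply: ler_wpDl.
    by apply: sumr_ge0 => i _; rewrite mulr_ge0 ?exprn_ge0 //; exact: cayley_ge0.
  have -> : x ^+ k * cayley_coef R k = renewal_weight R k * q ^+ k / k%:R.
    have := renewal_weightE R k0; rewrite /q exprMn -expRM_natl mulr1 => E.
    apply: (mulfI (lt0r_neq0 kR)); rewrite mulrCA E; field.
    by rewrite gt_eqF.
  rewrite ler_pdivlMr //.
  apply: (@le_trans _ _ (renewal_weight R k * ((1 + h) ^+ k) ^+ 3)); last first.
    rewrite ler_wpM2l ?(ltW (renewal_weight_gt0 _ _)) // -exprM mulnC exprM.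
    by rewrite lerXn2r ?nnegrE ?exprn_ge0 ?addr_ge0 ?(ltW h0) // (le_trans ler01) // ltW.
  apply: (@le_trans _ _ (renewal_weight R k * (k%:R * h) ^+ 3)); last first.
    rewrite ler_wpM2l ?(ltW (renewal_weight_gt0 _ _)) //.
    have hh : k%:R * h <= (1 + h) ^+ k.
      by apply: le_trans (bernoulli k (ltW h0)); rewrite lerDr.
    rewrite lerXn2r ?nnegrE ?exprn_ge0 ?addr_ge0 ?mulr_ge0 ?(ltW h0) //.
  have -> : renewal_weight R 1 * h ^+ 3 * k%:R * k%:R =
    h ^+ 3 * k%:R ^+ 2 * renewal_weight R 1 by ring.
  have -> : renewal_weight R k * (k%:R * h) ^+ 3 =
    h ^+ 3 * k%:R ^+ 2 * (k%:R * renewal_weight R k) by ring.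
  by rewrite ler_wpM2l ?bk // mulr_ge0 ?exprn_ge0 // ltW.
pose c := renewal_weight R 1 * h ^+ 3.
have c0 : 0 < c by rewrite mulr_gt0 // exprn_gt0.
have t0 : 0 <= t / c.
  by rewrite divr_ge0 ?(ltW c0) // (le_trans _ (H 0%N)) // /ev /wsum big_ord0.
have := archi_boundP t0; set k := Num.Def.archi_bound _ => kt.
have k0 : (0 < k)%N by rewrite -(ltr0n R) (le_lt_trans t0).
have := term _ k0; rewrite -/c leNgt => /negP; apply.
by rewrite mulrC -ltr_pdivrMr.
Qed.

Lemma polya_bounded_le x t N : 0 <= x -> (forall N', ev T x N' <= t) ->
  x * ev D x N <= Einv.
Proof.
move=> x0 H; rewrite -evXM; apply: (@cayley_bounded_le _ t).
  by rewrite ev_ge0 //; exact: XD_ge0.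
move=> K; have [N' HN'] := ev_comp_ge N.+1 K x0 cayley_ge0 XD_ge0 XD0.
rewrite -polya_gf_comp in HN'; apply: le_trans (H N').
by apply: le_trans HN'; apply: ler_sum => k _; rewrite mulrC.
Qed.

Lemma pseries_ev (F : fps R) x N : pseries F x N = ev F x N.
Proof. by rewrite /pseries /series /= big_mkord; apply: eq_bigr => i _; rewrite mulrC. Qed.

Lemma pseries_nondecreasing (F : fps R) x : 0 <= x -> fps_ge0 F ->
  {homo pseries F x : n m / (n <= m)%N >-> n <= m}.
Proof. by move=> x0 F0 n m le; rewrite !pseries_ev ev_mono. Qed.

(** T = C(z D), and 1/e is the radius of C, where C still converges. The radius of T thus becomes a
    condition on the partial sums of D. *)
Lemma cvgn_polyaP x : 0 <= x ->
  cvgn (pseries T x) <-> forall N, x * ev D x N <= Einv.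
Proof.
move=> x0; have nd := pseries_nondecreasing x0 polya_gf_ge0.
split=> [cT N|H].
  apply: (@polya_bounded_le _ (limn (pseries T x))) => // N'.
  by rewrite -pseries_ev; exact: nondecreasing_cvgn_le.
apply: nondecreasing_is_cvgn => //; exists 1 => _ [N _ <-]; rewrite pseries_ev.
apply: le_trans (ev_polya_le1 x0 (H N)).
by apply: ev_mono => //; exact: polya_gf_ge0.
Qed.

Lemma Einv_lt_half : Einv < 2^-1.
Proof.
rewrite expRN ltf_pV2 ?posrE ?expR_gt0 //.
by rewrite -[ltLHS]/(1 + 1) expR_gt1Dx // oner_neq0.
Qed.

Definition polya_disc : set R := [set r : R | 0 <= r /\ cvgn (pseries T r)]%classic.

Lemma polya_disc_le x : polya_disc x -> x <= Einv.
Proof.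
move=> [x0 /(cvgn_polyaP x0)/(_ 1%N)].
by rewrite /ev /wsum big_ord1 expr0 mul1r D_gf_coef0 mulr1.
Qed.

Lemma polya_disc_downward x y : polya_disc y -> 0 <= x -> x <= y -> polya_disc x.
Proof.
move=> [y0 /(cvgn_polyaP y0) H] x0 xy; split=> //; apply/(cvgn_polyaP x0) => N.
apply: le_trans (H N); apply: ler_pM => //; first exact: ev_ge0 D_gf_ge0.
exact: ev_le D_gf_ge0 _ _.
Qed.

End Radius.

Section DilatedSums.
Variable R : realType.
Implicit Types (x y : R) (F : fps R) (u : nat -> R) (N n : nat).

Definition dilated_sum u F : fps R :=
  Fps (fun n => \sum_(2 <= i < n.+1) u i * fps_dilate i F n).

Lemma sum_dilate_le x F i N : 0 <= x -> fps_ge0 F -> (0 < i)%N ->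
  \sum_(n < N) x ^+ n * fps_dilate i F n <= ev F (x ^+ i) N.
Proof.
move=> x0 F0 i0; pose g a := x ^+ (i * a) * F a.
have g0 a : 0 <= g a by rewrite mulr_ge0 ?exprn_ge0.
apply: (@le_trans _ _ (\sum_(n < N) \sum_(a < N) (n == i * a :> nat)%N%:R * g a)).
  apply: ler_sum => n _; rewrite fps_dilateE; case: ifP => [/dvdnP[a nE]|_]; last first.
    by rewrite mulr0 sumr_ge0 // => a _; rewrite mulr_ge0.
  have ltaN : (a < N)%N by rewrite (leq_ltn_trans _ (ltn_ord n)) // nE leq_pmulr.
  rewrite (bigD1 (Ordinal ltaN)) //= nE mulnK // mulnC eqxx mul1r ler_wpDr //.
  by apply: sumr_ge0 => b _; rewrite mulr_ge0.
rewrite exchange_big; apply: ler_sum => a _; rewrite -big_distrl /= -exprM.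
rewrite ler_piMl // -natr_sum lern1.
have [ltN|geN] := ltnP (i * a) N.
  by rewrite (bigD1 (Ordinal ltN)) //= eqxx big1 // => n; rewrite -val_eqE /= => /negPf->.
by rewrite big1 // => n _; case: eqP => // E; have := ltn_ord n; rewrite E ltnNge geN.
Qed.

Lemma ev_dilated_sum_le u F x N : (forall i, 0 <= u i) -> 0 <= x -> fps_ge0 F ->
  ev (dilated_sum u F) x N <= \sum_(2 <= i < N) u i * ev F (x ^+ i) N.
Proof.
move=> u0 x0 F0.
have term0 i n : 0 <= u i * (x ^+ n * fps_dilate i F n).
  rewrite mulr_ge0 // mulr_ge0 ?exprn_ge0 //.
  by rewrite fps_dilateE; case: ifP.
apply: (@le_trans _ _ (\sum_(n < N) \sum_(2 <= i < N) u i * (x ^+ n * fps_dilate i F n))).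
  apply: ler_sum => n _; rewrite big_distrr /=.
  have [le2|lt2] := leqP 2 n.+1; last first.
    rewrite [leLHS]big_geq; last exact: ltnW.
    by apply: sumr_ge0 => i _; exact: term0.
  rewrite [leRHS](big_cat_nat (n := n.+1)) //= ler_wpDr //.
    by apply: sumr_ge0 => i _; exact: term0.
  by apply: ler_sum => i _; rewrite mulrCA.
rewrite exchange_big big_nat_cond [leRHS]big_nat_cond.
apply: ler_sum => i /andP[/andP[i2 _] _]; rewrite -big_distrr /= ler_wpM2l //.
by apply: sum_dilate_le => //; exact: ltnW.
Qed.

Lemma ev_scale_le F x y N : fps_ge0 F -> F 0%N = 0 -> 0 <= x -> 0 <= y -> y <= 1 ->
  ev F (y * x) N <= y * ev F x N.
Proof.
move=> F0 F00 x0 y0 y1; rewrite /ev /wsum big_distrr /=; apply: ler_sum => -[[|n] ltn] _ /=.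
  by rewrite F00 !mulr0.
rewrite mulrA ler_wpM2r // exprMn ler_wpM2r ?exprn_ge0 //.
by rewrite exprS ler_piMr // exprn_ile1.
Qed.

Lemma geometric_le x N : 0 <= x -> x < 1 -> \sum_(2 <= i < N) x ^+ (i - 2) <= (1 - x)^-1.
Proof.
move=> x0 x1; rewrite -[2%N]add0n big_addn big_mkord.
under eq_bigr do rewrite addnK.
have x1' : 0 < 1 - x by rewrite subr_gt0.
rewrite -div1r ler_pdivlMr // mulrC -opprB mulNr -subrX1 opprB.
by rewrite gerBl exprn_ge0.
Qed.

End DilatedSums.

Section RadiusValue.
Variable R : realType.
Implicit Types (x y : R) (N n : nat).
Local Notation T := (polya_gf R).
Local Notation D := (D_gf R).
Local Notation L := (log_D_gf R).
Local Notation Einv := (expR (-1) : R).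
Local Notation rho := (polya_radius R).

Lemma log_D_gfE : L = dilated_sum (fun i => i%:R^-1) T.
Proof. by apply/fpsP => n; apply: eq_bigr => i _; rewrite mulrC. Qed.

(** Since x^i <= x^(i-2) y and T has no constant term, T(x^i) <= x^(i-2) T(y): a geometric series
    bounds the sum over i. *)
Lemma ev_log_D_le x y N : 0 <= x -> x < 1 -> 0 <= y -> x ^+ 2 <= y -> ev T y N <= 1 ->
  ev L x N <= (1 - x)^-1.
Proof.
move=> x0 x1 y0 xy Ty; rewrite log_D_gfE.
apply: le_trans (ev_dilated_sum_le N _ x0 (@polya_gf_ge0 R)) _ => [i|].
  by rewrite invr_ge0.
apply: le_trans (geometric_le N x0 x1).
rewrite big_nat_cond [leRHS]big_nat_cond; apply: ler_sum => i /andP[/andP[i2 _] _].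
have xi0 : 0 <= x ^+ (i - 2) by rewrite exprn_ge0.
have xi1 : x ^+ (i - 2) <= 1 by rewrite exprn_ile1 // ltW.
apply: (@le_trans _ _ (ev T (x ^+ i) N)).
  rewrite ler_piMl ?invf_le1 ?ltr0n ?ler1n ?(ltnW i2) //.
  by apply: ev_ge0; [rewrite exprn_ge0|exact: polya_gf_ge0].
apply: (@le_trans _ _ (ev T (x ^+ (i - 2) * y) N)).
  apply: ev_le; [exact: polya_gf_ge0|by rewrite exprn_ge0|].
  by rewrite -{1}(subnK i2) exprD ler_wpM2l.
apply: le_trans (ev_scale_le N (@polya_gf_ge0 R) (polya_gf0 R) y0 xi0 xi1) _.
by rewrite ler_piMr.
Qed.

Lemma ev_D_le x y N : 0 <= x -> x < 1 -> 0 <= y -> x ^+ 2 <= y -> ev T y N <= 1 ->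
  ev D x N <= expR ((1 - x)^-1).
Proof.
move=> x0 x1 y0 xy Ty; apply: le_trans (ev_exp_le N x0 (@log_D_gf_ge0 R) (log_D_gf0 R)) _.
by rewrite ler_expR (ev_log_D_le x0 x1 y0 xy Ty).
Qed.

(** Makes the radius positive. At 1/64, T_N <= 1 gives D_N <= exp(64/63) <= e^2, and e^2 / 64 <= 1/e
    because e <= 4; this in turn gives T_(N+1) <= 1. *)
Lemma polya_disc_64 : polya_disc (64^-1 : R).
Proof.
have x0 : 0 <= 64^-1 :> R by rewrite invr_ge0.
have e4 : expR 1 <= 4 :> R.
  have h : 2^-1 <= expR (- 2^-1) :> R.
    by apply: le_trans (expR_ge1Dx _); lra.
  have h2 : expR (2^-1) <= 2 :> R by move: h; rewrite expRN lef_pV2 ?posrE ?expR_gt0.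
  have -> : 1 = 2^-1 + 2^-1 :> R by field.
  rewrite expRD; apply: (@le_trans _ _ (2 * 2)); last by lra.
  by apply: ler_pM => //; exact: expR_ge0.
have step N : ev T 64^-1 N <= 1 -> 64^-1 * ev D 64^-1 N <= Einv.
  move=> TN; rewrite expRN.
  apply: (@le_trans _ _ (64^-1 * expR 2)).
    rewrite ler_wpM2l //.
    apply: le_trans (ev_D_le _ _ _ _ TN) _ => //; [lra|lra|].
    have -> : (1 - 64^-1)^-1 = 64 / 63 :> R by field.
    by rewrite ler_expR; lra.
  rewrite mulrC ler_pdivrMr //.
  rewrite -[2]/(1 + 1) expRD -[leLHS]mulr1.
  have e0 := expR_gt0 (1 : R).
  rewrite -(ler_pM2r e0) mulr1 [leRHS]mulrAC mulVf ?gt_eqF // mul1r.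
  apply: (@le_trans _ _ (4 * 4 * 4)); last by lra.
  by do 2?[apply: ler_pM => //]; rewrite ?mulr_ge0 ?expR_ge0.
have T1 N : ev T 64^-1 N <= 1.
  elim: N => [|N IHN]; first by rewrite /ev /wsum big_ord0.
  exact: ev_polya_le1 (step _ IHN).
by split=> //; apply/(cvgn_polyaP x0) => N; exact: step.
Qed.

Lemma has_sup_polya_disc : has_sup (@polya_disc R).
Proof.
split; first by exists 64^-1; exact: polya_disc_64.
by exists Einv => x; exact: polya_disc_le.
Qed.

Lemma rho_gt0 : 0 < rho.
Proof.
apply: lt_le_trans (ub_le_sup (has_sup_polya_disc).2 polya_disc_64).
by rewrite invr_gt0.
Qed.

Lemma rho_le : rho <= Einv.
Proof.
apply: ge_sup; first exact: (has_sup_polya_disc).1.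
by move=> x; exact: polya_disc_le.
Qed.

Lemma rho_lt_half : rho < 2^-1.
Proof. exact: le_lt_trans rho_le (Einv_lt_half R). Qed.

Lemma lt_rho_disc x : 0 <= x -> x < rho -> polya_disc x.
Proof.
move=> x0 xr; have rx : 0 < rho - x by rewrite subr_gt0.
have [y Ay yr] := sup_adherent rx has_sup_polya_disc.
by apply: (polya_disc_downward Ay x0); rewrite ltW // (le_lt_trans _ yr) // opprB addrC subrK.
Qed.

(** The bound holds at (1 - d) rho, where by Bernoulli the left side is at least 1 - N d times its
    value at [rho]; d is taken arbitrarily small. *)
Lemma rho_D_le N : rho * ev D rho N <= Einv.
Proof.
have r0 := rho_gt0; have y0 := mulr_ge0 (ltW r0) (ev_ge0 N (ltW r0) (@D_gf_ge0 R)).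
set y := rho * ev D rho N in y0 *.
apply/ler_addgt0Pr => e e0; pose d := Num.min 2^-1 (e / (N%:R * y + 1)).
have c0 : 0 < N%:R * y + 1 by rewrite ltr_wpDl // mulr_ge0.
have d0 : 0 < d by rewrite lt_min invr_gt0 ltr0n /= divr_gt0.
have d1 : d <= 2^-1 by rewrite ge_min lexx.
have d1' : d <= 1 by lra.
have de : N%:R * y * d <= e.
  apply: (@le_trans _ _ ((N%:R * y + 1) * d)); first by rewrite ler_wpM2r ?lerDl // ltW.
  by rewrite mulrC -ler_pdivlMr // ge_min lexx orbT.
have xD : polya_disc ((1 - d) * rho).
  apply: lt_rho_disc; first by rewrite mulr_ge0 ?subr_ge0 // ltW.
  by rewrite gtr_pMl // gtrBl.
have [x0 /(cvgn_polyaP x0)/(_ N)] := xD; rewrite -lerBlDr => H.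
apply: le_trans H; apply: (@le_trans _ _ ((1 - N%:R * d) * y)).
  rewrite mulrBl mul1r lerD2l lerN2.
  by rewrite mulrAC.
rewrite /y /ev /wsum mulrA big_distrr [leRHS]big_distrr /=.
apply: ler_sum => n _; rewrite !mulrA ler_wpM2r ?D_gf_ge0 //.
rewrite -[leRHS]exprS exprMn -[leLHS]mulrA -[X in _ * X <= _]exprS ler_wpM2r ?exprn_ge0 ?(ltW r0) //.
apply: le_trans (bernoulli_sub n.+1 (ltW d0) d1').
by rewrite lerD2l lerN2 ler_wpM2r ?ler_nat ?(ltW d0).
Qed.

Lemma rho_T_le N : ev T rho N <= 1.
Proof.
apply: le_trans (ev_polya_le1 (ltW rho_gt0) (rho_D_le N)).
by apply: ev_mono => //; exact: ltW rho_gt0.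
Qed.

(** A point beyond [rho] where D is bounded: (11/10)^6 < 2 and rho < 1/2 give [rho1 ^+ 2 <= rho].
    The cube serves the third moment, as (j + 1)^3 <= 10^3 (11/10)^(3 j) by Bernoulli. *)
Definition rho1 : R := rho * (11 / 10) ^+ 3.

Lemma rho1_lt1 : rho1 < 1.
Proof. by have := rho_lt_half; rewrite /rho1 !exprS expr0; lra. Qed.

Lemma rho_lt_rho1 : rho < rho1.
Proof. by have := rho_gt0; rewrite /rho1 !exprS expr0; lra. Qed.

Lemma rho1_sq : rho1 ^+ 2 <= rho.
Proof.
rewrite /rho1 exprMn -exprM expr2 -mulrA ler_piMr ?(ltW rho_gt0) //.
have := rho_lt_half; rewrite !exprS expr0; lra.
Qed.

Lemma ev_D_rho1 N : ev D rho1 N <= expR ((1 - rho1)^-1).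
Proof.
have r0 := rho_gt0; apply: (ev_D_le _ rho1_lt1 (ltW r0) rho1_sq (rho_T_le N)).
exact: ltW (lt_trans r0 rho_lt_rho1).
Qed.

Lemma convex_exp (a b l : R) n : 0 <= a -> a <= b -> 0 <= l -> l <= 1 ->
  ((1 - l) * a + l * b) ^+ n <= (1 - l) * a ^+ n + l * b ^+ n.
Proof.
move=> a0 ab l0 l1; elim: n => [|n IHn]; first by rewrite !expr0 !mulr1 subrK.
have l1' : 0 <= 1 - l by rewrite subr_ge0.
have b0 := le_trans a0 ab.
rewrite exprSr; apply: le_trans (ler_wpM2r _ IHn) _.
  by rewrite addr_ge0 // mulr_ge0.
rewrite -subr_ge0.
have -> : (1 - l) * a ^+ n.+1 + l * b ^+ n.+1 -
   ((1 - l) * a ^+ n + l * b ^+ n) * ((1 - l) * a + l * b) =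
   l * (1 - l) * ((b ^+ n - a ^+ n) * (b - a)) by rewrite !exprSr; ring.
by rewrite !mulr_ge0 // subr_ge0 // lerXn2r.
Qed.

(* If [rho D(rho) < 1/e], then [x D(x) <= 1/e] still holds for some [x > rho],
   by convexity, and [T] would converge at [x]. *)
Lemma rho_D_sup e : 0 < e -> exists N, Einv - e < rho * ev D rho N.
Proof.
move=> e0; apply: contrapT => H.
have HN N : rho * ev D rho N <= Einv - e.
  by rewrite leNgt; apply/negP => h; apply: H; exists N.
pose B := rho1 * expR ((1 - rho1)^-1).
have r0 := rho_gt0; have r1 := lt_trans r0 rho_lt_rho1.
have B0 : 0 < B by rewrite mulr_gt0 // expR_gt0.
(* [B] bounds x D(x) at [rho1], so a share [l] of that point costs at most e, the slack assumed at
   [rho]. *)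
pose l := Num.min 2^-1 (e / B).
have l0 : 0 < l by rewrite lt_min invr_gt0 ltr0n /= divr_gt0.
have l1 : l <= 1 by rewrite ge_min; apply/orP; left; lra.
have lB : l * B <= e by rewrite -ler_pdivlMr // ge_min lexx orbT.
pose x := (1 - l) * rho + l * rho1.
have xr : rho < x.
  have -> : x = rho + l * (rho1 - rho) by rewrite /x; ring.
  by rewrite ltrDl mulr_gt0 // subr_gt0 rho_lt_rho1.
have x0 := ltW (lt_trans r0 xr).
have : polya_disc x.
  split=> //; apply/(cvgn_polyaP x0) => N.
  apply: (@le_trans _ _ ((1 - l) * (rho * ev D rho N) + l * (rho1 * ev D rho1 N))).
    rewrite /ev /wsum !big_distrr /= -big_split /=; apply: ler_sum => n _.
    have -> : (1 - l) * (rho * (rho ^+ n * D n)) + l * (rho1 * (rho1 ^+ n * D n)) =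
        ((1 - l) * rho ^+ n.+1 + l * rho1 ^+ n.+1) * D n by rewrite !exprS; ring.
    rewrite mulrA -exprS ler_wpM2r ?D_gf_ge0 //.
    by apply: convex_exp => //; rewrite ltW // rho_lt_rho1.
  apply: (@le_trans _ _ ((Einv - e) + l * B)); last by rewrite -lerBrDr lerD2l lerN2.
  apply: lerD; last by rewrite ler_wpM2l ?(ltW l0) // ler_wpM2l ?(ltW r1) // ev_D_rho1.
  apply: le_trans (HN N); rewrite ler_piMl ?gerBl ?(ltW l0) //.
  by rewrite mulr_ge0 ?(ltW r0) // ev_ge0 ?(ltW r0) //; exact: D_gf_ge0.
move/(ub_le_sup (has_sup_polya_disc).2); rewrite -/rho leNgt => /negP; apply.
exact: xr.
Qed.

Lemma D_rho : fps_eval D rho = Einv / rho.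
Proof.
have r0 := rho_gt0; apply/cvg_lim => //; apply/cvgrPdist_le => e e0.
have re : 0 < rho * e by rewrite mulr_gt0.
have [N HN] := rho_D_sup re; exists N => // n /= leNn.
have le : ev D rho n <= Einv / rho by rewrite ler_pdivlMr // mulrC rho_D_le.
rewrite pseries_ev ger0_norm ?subr_ge0 // lerBlDr -lerBlDl -(ler_pM2l r0).
have -> : rho * (Einv / rho - e) = Einv - rho * e by field; rewrite gt_eqF.
apply: le_trans (ltW HN) _; rewrite ler_pM2l //.
by apply: ev_mono => //; [exact: ltW|exact: D_gf_ge0].
Qed.

End RadiusValue.

(** * The size of a random D-forest *)

Section StepDistribution.
Variable R : realType.
Implicit Types (x y : R) (N n : nat).
Local Notation T := (polya_gf R).
Local Notation D := (D_gf R).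
Local Notation L := (log_D_gf R).
Local Notation Einv := (expR (-1) : R).
Local Notation rho := (polya_radius R).

(* The law of [1 + |F|] for a Boltzmann [D]-forest [F] at [rho]: by
   [D_rho], [step n = d_(n-1) rho^(n-1) / D(rho)]. *)
Definition step : fps R := Fps (fun n => expR 1 * (rho ^+ n * (fpsX R * D) n)).

Let r0 : 0 <= rho. Proof. exact: ltW (rho_gt0 R). Qed.

Lemma step0 : step 0%N = 0. Proof. by rewrite /= XD0 !mulr0. Qed.

Lemma stepS n : step n.+1 = expR 1 * rho * (rho ^+ n * D n).
Proof. by rewrite /step [LHS]/= coef_fpsXM exprS !mulrA. Qed.

Lemma step_ge0 : fps_ge0 step.
Proof. by move=> n; rewrite mulr_ge0 ?expR_ge0 // mulr_ge0 ?exprn_ge0 // XD_ge0. Qed.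

Lemma sum_step (g : nat -> R) N :
  \sum_(l < N.+1) g l * step l =
  expR 1 * rho * \sum_(j < N) g j.+1 * (rho ^+ j * D j).
Proof.
rewrite big_ord_recl step0 mulr0 add0r big_distrr; apply: eq_bigr => j _.
by rewrite stepS mulrCA.
Qed.

Lemma eD_le1 N : expR 1 * rho * ev D rho N <= 1.
Proof.
rewrite -mulrA; apply: (@le_trans _ _ (expR 1 * Einv)).
  by rewrite ler_wpM2l ?expR_ge0 // rho_D_le.
by rewrite -expRD subrr expR0.
Qed.

Lemma sum_step_le1 N : \sum_(l < N) step l <= 1.
Proof.
case: N => [|N]; first by rewrite big_ord0 ler01.
have := sum_step (fun=> 1) N; under eq_bigr do rewrite mul1r.
move=> ->; apply: le_trans (eD_le1 N); rewrite ler_wpM2l ?mulr_ge0 ?expR_ge0 //.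
by rewrite /ev /wsum; apply: ler_sum => j _; rewrite mul1r.
Qed.

Lemma sum_step_sup e : 0 < e -> exists N, forall N', (N <= N')%N ->
  1 - e < \sum_(l < N') step l.
Proof.
move=> e0; have e1 : 0 < e * Einv by rewrite mulr_gt0 ?expR_gt0.
have [N HN] := rho_D_sup e1; exists N.+1 => N' leN.
apply: (@lt_le_trans _ _ (\sum_(l < N.+1) step l)).
  have := sum_step (fun=> 1) N; under eq_bigr do rewrite mul1r.
  move=> ->; under eq_bigr do rewrite mul1r.
  rewrite -mulrA -/(wsum (fun n => rho ^+ n) D N) -/(ev D rho N).
  have -> : 1 - e = expR 1 * (Einv - e * Einv).
    rewrite mulrBr mulrCA -expRD subrr expR0 mulr1.
    by [].
  by rewrite ltr_pM2l ?expR_gt0.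
rewrite -!(big_mkord predT (fun l => step l)) [leRHS](big_cat_nat (n := N.+1)) //=.
by rewrite lerDl sumr_ge0 // => l _; exact: step_ge0.
Qed.

Lemma tailsE n : tails step n = 1 - \sum_(l < n.+1) step l.
Proof.
rewrite /tails mulrBr mulr1 coef_fpsB mulrC coef_fpsM; congr (_ - _).
by apply: eq_bigr => l _; rewrite mulr1.
Qed.

Lemma tails_ge0 : fps_ge0 (tails step).
Proof. by move=> n; rewrite tailsE subr_ge0 sum_step_le1. Qed.

(** Summation by parts, each tail being the sum of [step l] over l > j. The mass 1 is reached only
    in the limit, so the tails are truncated with error at most e / (G + 1) each. *)
Lemma sum_tails_le (g : nat -> R) B N : (forall j, 0 <= g j) ->
  (forall N', \sum_(l < N') (\sum_(j < l) g j) * step l <= B) ->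
  \sum_(j < N) g j * tails step j <= B.
Proof.
move=> g0 HB; apply/ler_addgt0Pr => e e0.
pose G := \sum_(j < N) g j; have G0 : 0 <= G by apply: sumr_ge0.
have e1 : 0 < e / (G + 1) by rewrite divr_gt0 // ltr_wpDl.
have [N1 HN1] := sum_step_sup e1; pose N' := maxn N1 N.
have {HN1} HN' := HN1 N' (leq_maxl _ _).
apply: (@le_trans _ _ (\sum_(j < N) g j * (e / (G + 1) + \sum_(l < N' | (j < l)%N) step l))).
  apply: ler_sum => j _; rewrite ler_wpM2l // tailsE lerBlDr -addrA.
  have -> : \sum_(l < N' | (j < l)%N) step l + \sum_(l < j.+1) step l = \sum_(l < N') step l.
    have ltj : (j < N')%N by rewrite (leq_trans (ltn_ord j)) // leq_maxr.
    rewrite (big_ord_widen N' (fun l => step l)) // [RHS](bigID (fun l : 'I_N' => (j < l)%N)) /=.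
    by congr (_ + _); apply: eq_bigl => l; rewrite -leqNgt ltnS.
  by rewrite addrC -lerBlDr ltW.
under eq_bigr do rewrite mulrDr.
rewrite big_split -big_distrl /= -/G addrC lerD //.
  apply: le_trans (HB N').
  under [leRHS]eq_bigr do rewrite big_distrl /=.
  under eq_bigr do rewrite big_distrr /= big_mkcond /=.
  rewrite exchange_big; apply: ler_sum => l _ /=.
  rewrite -big_mkcond /=.
  rewrite (big_ord_widen_cond (N + l) (fun j => j < l)%N (fun j => g j * step l)) ?leq_addr //.
  rewrite (big_ord_widen (N + l) (fun j => g j * step l)) ?leq_addl //.
  rewrite big_mkcond [leRHS]big_mkcond; apply: ler_sum => j _.
  have h0 : 0 <= g j * step l by rewrite mulr_ge0 //; exact: step_ge0.
  by case: ifP => [/andP[->]//|_]; case: ifP.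
by rewrite mulrCA ler_piMr ?(ltW e0) // ler_pdivrMr ?mul1r ?lerDl // ltr_wpDl.
Qed.

(** Bounds the mean size rho D'(rho) / D(rho) of a Boltzmann D-forest, that is theta log D at [rho];
    it is below 1 because rho < 1/2. *)
Definition mean_bound : R := rho / (1 - rho).

Lemma mean_bound_lt1 : mean_bound < 1.
Proof.
have := rho_lt_half R; have := rho_gt0 R => h1 h2; rewrite /mean_bound ltr_pdivrMr; lra.
Qed.

Lemma theta_log_D : fps_theta L = dilated_sum (fun=> 1) (fps_theta T).
Proof.
apply/fpsP => n; rewrite -[LHS]/(n%:R * _) big_distrr /=.
rewrite big_nat_cond [RHS]big_nat_cond; apply: eq_bigr => i /andP[/andP[i2 _] _].
rewrite mul1r; case: ifP => [/dvdnP[a ->]|_]; last by rewrite mul0r mulr0.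
rewrite mulnK; last exact: ltnW.
have i0 : i%:R != 0 :> R by rewrite pnatr_eq0 -lt0n ltnW.
by rewrite natrM; field.
Qed.

Lemma nat_exp_le (s : R) n : 0 <= s -> s <= 2^-1 -> n%:R * s ^+ n <= s.
Proof.
move=> s0 s1; case: n => [|n]; first by rewrite mul0r.
rewrite exprS mulrCA ler_piMr //.
apply: (@le_trans _ _ (n.+1%:R * 2^-1 ^+ n)).
  by rewrite ler_wpM2l // lerXn2r ?nnegrE // invr_ge0.
by rewrite exprVn ler_pdivrMr ?exprn_gt0 // mul1r -natrX ler_nat ltn_expl.
Qed.

(** Term i is the sum of a t_a rho^(i a). With s = rho^(i-1) <= 1/2 one has a s^a <= s, so it is at
    most s T(rho) <= rho^(i-1); summing over i >= 2 gives rho / (1 - rho). *)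
Lemma ev_theta_log_D_le N : ev (fps_theta L) rho N <= mean_bound.
Proof.
have r1 : rho < 1 by have := rho_lt_half R; lra.
rewrite theta_log_D.
apply: le_trans (ev_dilated_sum_le N (fun=> ler01) r0 (fps_ge0_theta (@polya_gf_ge0 R))) _.
apply: (@le_trans _ _ (rho * \sum_(2 <= i < N) rho ^+ (i - 2))); last first.
  by rewrite /mean_bound ler_wpM2l // geometric_le.
rewrite big_distrr /= big_nat_cond [leRHS]big_nat_cond.
apply: ler_sum => i /andP[/andP[i2 _] _]; rewrite mul1r -exprS.
have -> : (i - 2).+1 = i.-1 by lia.
have si : rho ^+ i.-1 <= 2^-1.
  have -> : i.-1 = (i - 2).+1 by lia.
  rewrite exprS; apply: (@le_trans _ _ rho); last by rewrite ltW // rho_lt_half.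
  by rewrite ler_piMr // exprn_ile1 // ltW.
have s0 : 0 <= rho ^+ i.-1 by rewrite exprn_ge0.
apply: (@le_trans _ _ (rho ^+ i.-1 * ev T rho N)); last first.
  by rewrite ler_piMr // rho_T_le.
rewrite /ev /wsum big_distrr /=; apply: ler_sum => a _.
rewrite -[i in (_ ^+ i) ^+ _]prednK; last exact: ltnW.
rewrite exprS exprMn mulrA [_ * a%:R]mulrC !mulrA ler_wpM2r //.
rewrite [a%:R * _]mulrC -mulrA [leRHS]mulrC ler_wpM2l ?exprn_ge0 //.
exact: nat_exp_le.
Qed.

Lemma sum_step_mean N : \sum_(l < N) l.-1%:R * step l <= mean_bound.
Proof.
have mb0 : 0 <= mean_bound.
  by rewrite /mean_bound divr_ge0 // subr_ge0; have := rho_lt_half R; lra.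
case: N => [|N]; first by rewrite big_ord0.
rewrite (sum_step (fun l => l.-1%:R)).
have -> : \sum_(j < N) j.+1.-1%:R * (rho ^+ j * D j) = ev (fps_theta D) rho N.
  by apply: eq_bigr => j _; rewrite mulrCA.
have DE : fps_theta D = D * fps_theta L by rewrite fps_theta_exp ?log_D_gf0.
rewrite DE; apply: (@le_trans _ _ (expR 1 * rho * (ev D rho N * ev (fps_theta L) rho N))).
  rewrite ler_wpM2l ?mulr_ge0 ?expR_ge0 //; apply: evM_le => //; first exact: D_gf_ge0.
  exact/fps_ge0_theta/log_D_gf_ge0.
rewrite mulrA; apply: le_trans (ev_theta_log_D_le N).
rewrite ler_piMl ?eD_le1 // ev_ge0 //.
exact/fps_ge0_theta/log_D_gf_ge0.
Qed.

Definition moment_bound : R := expR 1 * rho * (10 ^+ 3 * expR ((1 - rho1 R)^-1)).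

Lemma cube_le j : j.+1%:R ^+ 3 * rho ^+ j <= 10 ^+ 3 * rho1 R ^+ j.
Proof.
rewrite /rho1 exprMn mulrCA mulrC ler_wpM2l ?exprn_ge0 // -exprM mulnC exprM.
have b10 : 0 <= (11 / 10 : R) by lra.
rewrite -exprMn lerXn2r ?nnegrE ?mulr_ge0 ?exprn_ge0 //.
have := bernoulli j (ltac:(lra) : 0 <= 1 / 10 :> R).
have -> : 1 + 1 / 10 = 11 / 10 :> R by field.
have j0 : 0 <= j%:R :> R by [].
by rewrite -[j.+1%:R]natr1; lra.
Qed.

Lemma sum_step_moment3 N : \sum_(l < N) l%:R ^+ 3 * step l <= moment_bound.
Proof.
have er0 : 0 <= expR 1 * rho by rewrite mulr_ge0 ?expR_ge0.
have mb0 : 0 <= moment_bound.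
  exact: mulr_ge0 er0 (mulr_ge0 (exprn_ge0 3 (ler0n _ 10)) (expR_ge0 _)).
case: N => [|N]; first by rewrite big_ord0.
rewrite (sum_step (fun l => l%:R ^+ 3)) /moment_bound; apply: (ler_wpM2l er0).
apply: (@le_trans _ _ (10 ^+ 3 * ev D (rho1 R) N)); last first.
  by rewrite ler_wpM2l ?exprn_ge0 ?ler0n ?ev_D_rho1.
rewrite /ev /wsum big_distrr /=; apply: ler_sum => j _.
by rewrite !mulrA ler_wpM2r ?cube_le //; exact: D_gf_ge0.
Qed.

Lemma step_moment2 N : wsum (fun j => j%:R ^+ 2) step N <= moment_bound.
Proof.
apply: le_trans (sum_step_moment3 N); apply: ler_sum => l _.
rewrite ler_wpM2r ?step_ge0 // -!natrX ler_nat.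
by case: (nat_of_ord l) => // a; rewrite leq_pexp2l.
Qed.

(** A second moment of the tails is controlled by a third moment of the law: the sum of (1 + j)^2
    over j < l is at most l^3. *)
Lemma tails_moment2 N : wsum (fun j => (1 + j%:R) ^+ 2) (tails step) N <= moment_bound.
Proof.
apply: (@sum_tails_le (fun j => (1 + j%:R) ^+ 2)) => [j|N']; first exact: sqr_ge0.
apply: le_trans (sum_step_moment3 N'); apply: ler_sum => l _.
rewrite ler_wpM2r ?step_ge0 //.
apply: (@le_trans _ _ (\sum_(j < l) l%:R ^+ 2)); last first.
  by rewrite sumr_const card_ord -[leLHS]mulr_natl -exprS.
by apply: ler_sum => j _; rewrite lerXn2r ?nnegrE ?addr_ge0 // nat1r ler_nat.
Qed.

Lemma tails_mean N : wsum (fun=> 1) (tails step - 1) N <= mean_bound.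
Proof.
have -> : wsum (fun=> 1) (tails step - 1) N = \sum_(j < N) (j != 0 :> nat)%:R * tails step j.
  apply: eq_bigr => -[[|j] ltj] _; rewrite mul1r coef_fpsB coef_fps1 /=.
    by rewrite tailsE big_ord1 step0 subr0 subrr mul0r.
  by rewrite subr0 mul1r.
apply: (@sum_tails_le (fun j => (j != 0 :> nat)%:R)) => [j|N']; first exact: ler0n.
apply: le_trans (sum_step_mean N'); apply: ler_sum => -[[|l] ltl] _ /=.
  by rewrite big_ord0 mul0r.
rewrite ler_wpM2r ?step_ge0 // big_ord_recl /= add0r.
by rewrite (eq_bigr (fun=> 1)) // sumr_const card_ord.
Qed.

Lemma step_ratio m :
  let B1 := fps_comp (Fps (fun j => renewal_weight R j.+1)) step in
  exists K, forall n, (0 < n)%N ->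
    0 < (step * B1) n /\
    `|(fpsX R ^+ m.+1 * B1) n - (step * B1) n| <= K / n%:R * (step * B1) n.
Proof.
apply: (@renewal_ratio _ step (renewal_weight R) mean_bound moment_bound).
- exact: step0.
- exact: step_ge0.
- exact: tails_ge0.
- exact: mean_bound_lt1.
- exact: tails_mean.
- exact: tails_moment2.
- exact: step_moment2.
- exact: renewal_weight_gt0.
- exact: renewal_weight_noninc.
- exact: renewal_weight_nondec.
Qed.

End StepDistribution.

(** * Weights of nodes as coefficients of a renewal series *)

Section Weights.
Variable R : realType.
Local Notation PR := {poly R}.
Local Notation D := (D_gf R).
Local Notation rho := (polya_radius R).

Definition deriv_at1 (p : PR) : R := (deriv p).[1].

Lemma deriv_at1M p q :
  deriv_at1 (p * q) = deriv_at1 p * q.[1] + p.[1] * deriv_at1 q.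
Proof. by rewrite /deriv_at1 derivM hornerD !hornerM. Qed.

Lemma deriv_at1_sum (I : Type) (r : seq I) (P : pred I) (F : I -> PR) :
  deriv_at1 (\sum_(i <- r | P i) F i) = \sum_(i <- r | P i) deriv_at1 (F i).
Proof. by rewrite /deriv_at1 raddf_sum horner_sum. Qed.

Lemma map_deriv_at1M (F G : fps PR) :
  map_fps deriv_at1 (F * G) =
  map_fps deriv_at1 F * map_fps (horner_eval 1) G +
  map_fps (horner_eval 1) F * map_fps deriv_at1 G.
Proof.
apply/fpsP => n; rewrite coef_fpsD !coef_fpsM [LHS]/= coef_fpsM deriv_at1_sum -big_split.
by apply: eq_bigr => i _; rewrite deriv_at1M.
Qed.

Lemma map_deriv_at1X (F : fps PR) k :
  map_fps deriv_at1 (F ^+ k) =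
  map_fps deriv_at1 F * map_fps (horner_eval 1) F ^+ k.-1 *+ k.
Proof.
elim: k => [|k IHk].
  apply/fpsP => n; rewrite mulr0n expr0 /= /deriv_at1 -polyC_natr derivC.
  exact: horner0.
rewrite exprS map_deriv_at1M IHk map_fps_exp [in RHS]mulrS; congr (_ + _).
by case: k {IHk} => [|k]; rewrite ?mulr0n ?mulr0 // mulrnAr mulrCA -exprS.
Qed.

Lemma map_deriv_at1_sized m :
  map_fps deriv_at1 (egf (sized_moved_forest R m)) = fpsC (D m) * fpsX R ^+ m.
Proof.
apply/fpsP => n; rewrite -[LHS]/(deriv_at1 (egf (sized_moved_forest R m) n)).
rewrite egf_sized_moved_forest egf_moved_forest coef_fpsCM.
have -> : (fpsX R ^+ m) n = (n == m)%:R.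
  rewrite -[_ ^+ m]mulr1 coef_fpsXnM coef_fps1 subn_eq0.
  by rewrite [in RHS]eqn_leq andbC; case: leqP.
rewrite -[map_fps _ _ _]/((D n)%:P) /deriv_at1.
case: eqP => [->|_]; rewrite ![nat_of_bool _]/=.
  by rewrite expr1 mulrC mul_polyC derivZ derivX hornerZ hornerC.
by rewrite expr0 mul1r derivC horner0 mulr0.
Qed.

Lemma weight_deriv m n :
  weight R (fun (t : rtree n) s v => #|Dforest t s v| == m) =
  deriv_at1 (marked_gf R m n).
Proof.
rewrite /weight deriv_at1_sum; apply: eq_bigr => T _.
rewrite /deriv_at1 derivZ hornerZ -/(deriv_at1 _) deriv_at1_sum big_distrr.
apply: eq_bigr => s _; rewrite /deriv_at1 derivXn hornerMn hornerXn expr1n /=.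
rewrite sumr_const mulr_natr; congr (_ *+ _).
by rewrite cardsE.
Qed.

(** A D-forest has at most n nodes, so the sizes up to n exhaust all cases. Summing the numerators
    over m then yields the denominator, since the terms p_(m+1) x^(m+1) add up to phi. *)
Lemma weight_total n :
  weight R (fun (t : rtree n) _ _ => true) =
  \sum_(m < n.+1) weight R (fun (t : rtree n) s v => #|Dforest t s v| == m).
Proof.
rewrite /weight exchange_big; apply: eq_bigr => T _.
rewrite exchange_big; apply: eq_bigr => s _ /=.
rewrite (partition_big (fun v => inord #|Dforest (repr T) s v| : 'I_n.+1) predT) //=.
apply: eq_bigr => m _; apply: eq_bigl => v; rewrite andbT -val_eqE /= inordK //.
by rewrite ltnS -[X in (_ <= X)%N]card_ord max_card.
Qed.

(** The chain rule for C(w) at u = 1: w becomes z D and its u-derivative d_m z^(m+1). *)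
Lemma weightE m n :
  weight R (fun (t : rtree n) s v => #|Dforest t s v| == m) =
  \sum_(k < n) k.+1%:R * cayley_coef R k.+1 *
    (D m * (fpsX R ^+ m.+1 * (fpsX R * D) ^+ k) n).
Proof.
rewrite weight_deriv (marked_gf_comp m (cayley_eq R)) coef_fps_comp deriv_at1_sum.
rewrite big_ord_recl deriv_at1M.
have C0 (c : R) : deriv_at1 c%:P = 0 by rewrite /deriv_at1 derivC horner0.
rewrite C0 mul0r add0r hornerC -[Fps _ ord0]/(cayley_coef R 0) cayley_coef_at0 mul0r add0r.
apply: eq_bigr => k _; rewrite deriv_at1M C0 mul0r add0r hornerC.
rewrite -[deriv_at1 _]/(map_fps deriv_at1 _ n) map_deriv_at1X.
rewrite map_deriv_at1M map_fpsM map_fpsX map_horner_sized map_deriv_at1_sized.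
have -> : map_fps deriv_at1 (fpsX PR) = 0.
  by apply/fpsP => l; rewrite /= -polyC_natr C0.
rewrite mul0r add0r coef_fpsMn /= -[in RHS]coef_fpsCM.
rewrite /bump /= add0n add1n [k.+1%:R * _]mulrC -[RHS]mulrA mulr_natl.
by congr (_ * (_ n *+ _)); rewrite mulrCA -exprS mulrA.
Qed.

Let B1 := fps_comp (Fps (fun j => renewal_weight R j.+1)) (step R).

Lemma stepX k n : (step R ^+ k) n = expR k%:R * (rho ^+ n * ((fpsX R * D) ^+ k) n).
Proof.
elim: k n => [|k IHk] n.
  by rewrite !expr0 coef_fps1 expR0 mul1r; case: n => [|n]; rewrite ?mulr0 ?expr0 ?mul1r.
rewrite !exprS !coef_fpsM !big_distrr /=; apply: eq_bigr => i _; rewrite IHk.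
have -> : rho ^+ n = rho ^+ i * rho ^+ (n - i) by rewrite -exprD subnKC // -ltnS.
rewrite -[k.+1%:R]natr1 expRD; ring.
Qed.

(** In the sum, (k + 1) C_(k+1) = b_(k+1) e^(k+1). One factor e and rho^(m+1) go into [step R m.+1];
    e^k and rho^(n-m-1) go into the k-th power of [step R]. *)
Lemma weight_step m n :
  weight R (fun (t : rtree n) s v => #|Dforest t s v| == m) * rho ^+ n =
  step R m.+1 * (fpsX R ^+ m.+1 * B1) n.
Proof.
rewrite weightE coef_fpsXnM; case: (leqP m.+1 n) => [lemn|ltnm]; last first.
  rewrite mulr0 big1 ?mul0r // => k _.
  by rewrite coef_fpsXnM leqNgt ltnm !mulr0.
have n0 : (0 < n)%N by apply: leq_trans lemn.
rewrite (@coef_fps_comp_bound _ _ _ _ n.-1 (step0 R)); last by lia.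
rewrite prednK // big_distrl big_distrr; apply: eq_bigr => k _.
rewrite -[Fps _ k]/(renewal_weight R k.+1) coef_fpsXnM lemn renewal_weightE // stepX stepS.
have -> : rho ^+ n = rho * rho ^+ m * rho ^+ (n - m.+1).
  by rewrite -exprS -exprD subnKC.
rewrite -[k.+1%:R]natr1 expRD -[LHS]/(_ * _) -[RHS]/(_ * _); ring.
Qed.

Lemma weight_total_step n :
  weight R (fun (t : rtree n) _ _ => true) * rho ^+ n = (step R * B1) n.
Proof.
rewrite weight_total big_distrl /=.
under eq_bigr do rewrite weight_step.
rewrite big_ord_recr /= coef_fpsXnM ltnn mulr0 addr0.
rewrite coef_fpsM big_ord_recl step0 mul0r add0r; apply: eq_bigr => m _.
by rewrite coef_fpsXnM ltn_ord.
Qed.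

Lemma prob_Dforest_sizeE m n :
  prob_Dforest_size R n m =
  step R m.+1 * ((fpsX R ^+ m.+1 * B1) n / (step R * B1) n).
Proof.
have rn : rho ^+ n != 0 by rewrite expf_neq0 // gt_eqF // rho_gt0.
rewrite /prob_Dforest_size /prob_Cnode mulrA -weight_step -weight_total_step.
by rewrite invfM mulrACA mulfV // mulr1.
Qed.

Lemma step_rho m : step R m.+1 = D m * rho ^+ m / fps_eval D rho.
Proof.
have r0 := rho_gt0 R; rewrite stepS D_rho expRN; field.
by rewrite !gt_eqF ?expR_gt0.
Qed.

End Weights.

Local Open Scope classical_set_scope.

Theorem theorem4 (R : realType) (m : nat) (C : fps R)
    (hC : C = fpsX R * fps_exp C) :
  (let D := map_fps polyC (D_gf R) in
   let z := fpsX {poly R} in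
   let u := fpsC ('X : {poly R}) in
   let dm := fpsC (D m) in
   marked_gf R m =
     fps_comp (map_fps polyC C)
       (u * z * (dm * z ^+ m) + z * (D - dm * z ^+ m)))
  /\
  (let D := D_gf R in
   let rho := polya_radius R in
   exists e : nat -> R,
     e =O_\oo (fun n : nat => n%:R^-1 : R) /\
     (\forall n \near \oo,
        prob_Dforest_size R n m = D m * rho ^+ m / fps_eval D rho * (1 + e n))).
Proof.
split=> D; first by move=> z u dm; rewrite marked_argE -marked_gf_comp.
move=> rho; have [K HK] := step_ratio R m.
pose B1 := fps_comp (Fps (fun j => renewal_weight R j.+1)) (step R).
exists (fun n => (fpsX R ^+ m.+1 * B1) n / (step R * B1) n - 1); split; last first.
  exists 1%N => // n _.
  by rewrite prob_Dforest_sizeE -step_rho addrCA subrr addr0.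
apply/eqO_exP; exists (`|K| + 1); first by rewrite ltr_wpDl.
exists 1%N => // n /= n1; have [y0 Hy] := HK n n1; rewrite -/B1 in y0 Hy.
rewrite -[X in _ - X](mulfV (lt0r_neq0 y0)) -mulrBl normrM.
rewrite [X in _ * X]gtr0_norm ?invr_gt0 // ler_pdivrMr //.
apply: le_trans Hy _; rewrite ler_wpM2r ?(ltW y0) //.
rewrite [`|n%:R^-1|]ger0_norm ?invr_ge0 // ler_wpM2r ?invr_ge0 //.
by rewrite (le_trans (ler_norm _)) // lerDl.
Qed.
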